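(* Let $p,q\ge2$ be integers and suppose $(\beta,h)\in\Theta$ is a critical point. Let $\boldsymbol m_1,\dots,\boldsymbol m_K$ be the global maximizers of $H_{\beta,h}$, arranged in ascending order of their first coordinates, with weights $p_1,\dots,p_K$ given by $p_k=\tau(\boldsymbol m_k)/\sum_{i=1}^K\tau(\boldsymbol m_i)$. Let $\boldsymbol X\sim\mathbb P_{\beta,h,N}$, with $\beta$ known, and let $\hat h_N$ be the maximum likelihood estimator of $h$. For $s$ a global maximizer of $f_{\beta,h}$ write $\rho(s)=k''\left(\frac{1+(q-1)s}{q}\right)/k''\left(\frac{1-s}{q}\right)$. Then, as $N\to\infty$: (1) If $(\beta,h)\in\mathcal C^1_{p,q}\setminus\{(\beta_c,0)\}$, then $f_{\beta,h}$ has exactly two global maximizers $s_2>s_1>0$, and $$N^{1/2}(\hat h_N-h)\xrightarrow{D}\frac{p_1}2\mathcal N^-\left(0,-\frac{q^2}{(q-1)^2}f''_{\beta,h}(s_1)\right)+\frac{1-p_1}2\mathcal N^+\left(0,-\frac{q^2}{(q-1)^2}f''_{\beta,h}(s_2)\right)+\frac12\delta_0.$$ (2) If $(\beta,h)\in\mathcal C^2_{p,q}$, then $f_{\beta,h}$ has exactly one global maximizer $s>0$, and $$N^{1/2}(\hat h_N-h)\xrightarrow{D}\frac{1-p_q}2\mathcal N^-\left(0,-\frac{q^2f''_{\beta,h}(s)}{(q-1)(1+(q-2)\rho(s))}\right)+\frac{p_q}2\mathcal N^+\left(0,-\frac{q^2}{(q-1)^2}f''_{\beta,h}(s)\right)+\frac12\delta_0.$$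 (3) If $(\beta,h)=(\beta_c,0)$, then $f_{\beta,h}$ has exactly two global maximizers, $0$ and $s>0$, and $$N^{1/2}(\hat h_N-h)\xrightarrow{D}\frac{(1-p_q)(q-1)}{2q}\mathcal N^-\left(0,-\frac{q^2f''_{\beta,h}(s)}{(q-1)(1+(q-2)\rho(s))}\right)+\frac{1-p_q}{2q}\mathcal N^+\left(0,-\frac{q^2}{(q-1)^2}f''_{\beta,h}(s)\right)+\frac{1+p_q}2\delta_0.$$
   Context: For real $\beta,h$ and $N\ge1$, $\mathbb P_{\beta,h,N}$ is the probability measure on $\{1,\dots,q\}^N$ with $\mathbb P_{\beta,h,N}(\boldsymbol X)\propto\exp\left(\beta N\sum_{r=1}^q\bar X_{\cdot r}^p+Nh\bar X_{\cdot1}\right)$, where $\bar X_{\cdot r}=N^{-1}\#\{i:X_i=r\}$; $\mathbb E_{\beta,h,N}$ is its expectation. $\Theta=(0,\infty)\times[0,\infty)$. For known $\beta$ and one sample $\boldsymbol X$, $\hat h_N$ maximizes the likelihood $h'\mapsto\mathbb P_{\beta,h',N}(\boldsymbol X)$ over $h'\in\mathbb R$; equivalently it is the solution in $h'$ of $\mathbb E_{\beta,h',N}(\bar X_{\cdot1})=\bar X_{\cdot1}$ (the left side is strictly increasing in $h'$; if there is no finite solution, $\hat h_N=\pm\infty$ according to where the supremum of the likelihood is approached). On the set $\mathcal P_q$ of probability vectors in $\mathbb R^q$, $H_{\beta,h}(\boldsymbol t)=\beta\sum_r t_r^p+ht_1-\sum_r t_r\log t_r$. For $s\in[0,1]$,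 $\boldsymbol x_s=\left(\frac{1+(q-1)s}{q},\frac{1-s}{q},\dots,\frac{1-s}{q}\right)$, $f_{\beta,h}(s)=H_{\beta,h}(\boldsymbol x_s)$, $k(x)=\beta x^p-x\log x$. Every global maximizer $\boldsymbol m_i$ of $H_{\beta,h}$ is a permutation of $\boldsymbol x_{s_i}$ for a unique $s_i\in[0,1)$, and $\tau(\boldsymbol m_i)=\sqrt{-f''_{\beta,h}(s_i)^{-1}\left(-k''\left(\frac{1-s_i}{q}\right)\right)^{2-q}\big/\prod_{r=1}^qm_{i,r}}$. With $\boldsymbol Q_{\boldsymbol v,\beta}(\boldsymbol t)=\sum_{r=1}^q\left(\beta p(p-1)v_r^{p-2}-\frac1{v_r}\right)t_r^2$ and $\mathcal H_q=\{\boldsymbol t\in\mathbb R^q:\sum_r t_r=0\}$, the point $(\beta,h)$ is critical if $H_{\beta,h}$ has more than one global maximizer and $\boldsymbol Q_{\boldsymbol m,\beta}$ is negative definite on $\mathcal H_q$ for each global maximizer $\boldsymbol m$. A critical point is strongly critical (set $\mathcal C^1_{p,q}$) if $f_{\beta,h}$ has more than one global maximizer on $[0,1]$, and weakly critical (set $\mathcal C^2_{p,q}$) if $f_{\beta,h}$ has a unique global maximizer. $\beta_c=\beta_c(p,q)=\inf\{\beta\ge0:f_{\beta,0}\text{ has a positive global maximizer}\}\in(0,\infty)$. $\mathcal N^{+}(0,\sigma^2)$ and $\mathcal N^-(0,\sigma^2)$ are the laws of $|Z|$ and $-|Z|$ for $Z\sim\mathcal N(0,\sigma^2)$; the right-hand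 sides are mixtures of probability measures. *)

(* Defs.v *)
From HB Require Import structures.
From mathcomp Require Import all_boot all_order all_algebra.
From mathcomp Require Import all_classical all_reals all_analysis.

Set Implicit Arguments.
Unset Strict Implicit.
Unset Printing Implicit Defensive.

Import Order.TTheory GRing.Theory Num.Theory.
Import numFieldNormedType.Exports.

Local Open Scope classical_set_scope.
Local Open Scope ring_scope.

(* Vectors of R^q are q-tuples [t] and the colours 1, ..., q are 'I_q, so that
   the first coordinate t_1 of the mathematical text is [t`_0]. *)

Definition freq (R : realType) (q N : nat) (X : {ffun 'I_N -> 'I_q}) :
    q.-tuple R :=
  [tuple #|[pred i | X i == r]|%:R / N%:R | r < q].

Definition gibbs_weight (R : realType) (p q : nat) (beta h : R) (N : nat)
    (X : {ffun 'I_N -> 'I_q}) : R :=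
  expR (beta * N%:R * \sum_(x <- freq R X) x ^+ p + N%:R * h * (freq R X)`_0).

Definition gibbs (R : realType) (p q : nat) (beta h : R) (N : nat)
    (X : {ffun 'I_N -> 'I_q}) : R :=
  gibbs_weight p beta h X /
  \sum_(Z : {ffun 'I_N -> 'I_q}) gibbs_weight p beta h Z.

Definition is_mle (R : realType) (p q : nat) (beta : R) (N : nat)
    (X : {ffun 'I_N -> 'I_q}) (e : \bar R) : Prop :=
  let L := fun h' : R => gibbs p beta h' X in
  let no_max := ~ exists h0, forall h', L h' <= L h0 in
  match e with
  | EFin h0 => forall h', L h' <= L h0
  | +oo%E => no_max /\ L h' @[h' --> +oo] --> sup (range L)
  | -oo%E => no_max /\ L h' @[h' --> -oo] --> sup (range L)
  end.

(* For N >= 1 and q >= 2 exactly one value satisfies [is_mle], so the default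
   value 0 is never used. *)
Definition mle (R : realType) (p q : nat) (beta : R) (N : nat)
    (X : {ffun 'I_N -> 'I_q}) : \bar R :=
  xget 0%E [set e | is_mle p beta X e].

Definition Theta (R : realType) : set (R * R) :=
  [set bh | 0 < bh.1 /\ 0 <= bh.2].

Definition prob_vec (R : realType) (q : nat) : set (q.-tuple R) :=
  [set t | (forall r, 0 <= tnth t r) /\ \sum_(x <- t) x = 1].

(* [ln 0 = 0] in the library, hence 0 * ln 0 = 0 as required. *)
Definition potts_H (R : realType) (p q : nat) (beta h : R) (t : q.-tuple R) : R :=
  beta * \sum_(x <- t) x ^+ p + h * t`_0 - \sum_(x <- t) x * ln x.

Definition H_maximizers (R : realType) (p q : nat) (beta h : R) :
    set (q.-tuple R) :=
  [set m | prob_vec m /\ forall t : q.-tuple R, prob_vec t ->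
                           potts_H p beta h t <= potts_H p beta h m].

Arguments H_maximizers {R}.

Definition xvec (R : realType) (q : nat) (s : R) : q.-tuple R :=
  [tuple if r == 0%N :> nat then (1 + (q%:R - 1) * s) / q%:R
         else (1 - s) / q%:R | r < q].

(* For s in ]-1/(q-1), 1[ all coordinates of [xvec q s] are positive, so that the
   two-sided derivatives of [potts_f] also make sense at s = 0. *)
Definition potts_f (R : realType) (p q : nat) (beta h : R) (s : R) : R :=
  potts_H p beta h (xvec q s).

Definition f_maximizers (R : realType) (p q : nat) (beta h : R) : set R :=
  [set s | 0 <= s <= 1 /\
           forall u, 0 <= u <= 1 ->
             potts_f p q beta h u <= potts_f p q beta h s].

Definition potts_k (R : realType) (p : nat) (beta : R) (x : R) : R :=
  beta * x ^+ p - x * ln x.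

Definition potts_f2 (R : realType) (p q : nat) (beta h : R) : R -> R :=
  ((potts_f p q beta h)^`(2))%classic.

Definition potts_k2 (R : realType) (p : nat) (beta : R) : R -> R :=
  ((potts_k p beta)^`(2))%classic.

Definition s_of (R : realType) (q : nat) (m : q.-tuple R) : R :=
  xget 0 [set s | 0 <= s < 1 /\ perm_eq m (xvec q s)].

Definition tau (R : realType) (p q : nat) (beta h : R) (m : q.-tuple R) : R :=
  let s := s_of m in
  Num.sqrt (- (potts_f2 p q beta h s)^-1
            * (- potts_k2 p beta ((1 - s) / q%:R)) ^ (2 - q%:Z)
            / \prod_(x <- m) x).

Definition rho (R : realType) (p q : nat) (beta : R) (s : R) : R :=
  potts_k2 p beta ((1 + (q%:R - 1) * s) / q%:R) / potts_k2 p beta ((1 - s) / q%:R).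

Definition potts_Q (R : realType) (p q : nat) (beta : R) (v t : q.-tuple R) : R :=
  \sum_(r < q) (beta * p%:R * (p%:R - 1) * tnth v r ^+ (p - 2)
                - (tnth v r)^-1) * tnth t r ^+ 2.

Definition critical (R : realType) (p q : nat) (beta h : R) : Prop :=
  (exists m m', [/\ H_maximizers p q beta h m,
                    H_maximizers p q beta h m' & m <> m']) /\
  (forall m, H_maximizers p q beta h m ->
   forall t : q.-tuple R, \sum_(x <- t) x = 0 -> t <> [tuple 0 | _ < q] ->
   potts_Q p beta m t < 0).

Definition strongly_critical (R : realType) (p q : nat) (beta h : R) : Prop :=
  critical p q beta h /\
  exists s s', [/\ f_maximizers p q beta h s,
                   f_maximizers p q beta h s' & s <> s'].

Definition weakly_critical (R : realType) (p q : nat) (beta h : R) : Prop :=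
  critical p q beta h /\ exists! s, f_maximizers p q beta h s.

Definition beta_c (R : realType) (p q : nat) : R :=
  inf [set beta : R | 0 <= beta /\
                      exists s, 0 < s /\ f_maximizers p q beta 0 s].

Definition lists_maximizers (R : realType) (p q : nat) (beta h : R)
    (ms : seq (q.-tuple R)) : Prop :=
  [/\ uniq ms,
      forall m, m \in ms <-> H_maximizers p q beta h m
    & sorted (fun u v : q.-tuple R => u`_0 <= v`_0) ms].

(* p_i, with i counted from 1. *)
Definition weight (R : realType) (p q : nat) (beta h : R)
    (ms : seq (q.-tuple R)) (i : nat) : R :=
  [seq tau p beta h m | m <- ms]`_i.-1 / \sum_(m <- ms) tau p beta h m.

(* N^+(0, v) and N^-(0, v) as functions of the variance v > 0; the scale
   parameter of [normal_prob] is the standard deviation. *)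
Definition half_normal_pos (R : realType) (v : R) : set R -> \bar R :=
  pushforward (normal_prob 0 (Num.sqrt v)) (fun z : R => `|z|).

Definition half_normal_neg (R : realType) (v : R) : set R -> \bar R :=
  pushforward (normal_prob 0 (Num.sqrt v)) (fun z : R => - `|z|).

Definition mixture (R : realType) (a v b w c : R) : set R -> \bar R :=
  fun A => (a%:E * half_normal_neg v A + b%:E * half_normal_pos w A
            + c%:E * \d_(0%R : R) A)%E.

(* Convergence in distribution, to a law mu on R, of extended-real random
   variables Y N on finite probability spaces with mass functions P N: the
   distribution functions converge at every continuity point of the limit. *)
Definition cvg_in_law (R : realType) (Omega : nat -> finType)
    (P : forall N, Omega N -> R) (Y : forall N, Omega N -> \bar R)
    (mu : set R -> \bar R) : Prop :=
  let F := fun x : R => fine (mu `]-oo, x]%classic) in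
  forall x : R, {for x, continuous F} ->
    \sum_(w : Omega N | (Y N w <= x%:E)%E) P N w @[N --> \oo] --> F x.

Definition mle_cvg_in_law (R : realType) (p q : nat) (beta h : R)
    (mu : set R -> \bar R) : Prop :=
  cvg_in_law (Omega := fun N => {ffun 'I_N -> 'I_q})
    (fun N X => gibbs p beta h X)
    (fun N X => (Num.sqrt (N%:R : R))%:E * (mle p beta X - h%:E))%E mu.

(* Main.v *)
From HB Require Import structures.
From mathcomp Require Import all_boot all_order all_algebra.
From mathcomp Require Import all_classical all_reals all_analysis.
From mathcomp Require Import measurable_realfun perm zify ring lra.
Require Import Defs.

(** Write q = n + 2.  The proof has three layers: a local limit theorem for the
colour counts, the passage from the counts to the estimator, and the
description of the maximizers of H.

Local limit.  The number of words with given colour counts is a multinomial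
coefficient, so a sum over words of a product of functions of the counts is a
coefficient of a product of exponential generating functions ([sum_words]).
Around a maximizer m, each factor, once the factorial is replaced by its
Stirling approximation, is a function of the count that looks Gaussian on the
scale sqrt N around N m_r, with precision -k''(m_r) ([loc_local_gauss]).  This shape, called
[local_gauss], is stable under convolution as long as the sum of the two
precisions is positive ([local_gauss_conv]), which tolerates a factor with
k'' > 0: one coordinate of a maximizer may be of that kind.  Hence the first
count is asymptotically Gaussian near each maximizer ([local_gauss_counts]),
with an explicit total mass that is a common multiple of tau(m) ([mass_tau]).
Configurations far from all maximizers carry an exponentially small fraction
of the mass ([far_gap], [far_sum_le]).

Estimator.  As E_c of the first frequency increases with c, the event
hat h <= c is the event that the observed frequency of colour 1 is at most its
mean under P_c ([mle_le]).  At c = h + x / sqrt N the tilt by the field selects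
the maximizers whose first coordinate is largest (if x > 0) or smallest
(if x < 0), and the mean is mu + (x / a) / sqrt N + o(1 / sqrt N), with mu that
coordinate and a the precision there ([mean_dev_cvg]).  Maximizers with a
smaller first coordinate then lie in the event, those with a larger one do not,
and those with first coordinate mu contribute a Gaussian distribution function
([mle_cdf_cvg]).  Read for both signs of x, this is the distribution function of
a mixture of two half-normal laws and an atom at 0 ([law_of_split]): the atom
collects what lies strictly between the two extreme groups and half of each
extreme group.

Maximizers.  Negative definiteness of Q forces all coordinates of a maximizer
but one to be equal ([max_pvec]), so the maximizers of H are the permutations of
the x_s with s maximizing f, and x_s itself if h > 0 ([H_maxP]).  Moreover
f'' is positive at most on an interval ([ddf_sign_qconcave], by a rule of signs
of Descartes type), which leaves at most two maximizers of f; if there are two and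
h = 0, one of them is 0 ([f_max_pair]).  Finally f_(beta,0)(s) - f_(beta,0)(0) increases strictly
with beta, so at h = 0 the coexistence of 0 and of a positive maximizer happens
exactly at beta_c ([beta_c_of_pair], [zero_max_at_beta_c]). *)

Set Implicit Arguments.
Unset Strict Implicit.
Unset Printing Implicit Defensive.

Import Order.TTheory GRing.Theory Num.Theory.
Import numFieldNormedType.Exports.

Local Open Scope classical_set_scope.
Local Open Scope ring_scope.

(** * Gaussian functions and sums over a rescaled lattice *)
Section gauss.
Variable R : realType.
Implicit Types (a m x z : R).
Notation mu := (@lebesgue_measure R).

(** Parametrized by the precision (inverse variance) a, without normalization:
precisions add under products, and a <= 0 is allowed. *)
Definition gauss a m x : R := expR (- (a / 2) * (x - m) ^+ 2).

Lemma normal_fun_gauss a m x : 0 < a ->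
  normal_fun m (Num.sqrt a)^-1 x = gauss a m x.
Proof.
move=> a0; rewrite /normal_fun /gauss; congr expR.
rewrite exprVn sqr_sqrtr ?ltW// -mulr_natr invfM invrK; field.
all: by rewrite ?gt_eqF.
Qed.

Lemma normal_pdf_gauss a m x : 0 < a ->
  normal_pdf m (Num.sqrt a)^-1 x = (Num.sqrt (2 * pi / a))^-1 * gauss a m x.
Proof.
move=> a0; rewrite normal_pdfE ?invr_eq0 ?gt_eqF ?sqrtr_gt0//.
rewrite normal_fun_gauss//; congr (_ * _); rewrite /normal_peak.
rewrite exprVn sqr_sqrtr ?ltW//; congr (Num.sqrt _)^-1.
by rewrite -mulr_natr; field; rewrite gt_eqF.
Qed.

Lemma gauss_ge0 a m x : 0 <= gauss a m x. Proof. exact: expR_ge0. Qed.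

Lemma gaussE a m x : 0 < a ->
  gauss a m x = Num.sqrt (2 * pi / a) * normal_pdf m (Num.sqrt a)^-1 x.
Proof.
move=> a0; rewrite normal_pdf_gauss// mulVKf// gt_eqF// sqrtr_gt0.
by rewrite divr_gt0// mulr_gt0// pi_gt0.
Qed.

Lemma measurable_gauss a m D : measurable_fun D (gauss a m).
Proof.
apply: measurable_funTS; apply: measurableT_comp => //.
apply: measurable_funM => //; apply: measurable_funX => //.
exact: measurable_funB.
Qed.

Lemma integrable_gauss a m : 0 < a -> mu.-integrable setT (EFin \o gauss a m).
Proof.
move=> a0.
have -> : EFin \o gauss a m = (fun x => (Num.sqrt (2 * pi / a))%:E *
   (normal_pdf m (Num.sqrt a)^-1 x)%:E)%E.
  by apply/funext => x /=; rewrite gaussE.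
by apply: integrableZl => //; exact: integrable_normal_pdf.
Qed.

Lemma integral_gauss_le a m z : 0 < a ->
  (\int[mu]_(x in `]-oo, z]) (gauss a m x)%:E =
   (Num.sqrt (2 * pi / a))%:E * normal_prob m (Num.sqrt a)^-1 `]-oo, z])%E.
Proof.
move=> a0; rewrite /normal_prob -ge0_integralZl//=.
- by apply: eq_integral => x _; rewrite gaussE.
- by apply/measurable_EFinP; apply: measurable_funTS; exact: measurable_normal_pdf.
- by move=> x _; rewrite lee_fin normal_pdf_ge0.
Qed.

Lemma integral_gauss a m : 0 < a ->
  (\int[mu]_x (gauss a m x)%:E = (Num.sqrt (2 * pi / a))%:E)%E.
Proof.
move=> a0; rewrite -[RHS]mule1.
rewrite -(integral_normal_pdf m (Num.sqrt a)^-1) -ge0_integralZl//=.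
- by apply: eq_integral => x _; rewrite gaussE.
- by apply/measurable_EFinP; exact: measurable_normal_pdf.
- by move=> x _; rewrite lee_fin normal_pdf_ge0.
Qed.

End gauss.

Section step.
Variable R : realType.
Notation mu := (@lebesgue_measure R).

(** Position of the integer j seen from N m on the scale sqrt N. *)
Definition scaled (m : R) (N j : nat) : R :=
  (j%:R - N%:R * m) / Num.sqrt N%:R.

(** The integer whose cell, on the scale sqrt N around N m, contains x. *)
Definition unscaled (m : R) (N : nat) (x : R) : nat :=
  Num.truncn (N%:R * m + Num.sqrt N%:R * x).

(** Spreading each value over a cell of width 1 / sqrt N turns a lattice sum into
an integral, so that dominated convergence applies to it. *)
Definition step (m : R) (phi : nat -> R) (K N : nat) (x : R) : R :=
  \sum_(j < K) phi j * \1_(`[scaled m N j, scaled m N j.+1[) x.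

Lemma scaled_itv m N j x : (0 < N)%N ->
  (x \in `[scaled m N j, scaled m N j.+1[) =
  (j%:R <= N%:R * m + Num.sqrt N%:R * x < j.+1%:R).
Proof.
move=> N0; have s0 : 0 < Num.sqrt (N%:R : R) by rewrite sqrtr_gt0 ltr0n.
rewrite in_itv/= /scaled ler_pdivrMr// ltr_pdivlMr//.
by rewrite lerBlDl ltrBrDl ![x * _]mulrC.
Qed.

Lemma stepE m phi K N x : (0 < N)%N ->
  step m phi K N x =
  if (0 <= N%:R * m + Num.sqrt N%:R * x) && (unscaled m N x < K)%N
  then phi (unscaled m N x) else 0.
Proof.
move=> N0; rewrite /step.
set y := N%:R * m + _; have [y0|y0]/= := leP 0 y; last first.
  apply: big1 => j _; rewrite indicE mem_setE scaled_itv// -/y.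
  by rewrite leNgt (lt_le_trans y0)//= mulr0.
have Ej j : (j%:R <= y < j.+1%:R) = (j == unscaled m N x :> nat).
  apply/idP/eqP => [jy|->]; last exact: truncn_itv.
  by apply/esym/eqP; rewrite truncn_eq.
have [uK|uK] := ltnP; last first.
  apply: big1 => j _; rewrite indicE mem_setE scaled_itv// -/y Ej.
  by rewrite ltn_eqF ?mulr0// (leq_trans (ltn_ord j)).
rewrite (bigD1 (Ordinal uK))//= big1 ?addr0.
  by rewrite indicE mem_setE scaled_itv// -/y Ej eqxx mulr1.
move=> j ju; rewrite indicE mem_setE scaled_itv// -/y Ej.
by rewrite -val_eqE/= in ju; rewrite (negbTE ju) mulr0.
Qed.

Lemma measurable_step m phi K N D : measurable_fun D (step m phi K N).
Proof.
rewrite /step; apply: measurable_sum => j; apply: measurable_funM => //.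
Qed.

Lemma integral_step m phi K N : (0 < N)%N ->
  (\int[mu]_x (step m phi K N x)%:E =
   ((\sum_(j < K) phi j) / Num.sqrt N%:R)%:E)%E.
Proof.
move=> N0.
have s0 : 0 < Num.sqrt (N%:R : R) by rewrite sqrtr_gt0 ltr0n.
under eq_integral do rewrite /step -sumEFin.
have Es j : mu `[scaled m N j, scaled m N j.+1[ = ((Num.sqrt N%:R)^-1)%:E.
  rewrite lebesgue_measure_itv/= lte_fin ltr_pM2r ?invr_gt0// ltrD2r ltr_nat ltnSn.
  by rewrite -EFinD /scaled; congr EFin; rewrite -mulrBl -natr1; field; rewrite gt_eqF.
have iI (j : 'I_K) : mu.-integrable setT
    (EFin \o \1_(`[scaled m N j, scaled m N j.+1[)).
  apply/integrableP; split; first by apply/measurable_EFinP; exact: measurable_indic.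
  under eq_integral do rewrite /= ger0_norm//.
  rewrite integral_indic//= setIT; move: (Es j) => /= ->; exact: ltry.
rewrite integral_sum//=; last first.
  move=> j; under eq_fun do rewrite EFinM; apply: integrableZl => //; exact: iI.
rewrite mulr_suml -sumEFin; apply: eq_bigr => j _.
under eq_integral do rewrite EFinM.
rewrite integralZl//; last exact: iI.
by rewrite integral_indic//= setIT; move: (Es j) => /= ->; rewrite EFinM.
Qed.

Lemma unscaled_near m N x : (0 < N)%N -> 0 <= N%:R * m + Num.sqrt N%:R * x ->
  scaled m N (unscaled m N x) <= x <= scaled m N (unscaled m N x) + (Num.sqrt N%:R)^-1.
Proof.
move=> N0 y0; have s0 : 0 < Num.sqrt (N%:R : R) by rewrite sqrtr_gt0 ltr0n.
have /= := truncn_itv y0; rewrite -/(unscaled m N x) => /andP[h1 h2].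
rewrite /scaled ler_pdivrMr//; set A := _ - _.
have -> : A / Num.sqrt N%:R + (Num.sqrt N%:R)^-1 = (A + 1) / Num.sqrt N%:R.
  by rewrite [RHS]mulrDl mul1r.
rewrite ler_pdivlMr// /A (mulrC x); move: h1 h2; rewrite -natr1; lra.
Qed.

Lemma sqrtn_ge1 N : (0 < N)%N -> 1 <= Num.sqrt (N%:R : R).
Proof. by move=> N0; rewrite -[leLHS]sqrtr1 ler_sqrt ?ler1n. Qed.

(** Cells have width at most 1, and (x - w)^2 <= 2 (s - w)^2 + 2 if x and s are at
distance at most 1: halving the precision absorbs the displacement. *)
Lemma gauss_unscaled_le m N x w k : (0 < N)%N -> 0 < k ->
  0 <= N%:R * m + Num.sqrt N%:R * x ->
  gauss k w (scaled m N (unscaled m N x)) <= expR (k / 2) * gauss (k / 2) w x.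
Proof.
move=> N0 k0 y0; have /andP[h1 h2] := unscaled_near N0 y0.
have s1 := sqrtn_ge1 N0.
have : (Num.sqrt (N%:R : R))^-1 <= 1 by rewrite invf_le1 ?(lt_le_trans ltr01).
move: h1 h2; set s := scaled _ _ _; set e := _^-1 => h1 h2 e1.
rewrite /gauss -expRD ler_expR.
have : (x - w) ^+ 2 <= 2 * (s - w) ^+ 2 + 2.
  have -> : x - w = (s - w) + (x - s) by lra.
  have : (x - s) ^+ 2 <= 1 by apply: exprn_ile1; lra.
  have := sqr_ge0 ((s - w) - (x - s)); nra.
nra.
Qed.

(** Domination of a lattice sum by an integral; what matters is that the bound
is uniform in N, in the number of terms and in the centre w. *)
Lemma lattice_gauss_le m w k N K : 0 < k -> (0 < N)%N ->
  (\sum_(j < K) gauss k w (scaled m N j)) / Num.sqrt N%:R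
  <= expR (k / 2) * Num.sqrt (2 * pi / (k / 2)).
Proof.
move=> k0 N0; rewrite -lee_fin -(@integral_step m (fun j => gauss k w (scaled m N j)))//.
have k20 : 0 < k / 2 by rewrite divr_gt0.
rewrite EFinM -(integral_gauss w k20) -ge0_integralZl//=; first last.
- by move=> x _; rewrite lee_fin gauss_ge0.
- by apply/measurable_EFinP; exact: measurable_gauss.
apply: ge0_le_integral => //=.
- by move=> x _; rewrite lee_fin stepE//; case: ifP => // _; exact: gauss_ge0.
- by apply/measurable_EFinP; exact: measurable_step.
- apply/measurable_EFinP; apply: measurable_funM => //; exact: measurable_gauss.
- move=> x _; rewrite lee_fin stepE//; case: ifP => [/andP[y0 _]|_].
    exact: gauss_unscaled_le.
  by rewrite mulr_ge0 ?expR_ge0.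
Qed.

End step.

Section riemann.
Variable R : realType.
Notation mu := (@lebesgue_measure R).

Lemma cvg_sqrtn_y : Num.sqrt (N%:R : R) @[N --> \oo] --> +oo.
Proof.
apply/cvgryPge => A; near=> N.
rewrite (le_trans (ler_norm A))// -sqrtr_sqr ler_sqrt//.
near: N; exact: nbhs_infty_ger.
Unshelve. all: end_near. Qed.

Lemma near_sqrtn_ge (A : R) : \forall N \near \oo, A <= Num.sqrt N%:R.
Proof. by move/cvgryPge : cvg_sqrtn_y => /(_ A). Qed.

Lemma near_unscaled_ge0 (m x : R) : 0 < m ->
  \forall N \near \oo, 0 <= N%:R * m + Num.sqrt N%:R * x.
Proof.
move=> m0; near=> N.
have -> : N%:R * m = Num.sqrt N%:R * (Num.sqrt N%:R * m) :> R.
  by rewrite mulrA -expr2 sqr_sqrtr.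
rewrite -mulrDr mulr_ge0// -lerBlDr sub0r -ler_pdivrMr//.
by near: N; exact: near_sqrtn_ge.
Unshelve. all: end_near. Qed.

Lemma cvg_scaled_unscaled (m x : R) : 0 < m ->
  scaled m N (unscaled m N x) @[N --> \oo] --> x.
Proof.
move=> m0; apply: (@squeeze_cvgr _ _ _ _ (fun N => x - (Num.sqrt N%:R)^-1) (cst x)).
- near=> N; have /= := @unscaled_near R m N x.
  move=> /(_ _ _)/andP[||h1 h2].
  + by near: N; exact: nbhs_infty_gt.
  + by near: N; exact: near_unscaled_ge0.
  by rewrite h1 lerBlDr h2.
- rewrite -[X in _ --> X]subr0; apply: cvgB; first exact: cvg_cst.
  apply/(gtr0_cvgV0 _).2; last exact: cvg_sqrtn_y.
  by near=> N; rewrite sqrtr_gt0 ltr0n; near: N; exact: nbhs_infty_gt.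
- exact: cvg_cst.
Unshelve. all: end_near. Qed.

(** Dominated convergence for the step functions of f N.  The hypothesis is only
along the lattice points approaching x, and for almost every x, which allows
indicators of half-lines in f. *)
Lemma riemann_sum (m k C : R) (K : nat -> nat) (f : nat -> nat -> R) (F : R -> R) :
  0 < m -> 0 < k ->
  (forall N j, (0 < N)%N -> `|f N j| <= C * gauss k 0 (scaled m N j)) ->
  (forall N j, (K N <= j)%N -> f N j = 0) ->
  measurable_fun setT F ->
  {ae mu, forall x, f N (unscaled m N x) @[N --> \oo] --> F x} ->
  (\sum_(j < K N) f N j) / Num.sqrt N%:R @[N --> \oo] --> \int[mu]_x F x.
Proof.
move=> m0 k0 fC f0 mF fF.
rewrite -cvg_shiftS.
pose f_ n x := (step m (f n.+1) (K n.+1) n.+1 x)%:E.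
pose g x := ((C * expR (k / 2)) * gauss (k / 2) 0 x)%:E.
have C0 : 0 <= C.
  have := @fC 1%N 0%N isT; move/(le_trans (normr_ge0 _)).
  by rewrite pmulr_lge0// /gauss expR_gt0.
have [] := @dominated_convergence _ _ _ mu setT measurableT f_ (EFin \o F) g.
- by move=> n; apply/measurable_EFinP; exact: measurable_step.
- exact/measurable_EFinP.
- move: fF; apply: filterS; first exact: (ae_filter_ringOfSetsType mu).
  move=> x fFx _; apply/fine_cvgP; split; first exact: nearW.
  suff : step m (f n.+1) (K n.+1) n.+1 x @[n --> \oo] --> F x by [].
  rewrite (cvg_shiftS (fun n => step m (f n) (K n) n x)).
  apply: cvg_trans fFx; apply: near_eq_cvg; near=> N.
  rewrite stepE//; last by near: N; exact: nbhs_infty_gt.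
  have -> /= : 0 <= N%:R * m + Num.sqrt N%:R * x.
    by near: N; exact: near_unscaled_ge0.
  by case: ltnP => // /f0.
- rewrite /g; under eq_fun do rewrite EFinM.
  by apply: integrableZl => //; apply: integrable_gauss; rewrite divr_gt0.
- apply: aeW => x n _; rewrite /f_ /g lee_fin stepE//.
  case: ifP => [/andP[y0 _]|_]; last by rewrite normr0 !mulr_ge0// expR_ge0.
  rewrite (le_trans (fC _ _ _))// -mulrA ler_wpM2l//.
  exact: gauss_unscaled_le.
- move=> iF _; rewrite /f_; under eq_fun do rewrite integral_step//.
  move=> h.
  have -> : \int[mu]_x F x = fine (\int[mu]_x (F x)%:E) by [].
  apply: (@fine_cvg _ _ _ _ (fun n => ((\sum_(j < K n.+1) f n.+1 j) / Num.sqrt n.+1%:R)%:E)).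
  rewrite fineK//; exact: integrable_fin_num.
Unshelve. all: end_near. Qed.

End riemann.

(** * Local limits of Gaussian shape and their convolutions *)
Section local_gauss.
Variable R : realType.
Notation mu := (@lebesgue_measure R).
Implicit Types (m a b c x y z : R) (u v : nat -> nat -> R).

(** The uniform bound holds with a precision b slightly smaller than the precision
a of the limit.  Both may be negative for one factor of a convolution. *)
Definition local_gauss m a b c u : Prop :=
  [/\ forall N n, 0 <= u N n,
      exists C : R, forall N n, (0 < N)%N -> u N n <= C * gauss b 0 (scaled m N n)
    & forall (n_ : nat -> nat) x, scaled m N (n_ N) @[N --> \oo] --> x ->
        u N (n_ N) @[N --> \oo] --> c * gauss a 0 x].

(** The normalization makes the limit an integral. *)
Definition lconv u v N n : R :=
  (\sum_(j < n.+1) u N j * v N (n - j)%N) / Num.sqrt N%:R.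

Lemma gaussM a b x y : a + b != 0 ->
  gauss a 0 x * gauss b 0 (y - x) =
  gauss (a + b) (b * y / (a + b)) x * gauss (a * b / (a + b)) 0 y.
Proof. by move=> ab; rewrite /gauss -!expRD; congr expR; field. Qed.

Lemma scaledB m1 m2 N n j : (j <= n)%N ->
  scaled m2 N (n - j) = scaled (m1 + m2) N n - scaled m1 N j.
Proof. by move=> jn; rewrite /scaled natrB// -mulrBl; congr (_ * _); ring. Qed.

(** Moves the centre to 0 at the price of half of the precision. *)
Lemma gauss_recenter k x y : 0 <= k ->
  gauss k y x <= expR (k / 2 * y ^+ 2) * gauss (k / 2) 0 x.
Proof.
move=> k0; rewrite /gauss -expRD ler_expR subr0.
have : x ^+ 2 / 2 - y ^+ 2 <= (x - y) ^+ 2.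
  by have := sqr_ge0 (x - 2 * y); nra.
nra.
Qed.

Lemma conv_bound m1 m2 b1 b2 C1 C2 u v N n : (0 < N)%N -> 0 < b1 + b2 ->
  (forall j, 0 <= u N j) -> (forall j, 0 <= v N j) ->
  (forall j, u N j <= C1 * gauss b1 0 (scaled m1 N j)) ->
  (forall j, v N j <= C2 * gauss b2 0 (scaled m2 N j)) ->
  forall j, (j <= n)%N ->
  u N j * v N (n - j)%N <= C1 * C2 *
    gauss (b1 + b2) (b2 * scaled (m1 + m2) N n / (b1 + b2)) (scaled m1 N j) *
    gauss (b1 * b2 / (b1 + b2)) 0 (scaled (m1 + m2) N n).
Proof.
move=> N0 b0 u0 v0 uC vC j jn.
rewrite -mulrA -gaussM ?gt_eqF// -scaledB// mulrACA.
exact: ler_pM.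
Qed.

Lemma integral_gauss_conv a1 a2 c1 c2 y : 0 < a1 + a2 ->
  \int[mu]_x (c1 * gauss a1 0 x * (c2 * gauss a2 0 (y - x))) =
  c1 * c2 * Num.sqrt (2 * pi / (a1 + a2)) * gauss (a1 * a2 / (a1 + a2)) 0 y.
Proof.
move=> a0.
transitivity (\int[mu]_x (c1 * c2 * gauss (a1 * a2 / (a1 + a2)) 0 y *
    gauss (a1 + a2) (a2 * y / (a1 + a2)) x)).
  apply: eq_Rintegral => x _.
  by rewrite mulrACA gaussM ?gt_eqF// mulrA mulrAC.
rewrite RintegralZl//; last exact: integrable_gauss.
rewrite mulrAC; congr (_ * _).
by rewrite /Rintegral; under eq_integral do rewrite -/(gauss _ _ _); rewrite integral_gauss.
Qed.

(** The limit is the convolution of two Gaussian functions, which only needs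
a1 + a2 > 0: one factor may grow.  In the same way the bound only needs
b1 + b2 > 0. *)
Lemma local_gauss_conv m1 m2 a1 a2 b1 b2 c1 c2 u v :
  0 < m1 -> 0 < m2 -> 0 < a1 + a2 -> 0 < b1 + b2 ->
  local_gauss m1 a1 b1 c1 u -> local_gauss m2 a2 b2 c2 v ->
  local_gauss (m1 + m2) (a1 * a2 / (a1 + a2)) (b1 * b2 / (b1 + b2))
    (c1 * c2 * Num.sqrt (2 * pi / (a1 + a2))) (lconv u v).
Proof.
move=> m10 m20 a0 b0 [u0 [C1 uC] ul] [v0 [C2 vC] vl].
have C_ge0 (C : R) b m (w : nat -> nat -> R) : (forall N n, 0 <= w N n) ->
  (forall N n, (0 < N)%N -> w N n <= C * gauss b 0 (scaled m N n)) -> 0 <= C.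
  move=> w0 wC; have := le_trans (w0 1%N 0%N) (wC 1%N 0%N isT).
  by rewrite pmulr_lge0// expR_gt0.
have C10 := C_ge0 _ _ _ _ u0 uC; have C20 := C_ge0 _ _ _ _ v0 vC.
split.
- by move=> N n; rewrite divr_ge0// sumr_ge0// => j _; rewrite mulr_ge0.
- pose D := expR ((b1 + b2) / 2) * Num.sqrt (2 * pi / ((b1 + b2) / 2)).
  exists (C1 * C2 * D) => N n N0; rewrite /lconv.
  pose G := gauss (b1 * b2 / (b1 + b2)) 0 (scaled (m1 + m2) N n).
  pose y := b2 * scaled (m1 + m2) N n / (b1 + b2).
  apply: (@le_trans _ _ (C1 * C2 * G *
      ((\sum_(j < n.+1) gauss (b1 + b2) y (scaled m1 N j)) / Num.sqrt N%:R))).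
    rewrite mulrA ler_wpM2r ?invr_ge0 ?sqrtr_ge0// mulr_sumr.
    apply: ler_sum => j _; rewrite mulrAC.
    apply: conv_bound => // [i|i|]; [exact: uC|exact: vC|by rewrite -ltnS].
  rewrite -/G mulrAC ler_wpM2r ?gauss_ge0// ler_wpM2l ?mulr_ge0//.
  exact: lattice_gauss_le.
- move=> n_ x nx.
  pose f N j := if (j < (n_ N).+1)%N then u N j * v N (n_ N - j)%N else 0.
  have -> : (fun N => lconv u v N (n_ N)) =
      (fun N => (\sum_(j < (n_ N).+1) f N j) / Num.sqrt N%:R).
    apply/funext => N; rewrite /lconv; congr (_ / _).
    by apply: eq_bigr => j _; rewrite /f ltn_ord.
  rewrite -integral_gauss_conv//.
  (* The centre of the product of the two bounds moves with the position of n_ N;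
     it stays bounded, so one fixed Gaussian bound works for all N. *)
  have [B wB] : exists B : R, forall N, `|scaled (m1 + m2) N (n_ N)| <= B.
    have : bounded_fun (fun N => scaled (m1 + m2) N (n_ N)).
      by apply: cvg_seq_bounded; apply/cvg_ex; exists x.
    by move=> [B [_ hB]]; exists (B + 1) => N; apply: (hB (B + 1)); rewrite ?ltrDl.
  have B0 : 0 <= B by exact: le_trans (wB 0%N).
  pose E := expR (`|b1 * b2 / (b1 + b2) / 2| * B ^+ 2) *
            expR ((b1 + b2) / 2 * (`|b2 / (b1 + b2)| * B) ^+ 2).
  apply: (@riemann_sum _ m1 ((b1 + b2) / 2) (C1 * C2 * E)) => //.
  + by rewrite divr_gt0.
  + move=> N j N0; rewrite /f; case: ifPn => [jn|_]; last first.
      by rewrite normr0 !mulr_ge0// expR_ge0.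
    rewrite ger0_norm ?mulr_ge0//.
    apply: (le_trans (conv_bound N0 b0 (u0 N) (v0 N) (uC N ^~ N0) (vC N ^~ N0) _)) => //.
    set W := scaled _ _ (n_ N).
    rewrite -[leLHS]mulrA -[leRHS]mulrA ler_wpM2l ?mulr_ge0//.
    rewrite [leLHS]mulrC /E -[leRHS]mulrA.
    apply: ler_pM; rewrite ?gauss_ge0//.
      rewrite /gauss subr0 ler_expR; apply: (le_trans (ler_norm _)).
      rewrite normrM normrN ler_wpM2l// ger0_norm ?sqr_ge0//.
      by rewrite -(@real_normK _ W) ?num_real// ler_sqr ?nnegrE ?wB.
    apply: (le_trans (gauss_recenter _ _ _)); first exact: ltW.
    rewrite ler_wpM2r ?gauss_ge0// ler_expR ler_wpM2l//; first by rewrite divr_ge0// ltW.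
    rewrite -(@real_normK _ (b2 * W / _)) ?num_real// ler_sqr ?nnegrE ?mulr_ge0//.
    by rewrite mulrAC normrM ler_wpM2l// wB.
  + by move=> N j nj; rewrite /f ltnNge nj.
  + apply: measurable_funM; apply: measurable_funM => //.
      exact: measurable_gauss.
    apply: measurableT_comp; first exact: measurable_gauss.
    exact: measurable_funB.
  + apply: aeW => /= z.
    have wz := @cvg_scaled_unscaled R m1 z m10.
    (* The truncation of the convolution is invisible in the limit, since m2 > 0. *)
    have lez : \forall N \near \oo, (unscaled m1 N z <= n_ N)%N.
      near=> N.
      have N0 : (0 < N)%N by near: N; exact: nbhs_infty_gt.
      have s0 : 0 < Num.sqrt (N%:R : R) by rewrite sqrtr_gt0 ltr0n.
      have h1 : scaled (m1 + m2) N (n_ N) - scaled m1 N (unscaled m1 N z) >= x - z - 1.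
        by near: N; apply: (cvgr_ge _ (cvgB nx wz)); rewrite gtrBl.
      have h2 : 0 <= N%:R * m2 + Num.sqrt N%:R * (x - z - 1).
        by near: N; exact: near_unscaled_ge0.
      rewrite -(ler_nat R) -subr_ge0.
      move: h1; rewrite /scaled -mulrBl ler_pdivlMr//; lra.
    have h : u N (unscaled m1 N z) * v N (n_ N - unscaled m1 N z)%N @[N --> \oo] -->
        c1 * gauss a1 0 z * (c2 * gauss a2 0 (x - z)).
      apply: cvgM; first exact: ul.
      apply: vl; apply: cvg_trans; last exact: (cvgB nx wz).
      apply: near_eq_cvg; near=> N.
      by rewrite (@scaledB m1)//; near: N.
    apply: cvg_trans h; apply: near_eq_cvg; near=> N.
    by rewrite /f ltnS ifT//; near: N.
Unshelve. all: end_near. Qed.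

End local_gauss.

(** * Exponential moments and distribution functions of local limits *)
Section local_gauss_sums.
Variable R : realType.
Notation mu := (@lebesgue_measure R).
Implicit Types (m a b c x y z : R) (u v : nat -> nat -> R).

Lemma gauss_tilt a y x : a != 0 ->
  gauss a 0 x * expR (y * x) = expR (y ^+ 2 / (2 * a)) * gauss a (y / a) x.
Proof. by move=> a0; rewrite /gauss -!expRD; congr expR; field. Qed.

(** The factor t may depend on N and have a limit only almost everywhere; the
exponential bound on t is absorbed by the Gaussian bound on u. *)
Lemma local_gauss_sum m a b c u (K : nat -> nat) (t : nat -> R -> R) (G : R -> R)
    (D y : R) : 0 < m -> 0 < b -> local_gauss m a b c u ->
  (forall N j, (K N <= j)%N -> u N j = 0) ->
  (forall N x, `|t N x| <= D * expR (y * x)) ->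
  measurable_fun setT G ->
  {ae mu, forall x, forall w : nat -> R, w N @[N --> \oo] --> x ->
     t N (w N) @[N --> \oo] --> G x} ->
  (\sum_(j < K N) u N j * t N (scaled m N j)) / Num.sqrt N%:R @[N --> \oo] -->
  \int[mu]_x (c * gauss a 0 x * G x).
Proof.
move=> m0 b0 [u0 [C uC] ul] uK tD mG tG.
have C0 : 0 <= C.
  have := le_trans (u0 1%N 0%N) (uC 1%N 0%N isT).
  by rewrite pmulr_lge0// expR_gt0.
have D0 : 0 <= D.
  by have := le_trans (normr_ge0 _) (tD 0%N 0); rewrite pmulr_lge0// expR_gt0.
apply: (@riemann_sum _ m (b / 2)
  (C * D * expR (y ^+ 2 / (2 * b)) * expR (b / 2 * (y / b) ^+ 2)) K
  (fun N j => u N j * t N (scaled m N j))) => //.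
- by rewrite divr_gt0.
- move=> N j N0; rewrite normrM ger0_norm//.
  apply: (@le_trans _ _ (C * gauss b 0 (scaled m N j) * (D * expR (y * scaled m N j)))).
    by apply: ler_pM => //; exact: uC.
  rewrite mulrACA gauss_tilt ?gt_eqF//.
  have := gauss_recenter (scaled m N j) (y / b) (ltW b0).
  have := expR_ge0 (y ^+ 2 / (2 * b)).
  move: (expR _) (expR _) (gauss _ _ _) (gauss _ _ _) => e1 e2 g1 g2 e10 h.
  by rewrite -!mulrA; do 3 rewrite ler_wpM2l//.
- by move=> N j Kj; rewrite uK// mul0r.
- by apply: measurable_funM => //; apply: measurable_funM => //; exact: measurable_gauss.
- move: tG; apply: filterS; first exact: (ae_filter_ringOfSetsType mu).
  move=> x tGx; have wx := @cvg_scaled_unscaled R m x m0.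
  by apply: cvgM; [exact: ul|exact: tGx].
Qed.

Lemma local_gauss_sum_tilt m a b c u (K : nat -> nat) y :
  0 < m -> 0 < a -> 0 < b -> local_gauss m a b c u ->
  (forall N j, (K N <= j)%N -> u N j = 0) ->
  (\sum_(j < K N) u N j * expR (y * scaled m N j)) / Num.sqrt N%:R @[N --> \oo] -->
  c * Num.sqrt (2 * pi / a) * expR (y ^+ 2 / (2 * a)).
Proof.
move=> m0 a0 b0 ug uK.
have -> : c * Num.sqrt (2 * pi / a) * expR (y ^+ 2 / (2 * a)) =
    \int[mu]_x (c * gauss a 0 x * expR (y * x)).
  transitivity (\int[mu]_x (c * expR (y ^+ 2 / (2 * a)) * gauss a (y / a) x)).
    rewrite RintegralZl//; last exact: integrable_gauss.
    by rewrite mulrAC; congr (_ * _); rewrite /Rintegral integral_gauss.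
  by apply: eq_Rintegral => x _; rewrite -[RHS]mulrA gauss_tilt ?gt_eqF// mulrA.
apply: (@local_gauss_sum m a b c u K (fun _ x => expR (y * x)) _ 1 y) => //.
- by move=> N x; rewrite mul1r ger0_norm ?expR_ge0.
- by apply: measurableT_comp => //; exact: measurable_funM.
- apply: aeW => x w wx; apply: continuous_cvg; first exact: continuous_expR.
  by apply: cvgM => //; exact: cvg_cst.
Qed.

Lemma local_gauss_sum_le m a b c u (K : nat -> nat) (z : nat -> R) (l : R) :
  0 < m -> 0 < a -> 0 < b -> local_gauss m a b c u ->
  (forall N j, (K N <= j)%N -> u N j = 0) ->
  z N @[N --> \oo] --> l ->
  (\sum_(j < K N) u N j * (scaled m N j <= z N)%R%:R) / Num.sqrt N%:R @[N --> \oo] -->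
  c * Num.sqrt (2 * pi / a) * fine (normal_prob 0 (Num.sqrt a)^-1 `]-oo, l]).
Proof.
move=> m0 a0 b0 ug uK zl.
have -> : c * Num.sqrt (2 * pi / a) * fine (normal_prob 0 (Num.sqrt a)^-1 `]-oo, l]) =
    \int[mu]_x (c * gauss a 0 x * (x <= l)%R%:R).
  transitivity (\int[mu]_(x in `]-oo, l]) (c * gauss a 0 x)).
    rewrite RintegralZl//; last first.
      by apply: integrableS (integrable_gauss _ a0) => //.
    rewrite /Rintegral integral_gauss_le// fineM//; last first.
      by apply: fin_num_measure.
    by rewrite mulrA.
  rewrite Rintegral_mkcond; apply: eq_Rintegral => x _.
  rewrite patchE mem_setE in_itv/=; case: (x <= l); by rewrite ?mulr1 ?mulr0.
apply: (@local_gauss_sum m a b c u K (fun N x => (x <= z N)%R%:R) _ 1 0) => //.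
- by move=> N x; rewrite mul0r expR0 mulr1 ger0_norm ?ler0n// lern1 leq_b1.
- rewrite (_ : (fun x => _) = \1_(`]-oo, l])); first exact: measurable_indic.
  by apply/funext => x; rewrite indicE mem_setE in_itv.
(* The indicators converge except at the threshold l itself. *)
- exists [set l]; split => //; first exact: lebesgue_measure_set1.
  move=> x /=; apply: contra_notP => /eqP xl w wx.
  have [{}xl|lx] := ltP x l.
  + apply: cvg_near_cst; near=> N.
    congr ((nat_of_bool _)%:R); rewrite (ltW xl); apply: ltW.
    have : w N < (x + l) / 2 by near: N; apply: (cvgr_lt _ wx); lra.
    have : (x + l) / 2 < z N by near: N; apply: (cvgr_gt _ zl); lra.
    lra.
  + have {}lx : l < x by rewrite lt_neqAle eq_sym xl.
    apply: cvg_near_cst; near=> N.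
    congr ((nat_of_bool _)%:R); rewrite [RHS]leNgt lx; apply: lt_geF.
    have : (x + l) / 2 < w N by near: N; apply: (cvgr_gt _ wx); lra.
    have : z N < (x + l) / 2 by near: N; apply: (cvgr_lt _ zl); lra.
    lra.
Unshelve. all: end_near. Qed.

Lemma local_gauss_sum_ley m a b c u (K : nat -> nat) (z : nat -> R) :
  0 < m -> 0 < a -> 0 < b -> local_gauss m a b c u ->
  (forall N j, (K N <= j)%N -> u N j = 0) ->
  z N @[N --> \oo] --> +oo ->
  (\sum_(j < K N) u N j * (scaled m N j <= z N)%R%:R) / Num.sqrt N%:R @[N --> \oo] -->
  c * Num.sqrt (2 * pi / a).
Proof.
move=> m0 a0 b0 ug uK zy.
have -> : c * Num.sqrt (2 * pi / a) = \int[mu]_x (c * gauss a 0 x * cst 1 x).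
  under eq_Rintegral do rewrite /= mulr1.
  rewrite RintegralZl//; last exact: integrable_gauss.
  by rewrite /Rintegral integral_gauss.
apply: (@local_gauss_sum m a b c u K (fun N x => (x <= z N)%R%:R) (cst 1) 1 0) => //.
- by move=> N x; rewrite mul0r expR0 mulr1 ger0_norm ?ler0n// lern1 leq_b1.
- apply: aeW => x w wx; apply: cvg_near_cst; near=> N.
  rewrite (_ : _ <= _ = true)//; apply: (@le_trans _ _ (x + 1)).
    by near: N; apply: (cvgr_le _ wx); rewrite ltrDl.
  by near: N; move/cvgryPge : zy; exact.
Unshelve. all: end_near. Qed.

Lemma local_gauss_sum_leNy m a b c u (K : nat -> nat) (z : nat -> R) :
  0 < m -> 0 < a -> 0 < b -> local_gauss m a b c u ->
  (forall N j, (K N <= j)%N -> u N j = 0) ->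
  z N @[N --> \oo] --> -oo ->
  (\sum_(j < K N) u N j * (scaled m N j <= z N)%R%:R) / Num.sqrt N%:R @[N --> \oo] --> (0 : R).
Proof.
move=> m0 a0 b0 ug uK zy.
have I0 : \int[mu]_x (c * gauss a 0 x * cst 0 x) = 0.
  by under eq_Rintegral do rewrite /= mulr0; rewrite /Rintegral integral0.
rewrite -[X in _ --> X]I0.
apply: (@local_gauss_sum m a b c u K (fun N x => (x <= z N)%R%:R) (cst 0) 1 0) => //.
- by move=> N x; rewrite mul0r expR0 mulr1 ger0_norm ?ler0n// lern1 leq_b1.
- apply: aeW => x w wx; apply: cvg_near_cst; near=> N.
  rewrite (_ : _ <= _ = false)//; apply: lt_geF; apply: (@lt_le_trans _ _ (x - 1)).
    by near: N; move/cvgrNyPlt : zy; exact.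
  by near: N; apply: (cvgr_ge _ wx); rewrite gtrBl.
Unshelve. all: end_near. Qed.

End local_gauss_sums.

(** * The exponential formula for words *)
Section word_sums.

Definition cnt (q N : nat) (X : {ffun 'I_N -> 'I_q}) (r : 'I_q) : nat :=
  #|[pred i | X i == r]|.

Definition fcons (q N : nat) (r : 'I_q) (X : {ffun 'I_N -> 'I_q}) :
    {ffun 'I_N.+1 -> 'I_q} :=
  [ffun i => if unlift ord0 i is Some j then X j else r].

Lemma cnt_fcons q N r0 (X : {ffun 'I_N -> 'I_q}) r :
  cnt (fcons r0 X) r = ((r0 == r) + cnt X r)%N.
Proof.
rewrite /cnt -!sum1_card !big_mkcond big_ord_recl/= !inE ffunE unlift_none.
congr (_ + _)%N; rewrite [RHS]big_mkcond.
by apply: eq_bigr => i _; rewrite !inE ffunE liftK.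
Qed.

Lemma cnt_sum q N (X : {ffun 'I_N -> 'I_q}) : (\sum_r cnt X r)%N = N.
Proof.
rewrite /cnt -[RHS]card_ord -sum1_card (partition_big (fun i => X i) predT)//=.
by apply: eq_bigr => r _; rewrite -sum1_card.
Qed.

Lemma sum_fcons (V : nmodType) q N (F : {ffun 'I_N.+1 -> 'I_q} -> V) :
  \sum_X F X = \sum_(r : 'I_q) \sum_(X : {ffun 'I_N -> 'I_q}) F (fcons r X).
Proof.
rewrite pair_big/= (reindex (fun u => fcons u.1 u.2)); last first.
  exists (fun X : {ffun 'I_N.+1 -> 'I_q} => (X ord0, [ffun i : 'I_N => X (lift ord0 i)])).
    move=> [r X] _ /=; congr pair; first by rewrite ffunE unlift_none.
    by apply/ffunP => i; rewrite !ffunE liftK.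
  move=> X _ /=; apply/ffunP => i; rewrite ffunE.
  by case: unliftP => [j ->|->//]; rewrite ffunE.
by apply: eq_bigl.
Qed.

Variable R : comNzRingType.

(** Leibniz rule in the form needed for the induction on the length of words. *)
Lemma deriv_bigprod (I : eqType) (s : seq I) (P : I -> {poly R}) : uniq s ->
  (\prod_(i <- s) P i)^`() =
  \sum_(j <- s) \prod_(i <- s) (if i == j then (P i)^`() else P i).
Proof.
elim: s => [_|i s IH /= /andP[is_ us]]; first by rewrite !big_nil derivC.
rewrite !big_cons derivM IH// eqxx; congr (_ * _ + _).
  rewrite !big_seq; apply: eq_bigr => j js.
  by case: eqP => // ji; move: is_; rewrite -ji js.
rewrite mulr_sumr !big_seq; apply: eq_bigr => j js.
by rewrite big_cons; case: eqP => // ij; move: is_; rewrite ij js.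
Qed.

(** The exponential formula.  Induction on N: choosing the first letter of the
word amounts to differentiating one factor of the product. *)
Lemma sum_words q N (P : 'I_q -> {poly R}) :
  \sum_(X : {ffun 'I_N -> 'I_q}) \prod_r ((cnt X r)`!%:R * (P r)`_(cnt X r)) =
  N`!%:R * (\prod_r P r)`_N.
Proof.
elim: N P => [|N IH] P.
  rewrite (bigD1 (ffun0 (card_ord 0)))//=.
  rewrite [X in _ + X]big1 ?addr0; last first.
    by move=> X /eqP h; exfalso; apply: h; apply/ffunP; case.
  rewrite mul1r -horner_coef0 horner_prod; apply: eq_bigr => r _.
  have -> : cnt (ffun0 (card_ord 0)) r = 0%N by rewrite /cnt; apply: eq_card0; case.
  by rewrite mul1r horner_coef0.
have -> : N.+1`!%:R * (\prod_r P r)`_N.+1 = N`!%:R * (\prod_r P r)^`()`_N.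
  by rewrite coef_deriv factS natrM -mulr_natr; ring.
rewrite deriv_bigprod ?index_enum_uniq// coef_sum mulr_sumr sum_fcons.
apply: eq_bigr => r0 _; rewrite -IH; apply: eq_bigr => X _.
apply: eq_bigr => r _; rewrite cnt_fcons [r0 == r]eq_sym.
case: eqP => _; last by rewrite add0n.
by rewrite add1n coef_deriv factS natrM -mulr_natr; ring.
Qed.
End word_sums.

(** * Elementary calculus and the Stirling ratio *)
Section calculus.
Variable R : realType.
Implicit Types (f g df : R -> R) (x a b : R).

(** The rules below are stated for lambda-abstractions with the derivative in the
last argument, so that [der_tac] can compute derivatives by unification. *)
Definition der f x (a : R) : Prop := is_derive x 1 f a.

Lemma der_eq f x a b : der f x a -> a = b -> der f x b.
Proof. by move=> fa <-. Qed.
Lemma dcst (c x : R) : der (fun=> c) x 0.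
Proof. exact: is_derive_cst. Qed.
Lemma did x : der (fun y => y) x 1.
Proof. exact: is_derive_id. Qed.
Lemma dD f g x a b : der f x a -> der g x b ->
  der (fun y => f y + g y) x (a + b).
Proof. by rewrite /der => *; exact: is_deriveD. Qed.
Lemma dN f x a : der f x a -> der (fun y => - f y) x (- a).
Proof. by rewrite /der => *; exact: is_deriveN. Qed.
Lemma dM f g x a b : der f x a -> der g x b ->
  der (fun y => f y * g y) x (f x * b + g x * a).
Proof. by rewrite /der => *; exact: is_deriveM. Qed.
Lemma dX f n x a : der f x a ->
  der (fun y => f y ^+ n) x (n%:R * f x ^+ n.-1 * a).
Proof.
rewrite /der => fa; rewrite (_ : (fun y => f y ^+ n) = f ^+ n); first exact: is_deriveX.
by apply/funext => y; elim: n => // n IH; rewrite !exprS IH.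
Qed.
Lemma dV f x a : f x != 0 -> der f x a ->
  der (fun y => (f y)^-1) x (- (f x) ^- 2 * a).
Proof. by rewrite /der => fx fa; exact: is_deriveV. Qed.
Lemma dln f x a : 0 < f x -> der f x a ->
  der (fun y => ln (f y)) x ((f x)^-1 * a).
Proof. by move=> f0 fa; exact: (@is_derive1_comp _ (@ln R) f x _ _ (is_derive1_ln f0) fa). Qed.
Lemma dexp f x a : der f x a ->
  der (fun y => expR (f y)) x (expR (f x) * a).
Proof. by move=> fa; exact: (@is_derive1_comp _ (@expR R) f x _ _ (is_derive_expR _) fa). Qed.

End calculus.

Ltac der_tac := repeat first [exact: dcst | exact: did | apply: dD | apply: dN |
  apply: dM | apply: dX | apply: dln | apply: dV | apply: dexp].

Section calculus2.
Variable R : realType.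
Implicit Types (f g df : R -> R) (x a b : R).

Lemma is_derive_continuous f x a : der f x a -> {for x, continuous f}.
Proof. by move=> [df _]; apply/differentiable_continuous/derivable1_diffP. Qed.

Lemma mvt f df a b : a < b -> (forall x, a <= x <= b -> der f x (df x)) ->
  exists2 c, a < c < b & f b - f a = df c * (b - a).
Proof.
move=> ab fd.
have [||c] := @MVT R f df a b ab; last by rewrite in_itv/=; exists c.
- by move=> x; rewrite in_itv/= => /andP[ax xb]; apply: fd; rewrite !ltW.
- apply: continuous_in_subspaceT => x; rewrite inE/= in_itv/= => xab.
  exact: is_derive_continuous (fd x xab).
Qed.

Lemma deriv_ge0_le f df a b : a <= b ->
  (forall x, a <= x <= b -> der f x (df x)) ->
  (forall x, a < x < b -> 0 <= df x) -> f a <= f b.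
Proof.
rewrite le_eqVlt => /predU1P[->//|ab] fd d0.
have [c cab h] := mvt ab fd.
by rewrite -subr_ge0 h mulr_ge0 ?d0// subr_ge0 ltW.
Qed.

Lemma deriv_gt0_lt f df a b : a < b ->
  (forall x, a <= x <= b -> der f x (df x)) ->
  (forall x, a < x < b -> 0 < df x) -> f a < f b.
Proof.
move=> ab fd d0; have [c cab h] := mvt ab fd.
by rewrite -subr_gt0 h mulr_gt0 ?d0// subr_gt0.
Qed.

(** Together with the upper bound below, this brackets (n + 1/2) ln (1 + 1/n)
closely enough for the monotonicity of the Stirling ratio. *)
Lemma ln1D_ge (x : R) : 0 <= x -> 2 * x / (2 + x) <= ln (1 + x).
Proof.
move=> x0.
pose f (y : R) := ln (1 + y) - 2 * y / (2 + y).
rewrite -subr_ge0 -/(f x); have <- : f 0 = 0 by rewrite /f addr0 ln1 mulr0 mul0r subrr.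
apply: (@deriv_ge0_le f (fun y => y ^+ 2 / ((1 + y) * (2 + y) ^+ 2)) 0 x x0) => y /andP[y0 _].
  have h1 : 1 + y != 0 by apply: lt0r_neq0; lra.
  have h2 : 2 + y != 0 by apply: lt0r_neq0; lra.
  apply: der_eq; first by der_tac => //; lra.
  by rewrite /=; field; rewrite h1 h2.
by rewrite divr_ge0 ?sqr_ge0// mulr_ge0 ?sqr_ge0//; lra.
Qed.

Lemma ln1D_le (x : R) : 0 <= x -> ln (1 + x) <= (x + x / (1 + x)) / 2.
Proof.
move=> x0.
pose f (y : R) := (y + y / (1 + y)) / 2 - ln (1 + y).
rewrite -subr_ge0 -/(f x).
have <- : f 0 = 0 by rewrite /f addr0 ln1 mul0r addr0 mul0r subrr.
apply: (@deriv_ge0_le f (fun y => (1 - (1 + y)^-1) ^+ 2 / 2) 0 x x0) => y /andP[y0 _].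
  have h1 : 1 + y != 0 by apply: lt0r_neq0; lra.
  apply: der_eq; first by der_tac => //; lra.
  by rewrite /=; field.
by rewrite divr_ge0 ?sqr_ge0.
Qed.

(** By Stirling's formula this tends to the square root of 2 pi; the limit enters
all the masses in the same way and cancels in the weights. *)
Definition stirling_ratio (n : nat) : R :=
  n`!%:R * expR (n%:R - n%:R * ln n%:R) / Num.sqrt n%:R.

Lemma stirling_ratio_gt0 n : (0 < n)%N -> 0 < stirling_ratio n.
Proof.
by move=> n0; rewrite divr_gt0 ?sqrtr_gt0 ?ltr0n// mulr_gt0 ?ltr0n ?fact_gt0// expR_gt0.
Qed.

Lemma ln_stirling_ratioS n : (0 < n)%N ->
  stirling_ratio n.+1 = stirling_ratio n *
    expR (1 - (n%:R + 1 / 2) * ln (1 + n%:R^-1)).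
Proof.
move=> n0; have n0' : 0 < n%:R :> R by rewrite ltr0n.
have -> : ln (1 + n%:R^-1) = ln n.+1%:R - ln n%:R :> R.
  rewrite -ln_div ?posrE ?ltr0n//; congr ln; rewrite -natr1; field.
  by rewrite gt_eqF.
have sqE k : (0 < k)%N -> Num.sqrt k%:R = expR (ln k%:R / 2) :> R.
  move=> k0; rewrite -powR12_sqrt// /powR gt_eqF ?ltr0n// mulrC.
  by congr expR; rewrite mulrC.
rewrite /stirling_ratio !sqE// factS natrM -!expRN.
rewrite -{1}[n.+1%:R]lnK ?posrE ?ltr0n//.
set A := ln n.+1%:R; set B := ln n%:R.
rewrite -!mulrA mulrCA; congr (_ * _); rewrite -!expRD; congr expR.
by rewrite -natr1; field.
Qed.

(** The ratio decreases and its product with exp(-1/(4n)) increases. *)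
Lemma stirling_ratio_cvg : exists2 C : R, 0 < C &
  stirling_ratio n @[n --> \oo] --> C /\
  forall n, (0 < n)%N -> C <= stirling_ratio n.
Proof.
have dec n : (0 < n)%N -> stirling_ratio n.+1 <= stirling_ratio n.
  move=> n0; have n0' : 0 < n%:R :> R by rewrite ltr0n.
  rewrite ln_stirling_ratioS//; apply: ler_piMr; first exact/ltW/stirling_ratio_gt0.
  rewrite expR_le1 subr_le0.
  have h : 0 <= n%:R^-1 :> R by rewrite invr_ge0 ltW.
  have := ln1D_ge h.
  have -> : 2 * n%:R^-1 / (2 + n%:R^-1) = (n%:R + 1 / 2)^-1 :> R.
    by field; rewrite !gt_eqF//; lra.
  by rewrite -ler_pdivrMl ?mulr1 ?addr_gt0// divr_gt0.
(* The increasing minorant bounds the ratio away from 0. *)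
pose s n := stirling_ratio n * expR (- (4 * n%:R)^-1).
have inc n : (0 < n)%N -> s n <= s n.+1.
  move=> n0; have n0' : 0 < n%:R :> R by rewrite ltr0n.
  rewrite /s ln_stirling_ratioS// -mulrA; apply: ler_wpM2l; first exact/ltW/stirling_ratio_gt0.
  rewrite -expRD ler_expR.
  have h : 0 <= n%:R^-1 :> R by rewrite invr_ge0 ltW.
  have := ln1D_le h.
  have -> : (n%:R^-1 + n%:R^-1 / (1 + n%:R^-1)) / 2 =
      (1 + (4 * n%:R)^-1 - (4 * n.+1%:R)^-1) / (n%:R + 1 / 2) :> R.
    by rewrite -natr1; field; rewrite !gt_eqF//; lra.
  rewrite ler_pdivlMr; last by lra.
  move: (ln _) ((4 * n%:R)^-1) ((4 * n.+1%:R)^-1) => L A B; lra.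
have s1 n : s 1%N <= s n.+1.
  by elim: n => // n IH; apply: (le_trans IH); exact: inc.
pose c n := stirling_ratio n.+1.
have cdec : nonincreasing_seq c.
  by apply/nonincreasing_seqP => n; exact: dec.
have cs n : s 1%N <= c n.
  apply: (le_trans (s1 n)); rewrite /s /c; apply: ler_piMr; first exact/ltW/stirling_ratio_gt0.
  by rewrite expR_le1 oppr_le0 invr_ge0 mulr_ge0.
have cvgc : cvgn c.
  by apply: nonincreasing_is_cvgn => //; exists (s 1%N) => _ [n _ <-].
exists (limn c).
  apply: (@lt_le_trans _ _ (s 1%N)).
    by rewrite mulr_gt0 ?stirling_ratio_gt0// expR_gt0.
  by apply: limr_ge => //; exact: nearW.
split; first by rewrite -cvg_shiftS.
by case=> // n _; exact: nonincreasing_cvgn_ge.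
Qed.

End calculus2.

(** * Laplace expansion of a single count *)
Section local_coordinate.
Variable R : realType.

(** Second-order Taylor expansion with Peano remainder.  The derivative f1 is
only differentiated at m, so this follows from the mean value theorem applied
to f minus its quadratic part. *)
Lemma peano2 (f f1 : R -> R) (m f2 e : R) :
  (\forall x \near m, der f x (f1 x)) -> der f1 m f2 -> 0 < e ->
  \forall x \near m,
    `|f x - f m - f1 m * (x - m) - f2 / 2 * (x - m) ^+ 2| <= e * (x - m) ^+ 2.
Proof.
move=> /nbhs_ballP[r /= r0 fr] [f1d f1v] e0.
have : h^-1 *: (f1 (h + m) - f1 m) @[h --> 0^'] --> f2.
  have E : (fun h => h^-1 *: (f1 (h + m) - f1 m)) =
      (fun h => h^-1 *: ((f1 \o shift m) (h *: (1 : R)) - f1 m)).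
    by apply/funext => h /=; rewrite [h *: _]mulr1.
  by rewrite E -f1v; exact: f1d.
move=> /cvgrPdist_le /(_ e e0) /nbhs_ballP[r2 /= r20 hr2].
have f1m x : `|x - m| < r2 -> `|f1 x - f1 m - f2 * (x - m)| <= e * `|x - m|.
  move=> xm; have [->|xm0] := eqVneq x m; first by rewrite !subrr mulr0 subrr !normr0 mulr0.
  have xm00 : x - m != 0 by rewrite subr_eq0.
  have hb : ball (0 : R) r2 (x - m) by rewrite /ball/= sub0r normrN.
  have := hr2 _ hb xm00; rewrite subrK /GRing.scale/= => h.
  have -> : f1 x - f1 m - f2 * (x - m) =
      - ((f2 - (x - m)^-1 * (f1 x - f1 m)) * (x - m)) by field.
  by rewrite normrN normrM ler_wpM2r.
near=> x.
have xr : `|x - m| < r by rewrite distrC; near: x; apply: nbhsx_ballx.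
have xr2 : `|x - m| < r2 by rewrite distrC; near: x; apply: nbhsx_ballx.
pose g y := f y - f1 m * (y - m) - f2 / 2 * (y - m) ^+ 2.
pose g1 y := f1 y - f1 m - f2 * (y - m).
have gd y : `|y - m| < r -> der g y (g1 y).
  move=> yr; apply: der_eq.
    apply: dD; last first.
      by der_tac.
    apply: dD; last first.
      by der_tac.
    by apply: fr; rewrite /ball/= distrC.
  by rewrite /g1 /= ; field.
have -> : f x - f m - f1 m * (x - m) - f2 / 2 * (x - m) ^+ 2 = g x - g m.
  by rewrite /g; ring.
have key a b : a < b -> `|a - m| < r -> `|b - m| < r -> `|a - m| < r2 -> `|b - m| < r2 ->
   (a = m \/ b = m) -> `|g b - g a| <= e * (b - a) ^+ 2.
  move=> ab ar br ar2 br2 abm.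
  have [y aby|c /andP[ac cb] ->] := @mvt _ g g1 a b ab.
    apply: gd; move: ar br aby; rewrite !ltr_norml; lra.
  rewrite normrM (ger0_norm (_ : 0 <= b - a)); last by lra.
  rewrite expr2 mulrA ler_wpM2r//; first by lra.
  apply: (le_trans (f1m c _)); first by move: ar2 br2; rewrite !ltr_norml; lra.
  rewrite (ler_wpM2l (ltW e0))// ler_norml; case: abm => <-; lra.
have mm d : 0 < d -> `|m - m| < d by rewrite subrr normr0.
have [xm|mx|->] := ltgtP x m.
- rewrite [`|g x - g m|]distrC (_ : (x - m) ^+ 2 = (m - x) ^+ 2); last by ring.
  by apply: key => //; [exact: mm|exact: mm|right].
- by apply: key => //; [exact: mm|exact: mm|left].
- by rewrite !subrr normr0 expr0n/= mulr0.
Unshelve. all: end_near. Qed.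

(** The Boltzmann factor of a single count n, divided by its affine part at m, with
the factorial replaced by its Stirling ratio and cut off at distance d. *)
Definition loc (phi : R -> R) (phi1 m d : R) (N n : nat) : R :=
  let t := n%:R / N%:R in
  if `|t - m| <= d then
    expR (N%:R * (phi t - phi m - phi1 * (t - m))) /
      (Num.sqrt t * stirling_ratio R n)
  else 0.

(** The exponent is -(a/2) w^2 + o(1) at distance w sqrt N from N m.  The bound
with the smaller precision b holds on the whole window once d is small. *)
Lemma loc_local_gauss (phi phi1 : R -> R) (m a b : R) : 0 < m -> b < a ->
  (\forall x \near m, der phi x (phi1 x)) -> der phi1 m (- a) ->
  forall C : R, stirling_ratio R n @[n --> \oo] --> C -> 0 < C ->
    (forall n, (0 < n)%N -> C <= stirling_ratio R n) ->
  \forall d \near 0^'+,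
    local_gauss m a b (Num.sqrt m * C)^-1 (loc phi (phi1 m) m d).
Proof.
move=> m0 ba phid phi1d C sC C0 Cs.
have e0 : 0 < (a - b) / 2 by rewrite divr_gt0// subr_gt0.
have /nbhs_ballP[r /= r0 hr] := peano2 phid phi1d e0.
near=> d.
have d0 : 0 < d by [].
have dr : d < r by near: d; exact: nbhs_right_lt.
have dm : d < m by near: d; exact: nbhs_right_lt.
pose T t := phi t - phi m - phi1 m * (t - m).
have Tle t : `|t - m| <= d -> T t <= - (b / 2) * (t - m) ^+ 2.
  move=> td; have := hr t; rewrite /ball/= distrC => /(_ (le_lt_trans td dr)).
  rewrite -/(T t) ler_norml => /andP[_]; lra.
have near_pos n N : `|n%:R / N%:R - m| <= d -> m - d <= n%:R / N%:R.
  by rewrite ler_norml => /andP[h _]; lra.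
have n_gt0 n N : `|n%:R / N%:R - m| <= d -> (0 < n)%N.
  move=> /near_pos h; rewrite lt0n; apply/eqP => n0; move: h; rewrite n0 mul0r; lra.
have tw n N : (0 < N)%N -> n%:R / N%:R - m = scaled m N n / Num.sqrt N%:R.
  move=> N0; have N0' : 0 < N%:R :> R by rewrite ltr0n.
  rewrite /scaled -mulrA -invfM -expr2 sqr_sqrtr ?ltW//; field.
  by rewrite gt_eqF.
have tw2 n N : (0 < N)%N -> N%:R * (n%:R / N%:R - m) ^+ 2 = scaled m N n ^+ 2.
  move=> N0; have N0' : 0 < N%:R :> R by rewrite ltr0n.
  rewrite tw// expr_div_n sqr_sqrtr ?ltW// mulrC divfK// gt_eqF//.
split.
- move=> N n; rewrite /loc; case: ifPn => // /n_gt0 n0.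
  by rewrite divr_ge0 ?expR_ge0// mulr_ge0 ?sqrtr_ge0// ltW// stirling_ratio_gt0.
- exists (Num.sqrt (m - d) * C)^-1 => N n N0; rewrite /loc; case: ifPn => [h|_].
  + have n0 := n_gt0 _ _ h; rewrite mulrC; apply: ler_pM; rewrite ?expR_ge0 ?invr_ge0//.
    * by rewrite mulr_ge0 ?sqrtr_ge0// ltW// stirling_ratio_gt0.
    * rewrite lef_pV2 ?posrE; last 2 first.
        rewrite mulr_gt0 ?stirling_ratio_gt0// sqrtr_gt0.
        by apply: lt_le_trans (near_pos _ _ h); lra.
        by rewrite mulr_gt0// sqrtr_gt0; lra.
      apply: ler_pM; [exact: sqrtr_ge0|exact: ltW| |exact: Cs].
      exact/ler_wsqrtr/near_pos.
    * rewrite /gauss ler_expR subr0 -tw2// mulrCA ler_wpM2l//.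
      exact: Tle.
  + by rewrite mulr_ge0 ?expR_ge0// invr_ge0 mulr_ge0 ?sqrtr_ge0 ?ltW.
- move=> n_ x nx.
  have tm : (n_ N)%:R / N%:R @[N --> \oo] --> m.
    have : (n_ N)%:R / N%:R - m @[N --> \oo] --> (0 : R).
      have : scaled m N (n_ N) / Num.sqrt N%:R @[N --> \oo] --> x * 0.
        apply: cvgM => //; apply/(gtr0_cvgV0 _).2; last exact: cvg_sqrtn_y.
        by near=> N; rewrite sqrtr_gt0 ltr0n; near: N; exact: nbhs_infty_gt.
      rewrite mulr0; apply: cvg_trans; apply: near_eq_cvg; near=> N.
      by rewrite tw//; near: N; exact: nbhs_infty_gt.
    by move=> h; apply/subr_cvg0.
  have tmd : \forall N \near \oo, `|(n_ N)%:R / N%:R - m| <= d.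
    near=> N; rewrite distrC; near: N.
    by move/cvgrPdist_le : tm; apply.
  have ny : n_ N @[N --> \oo] --> \oo.
    apply/cvgnyPge => A; near=> N.
    have N0 : (0 < N)%N by near: N; exact: nbhs_infty_gt.
    have N0' : 0 < N%:R :> R by rewrite ltr0n.
    rewrite -(ler_nat R).
    have h : m - d <= (n_ N)%:R / N%:R by apply: near_pos; near: N.
    move: h; rewrite ler_pdivlMr//; apply: le_trans.
    rewrite -ler_pdivrMl ?subr_gt0//; near: N; exact: nbhs_infty_ger.
  have NT : N%:R * T ((n_ N)%:R / N%:R) @[N --> \oo] --> - (a / 2) * x ^+ 2.
    have w2 : scaled m N (n_ N) ^+ 2 @[N --> \oo] --> x ^+ 2.
      exact: (cvgM nx nx).
    have k1 : - (a / 2) * scaled m N (n_ N) ^+ 2 @[N --> \oo] --> - (a / 2) * x ^+ 2.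
      by apply: cvgM => //; exact: cvg_cst.
    (* The remainder of the expansion, multiplied by N, is at most a small multiple
       of w^2, where w is the rescaled position, which is bounded. *)
    suff k0 : N%:R * T ((n_ N)%:R / N%:R) - - (a / 2) * scaled m N (n_ N) ^+ 2
        @[N --> \oo] --> (0 : R).
      have -> : (fun N => N%:R * T ((n_ N)%:R / N%:R)) =
          (fun N => N%:R * T ((n_ N)%:R / N%:R) - - (a / 2) * scaled m N (n_ N) ^+ 2 +
            - (a / 2) * scaled m N (n_ N) ^+ 2).
        by apply/funext => N; rewrite subrK.
      by rewrite -(add0r (- (a / 2) * x ^+ 2)); exact: cvgD.
    apply/cvgr0Pnorm_le => e e1.
    have M0 : 0 < x ^+ 2 + 1 by have := sqr_ge0 x; lra.
    have ee : 0 < e / (x ^+ 2 + 1) by rewrite divr_gt0.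
    have P2 := peano2 phid phi1d ee.
    near=> N.
    have N0 : (0 < N)%N by near: N; exact: nbhs_infty_gt.
    have N0' : 0 < N%:R :> R by rewrite ltr0n.
    rewrite -tw2// mulrCA -mulrBr normrM (ger0_norm (ltW N0')).
    have h : `|T ((n_ N)%:R / N%:R) - - (a / 2) * ((n_ N)%:R / N%:R - m) ^+ 2|
       <= (e / (x ^+ 2 + 1)) * ((n_ N)%:R / N%:R - m) ^+ 2.
      rewrite -[- (a / 2)]mulNr; near: N; exact: (tm _ P2).
    apply: (le_trans (ler_wpM2l (ltW N0') h)).
    rewrite mulrCA tw2// mulrAC ler_pdivrMr// ler_wpM2l//; first exact: ltW.
    by near: N; apply: (cvgr_le _ w2); rewrite ltrDl.
  rewrite mulrC /gauss subr0.
  apply: (@cvg_trans _ (expR (N%:R * T ((n_ N)%:R / N%:R)) /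
      (Num.sqrt ((n_ N)%:R / N%:R) * stirling_ratio R (n_ N)) @[N --> \oo])).
    by apply: near_eq_cvg; near=> N; rewrite /loc ifT//; near: N.
  apply: cvgM; first by apply: continuous_cvg => //; exact: continuous_expR.
  apply: cvgV; first by rewrite gt_eqF// mulr_gt0// sqrtr_gt0.
  apply: cvgM; first by apply: continuous_cvg => //; exact: sqrt_continuous.
  exact: (cvg_comp n_ (stirling_ratio R) ny sC).
Unshelve. all: end_near. Qed.

End local_coordinate.

(** * Products of generating functions *)
Section local_products.
Variable R : realType.
Implicit Types (m a b c d x y z : R) (u v : nat -> nat -> R).

(** One special coordinate u convolved with n copies of the common one v. *)
Definition conv_iter u v n := iter n (fun w => lconv w v) u.

(** The precision of the sum of independent parts is harmonic:
1 / (1/a + n/ay).  The condition ay + n a > 0 makes all intermediate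
sums of precisions positive, also for a < 0. *)
Lemma local_gauss_iter m a b c u (my ay bY cy : R) v n :
  0 < m -> 0 < my -> 0 < ay -> 0 < bY -> 0 < ay + n%:R * a -> 0 < bY + n%:R * b ->
  local_gauss m a b c u -> local_gauss my ay bY cy v ->
  local_gauss (m + n%:R * my) (a * ay / (ay + n%:R * a)) (b * bY / (bY + n%:R * b))
    (c * cy ^+ n * Num.sqrt ((2 * pi / ay) ^+ n * (ay / (ay + n%:R * a))))
    (conv_iter u v n).
Proof.
move=> m0 my0 ay0 by0 + + lu lv.
elim: n => [|n IH] an bn.
  rewrite mul0r !addr0 expr0 mulr1 mul0r addr0 expr0 mul1r divff ?gt_eqF//.
  by rewrite sqrtr1 mulr1 mulfK ?gt_eqF// mul0r addr0 mulfK ?gt_eqF.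
have prev (s t : R) : 0 < s -> 0 < s + n.+1%:R * t -> 0 < s + n%:R * t.
  move=> s0; have [t0 _|t0] := leP 0 t; first by rewrite ltr_pwDl// mulr_ge0.
  by rewrite -natr1 mulrDl mul1r; move: (n%:R * t) => nt; lra.
have an' := prev _ _ ay0 an; have bn' := prev _ _ by0 bn.
have sum_gt0 (s t : R) : 0 < s -> 0 < s + n.+1%:R * t -> 0 < s + n%:R * t ->
    t * s / (s + n%:R * t) + s = s * (s + n.+1%:R * t) / (s + n%:R * t).
  by move=> s0 st st'; rewrite -natr1; field; rewrite gt_eqF.
have Ea := sum_gt0 _ _ ay0 an an'; have Eb := sum_gt0 _ _ by0 bn bn'.
have h := IH an' bn'.
have ha : 0 < a * ay / (ay + n%:R * a) + ay by rewrite Ea divr_gt0// mulr_gt0.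
have hb : 0 < b * bY / (bY + n%:R * b) + bY by rewrite Eb divr_gt0// mulr_gt0.
have m'0 : 0 < m + n%:R * my by rewrite ltr_pwDl// mulr_ge0// ltW.
have := local_gauss_conv m'0 my0 ha hb h lv.
rewrite Ea Eb.
have an2 : 0 < ay + (1 + n%:R) * a by rewrite nat1r.
have bn2 : 0 < bY + (1 + n%:R) * b by rewrite nat1r.
have -> : m + n%:R * my + my = m + n.+1%:R * my by rewrite -natr1; ring.
have -> : a * ay / (ay + n%:R * a) * ay / (ay * (ay + n.+1%:R * a) / (ay + n%:R * a)) =
    a * ay / (ay + n.+1%:R * a) by field; rewrite !gt_eqF.
have -> : b * bY / (bY + n%:R * b) * bY / (bY * (bY + n.+1%:R * b) / (bY + n%:R * b)) =
    b * bY / (bY + n.+1%:R * b) by field; rewrite !gt_eqF.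
suff -> : forall X Y : R, 0 <= X ->
    c * cy ^+ n * Num.sqrt X * cy * Num.sqrt Y = c * cy ^+ n.+1 * Num.sqrt (X * Y).
  rewrite (_ : _ * _ * (2 * pi / _) = (2 * pi / ay) ^+ n.+1 * (ay / (ay + n.+1%:R * a)))//.
    by rewrite exprSr; field; rewrite !gt_eqF.
  by rewrite mulr_ge0 ?exprn_ge0 ?divr_ge0 ?mulr_ge0 ?pi_ge0// ltW.
by move=> X Y X0; rewrite sqrtrM// exprSr; ring.
Qed.

(** The pair of counts (j, N - j): the complementary part is determined by j since
the counts add up to N. *)
Definition pinned u v (N j : nat) : R :=
  if (j <= N)%N then u N j * v N (N - j)%N else 0.

Lemma scaled_compl m1 m2 N j : m1 + m2 = 1 -> (j <= N)%N ->
  scaled m2 N (N - j) = - scaled m1 N j.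
Proof.
move=> m12 jN; rewrite (scaledB m1)// /scaled m12 mulr1 subrr mul0r sub0r//.
Qed.

(** The two parts sit at opposite distances from their centres, so the
precisions add. *)
Lemma local_gauss_pinned m1 m2 a1 a2 b1 b2 c1 c2 u v :
  0 < m2 -> m1 + m2 = 1 ->
  local_gauss m1 a1 b1 c1 u -> local_gauss m2 a2 b2 c2 v ->
  local_gauss m1 (a1 + a2) (b1 + b2) (c1 * c2) (pinned u v).
Proof.
move=> m20 m12 [u0 [C1 uC] ul] [v0 [C2 vC] vl].
have gM (s t x : R) : gauss s 0 x * gauss t 0 (- x) = gauss (s + t) 0 x.
  by rewrite /gauss -expRD; congr expR; rewrite !subr0; field.
split.
- by move=> N n; rewrite /pinned; case: ifP => // _; rewrite mulr_ge0.
- exists (C1 * C2) => N n N0; rewrite /pinned; case: ifPn => [nN|_]; last first.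
    have C10 := le_trans (u0 N n) (uC N n N0).
    have C20 := le_trans (v0 N n) (vC N n N0).
    rewrite !pmulr_lge0 ?expR_gt0// in C10 C20.
    by rewrite !mulr_ge0// expR_ge0.
  rewrite -gM mulrACA -(scaled_compl m12 nN).
  by apply: ler_pM => //; [exact: uC|exact: vC].
- move=> n_ x nx.
  have nN : \forall N \near \oo, (n_ N <= N)%N.
    near=> N.
    have N0 : (0 < N)%N by near: N; exact: nbhs_infty_gt.
    have s0 : 0 < Num.sqrt (N%:R : R) by rewrite sqrtr_gt0 ltr0n.
    have h1 : scaled m1 N (n_ N) <= x + 1.
      by near: N; apply: (cvgr_le _ nx); rewrite ltrDl.
    have h2 : 0 <= N%:R * m2 + Num.sqrt N%:R * (- (x + 1)).
      by near: N; exact: near_unscaled_ge0.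
    rewrite -(ler_nat R); move: h1; rewrite /scaled ler_pdivrMr//.
    have -> : m1 = 1 - m2 by rewrite -m12 addrK.
    lra.
  rewrite -gM mulrACA.
  have h : u N (n_ N) * v N (N - n_ N)%N @[N --> \oo] -->
      c1 * gauss a1 0 x * (c2 * gauss a2 0 (- x)).
    apply: cvgM; first exact: ul.
    apply: vl; apply: cvg_trans; last exact: (cvgN nx).
    apply: near_eq_cvg; near=> N.
    by rewrite (scaled_compl m12)//; near: N.
  apply: cvg_trans h; apply: near_eq_cvg; near=> N.
  by rewrite /pinned ifT//; near: N.
Unshelve. all: end_near. Qed.

(** Generating functions whose coefficients are K exp(n b) u N n.  The exponential
factor is the same for all coordinates (it carries the Lagrange multiplier),
so it passes through products. *)
Definition egf_of (N : nat) (b K : R) u (P : {poly R}) :=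
  forall n, (n <= N)%N -> P`_n = K * expR (n%:R * b) * u N n.

Lemma egf_ofM N b K1 K2 u v P Q : (0 < N)%N -> egf_of N b K1 u P ->
  egf_of N b K2 v Q -> egf_of N b (K1 * K2 * Num.sqrt N%:R) (lconv u v) (P * Q).
Proof.
move=> N0 Pu Qv n nN; rewrite coefM /lconv.
have s0 : Num.sqrt N%:R != 0 :> R by rewrite gt_eqF// sqrtr_gt0 ltr0n.
rewrite (_ : K1 * K2 * _ * _ * _ = K1 * K2 * expR (n%:R * b) *
  (\sum_(j < n.+1) u N j * v N (n - j)%N)); last by field.
rewrite mulr_sumr; apply: eq_bigr => j _.
have jn : (j <= n)%N by rewrite -ltnS.
rewrite Pu ?(leq_trans jn)// Qv ?(leq_trans (leq_subr _ _))//.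
rewrite (_ : n%:R = j%:R + (n - j)%:R) ?mulrDl ?expRD; first by ring.
by rewrite -natrD subnKC.
Qed.

Lemma egf_of_iter N b K1 K2 u v P Q n : (0 < N)%N -> egf_of N b K1 u P ->
  egf_of N b K2 v Q ->
  egf_of N b (K1 * (K2 * Num.sqrt N%:R) ^+ n) (conv_iter u v n) (P * Q ^+ n).
Proof.
move=> N0 Pu Qv; elim: n => [|n IH]; first by rewrite !expr0 !mulr1.
have -> : K1 * (K2 * Num.sqrt N%:R) ^+ n.+1 =
    K1 * (K2 * Num.sqrt N%:R) ^+ n * K2 * Num.sqrt N%:R.
  by rewrite exprSr; ring.
by rewrite exprSr mulrA; exact: egf_ofM.
Qed.

Lemma egf_of_pinned N b K1 K2 u v P Q (g : nat -> R) :
  egf_of N b K1 u P -> egf_of N b K2 v Q ->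
  ((\poly_(n < N.+1) (g n * P`_n)) * Q)`_N =
  K1 * K2 * expR (N%:R * b) * \sum_(j < N.+1) pinned u v N j * g j.
Proof.
move=> Pu Qv; rewrite coefM mulr_sumr; apply: eq_bigr => j _.
have jN : (j <= N)%N by rewrite -ltnS.
rewrite coef_poly ltn_ord Pu// Qv ?leq_subr// /pinned jN.
rewrite (_ : N%:R = j%:R + (N - j)%:R) ?mulrDl ?expRD; first by ring.
by rewrite -natrD subnKC.
Qed.

End local_products.

(** * The Gibbs weight near a maximizer *)
Section near_sum.
Variable R : realType.
Variables (p : nat) (beta : R).
Implicit Types (h d x y lam : R).

(** Closed forms of the first two derivatives of k on x > 0. *)
Definition k1 x : R := beta * p%:R * x ^+ p.-1 - ln x - 1.
Definition k2 x : R := beta * p%:R * (p%:R - 1) * x ^+ (p - 2) - x^-1.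

Lemma der_k x : 0 < x -> der (potts_k p beta) x (k1 x).
Proof.
move=> x0; apply: der_eq; first by rewrite /potts_k; der_tac.
by rewrite /k1 /=; field; rewrite gt_eqF.
Qed.

Lemma der_k1 x : (0 < p)%N -> 0 < x -> der k1 x (k2 x).
Proof.
move=> p0 x0; apply: der_eq; first by rewrite /k1; der_tac.
rewrite /k2 subn2 -subn1 natrB//=; field; by rewrite gt_eqF.
Qed.

Variable n : nat.
Notation q := n.+2.
Implicit Types (m : q.-tuple R) (N : nat).

Definition field_at h (r : 'I_q) : R := if r == ord0 then h else 0.

Definition near_max m d N (X : {ffun 'I_N -> 'I_q}) : bool :=
  [forall r, `|(cnt X r)%:R / N%:R - tnth m r| <= d].

Definition cut_egf h m d N (r : 'I_q) : {poly R} :=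
  \poly_(i < N.+1) (if `|i%:R / N%:R - tnth m r| <= d then
    expR (beta * N%:R * (i%:R / N%:R) ^+ p + field_at h r * i%:R) / i`!%:R else 0).

Lemma cnt_le N (X : {ffun 'I_N -> 'I_q}) r : (@cnt q N X r <= N)%N.
Proof. by rewrite -[leqRHS](card_ord N); exact: max_card. Qed.

Lemma freqE N (X : {ffun 'I_N -> 'I_q}) r : tnth (freq R X) r = (@cnt q N X r)%:R / N%:R.
Proof. by rewrite tnth_mktuple. Qed.

Lemma freq0E N (X : {ffun 'I_N -> 'I_q}) : (freq R X)`_0 = (@cnt q N X ord0)%:R / N%:R.
Proof. by rewrite -freqE (tnth_nth 0). Qed.

Lemma gibbs_weightE h N (X : {ffun 'I_N -> 'I_q}) : (0 < N)%N -> gibbs_weight p beta h X =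
  \prod_(r < q) expR (beta * N%:R * ((cnt X r)%:R / N%:R) ^+ p +
                      field_at h r * (@cnt q N X r)%:R).
Proof.
move=> N0; have N0' : 0 < N%:R :> R by rewrite ltr0n.
rewrite /gibbs_weight freq0E -expR_sum; congr expR.
rewrite big_split/= -mulr_sumr big_map big_enum/=; congr (_ + _).
rewrite (bigD1 ord0)//= [X in _ + X]big1 ?addr0 /field_at ?eqxx; last first.
  by move=> r /negbTE ->; rewrite mul0r.
by field; rewrite gt_eqF.
Qed.

Definition near_sum h m d N (g : nat -> R) : R :=
  \sum_(X : {ffun 'I_N -> 'I_q} | near_max m d X) gibbs_weight p beta h X * g (cnt X ord0).

(** The Gibbs weight is a product over the colours of functions of their counts,
so the exponential formula applies; g multiplies the factor of colour 1. *)
Lemma near_sumE h m d N g : (0 < N)%N ->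
  near_sum h m d N g = N`!%:R *
    ((\poly_(i < N.+1) (g i * (cut_egf h m d N ord0)`_i)) *
     \prod_(r | r != ord0) cut_egf h m d N r)`_N.
Proof.
move=> N0.
pose P (r : 'I_q) := if r == ord0 then \poly_(i < N.+1) (g i * (cut_egf h m d N ord0)`_i)
              else cut_egf h m d N r.
have -> : (\poly_(i < N.+1) (g i * (cut_egf h m d N ord0)`_i)) *
     \prod_(r | r != ord0) cut_egf h m d N r = \prod_r P r.
  rewrite [RHS](bigD1 ord0)//= /P eqxx; congr (_ * _).
  by apply: eq_bigr => r /negbTE ->.
rewrite -sum_words /near_sum big_mkcond/=; apply: eq_bigr => X _.
have Pr r : (cnt X r)`!%:R * (P r)`_(cnt X r) =
   (if r == ord0 then g (cnt X ord0) else 1) *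
   (if `|(cnt X r)%:R / N%:R - tnth m r| <= d then
     expR (beta * N%:R * ((cnt X r)%:R / N%:R) ^+ p + field_at h r * (cnt X r)%:R) else 0).
  have f0 : (cnt X r)`!%:R != 0 :> R by rewrite pnatr_eq0 -lt0n fact_gt0.
  rewrite /P; case: eqP => [->|_].
    rewrite coef_poly ltnS cnt_le /cut_egf coef_poly ltnS cnt_le.
    have f00 : (cnt X ord0)`!%:R != 0 :> R by rewrite pnatr_eq0 -lt0n fact_gt0.
    by case: ifP => _; [field|rewrite !mulr0].
  rewrite /cut_egf coef_poly ltnS cnt_le mul1r.
  by case: ifP => _; [field|rewrite mulr0].
rewrite (eq_bigr _ (fun r _ => Pr r)) big_split/=.
have -> : \prod_(i < q) (if i == ord0 then g (cnt X ord0) else 1) = g (cnt X ord0).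
  by rewrite -big_mkcond/= big_pred1_eq.
case: ifPn => [/forallP nX|].
  rewrite gibbs_weightE// mulrC; congr (_ * _); apply: eq_bigr => r _.
  by rewrite nX.
rewrite negb_forall => /existsP[r nr].
by rewrite (bigD1 r)//= (negbTE nr) mul0r mulr0.
Qed.

Definition coord_loc d x : nat -> nat -> R := loc (potts_k p beta) (k1 x) x d.

(** The affine part of the exponent at m_r becomes exp(n lam) times a constant,
where lam is the Lagrange multiplier, which does not depend on r. *)
Lemma cut_egf_of h m d N r lam : (0 < N)%N -> d < tnth m r ->
  k1 (tnth m r) + field_at h r = lam ->
  egf_of N (1 - ln N%:R + lam)
    ((Num.sqrt N%:R)^-1 * expR (N%:R * (potts_k p beta (tnth m r) +
       field_at h r * tnth m r - lam * tnth m r)))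
    (coord_loc d (tnth m r)) (cut_egf h m d N r).
Proof.
move=> N0 dm lamE i iN; have N0' : 0 < N%:R :> R by rewrite ltr0n.
rewrite coef_poly ltnS iN /coord_loc /loc; case: ifPn => [ti|_]; last by rewrite mulr0.
have t0 : 0 < i%:R / N%:R :> R.
  by move: ti; rewrite ler_norml => /andP[h1 _]; move: h1 dm; lra.
have i0' : 0 < i%:R :> R by move: t0; rewrite pmulr_lgt0 ?invr_gt0.
have i0 : (0 < i)%N by rewrite -(ltr0n R).
have -> : (i`!%:R)^-1 = expR (i%:R - i%:R * ln i%:R) /
    (Num.sqrt N%:R * Num.sqrt (i%:R / N%:R) * stirling_ratio R i) :> R.
  have -> : Num.sqrt N%:R * Num.sqrt (i%:R / N%:R) = Num.sqrt i%:R :> R.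
    by rewrite -sqrtrM ?ler0n// mulrC divfK// gt_eqF.
  rewrite /stirling_ratio; field.
  by rewrite !gt_eqF ?sqrtr_gt0 ?expR_gt0 ?ltr0n ?fact_gt0.
set t := i%:R / N%:R; set S := stirling_ratio R i.
have E : expR (beta * N%:R * t ^+ p + field_at h r * i%:R) *
      expR (i%:R - i%:R * ln i%:R) =
    expR (N%:R * (potts_k p beta (tnth m r) + field_at h r * tnth m r - lam * tnth m r)) *
    expR (i%:R * (1 - ln N%:R + lam)) *
    expR (N%:R * (potts_k p beta t - potts_k p beta (tnth m r) -
      k1 (tnth m r) * (t - tnth m r))).
  rewrite -!expRD; congr expR.
  have iE : i%:R = N%:R * t by rewrite /t mulrC divfK// gt_eqF.
  have lnE : ln i%:R = ln N%:R + ln t by rewrite iE lnM ?posrE.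
  have -> : k1 (tnth m r) = lam - field_at h r by rewrite -lamE addrK.
  rewrite lnE iE /potts_k; ring.
have S0 : S != 0 by rewrite gt_eqF// stirling_ratio_gt0.
have sN : Num.sqrt N%:R != 0 :> R by rewrite gt_eqF// sqrtr_gt0.
have st : Num.sqrt t != 0 by rewrite gt_eqF// sqrtr_gt0.
rewrite mulrA E; field.
by rewrite S0 sN st.
Qed.

Lemma card_other (j : 'I_q) : j != ord0 ->
  #|[pred r : 'I_q | (r != ord0) && (r != j)]| = n.
Proof.
move=> j0; have := cardC (pred2 (ord0 : 'I_q) j); rewrite card2 eq_sym j0 card_ord.
move=> h2; apply: (@addnI 2); rewrite -[RHS]h2; congr (_ + _)%N.
by apply: eq_card => r; rewrite !inE negb_or.
Qed.

Lemma sum_other (j : 'I_q) (F : 'I_q -> R) (f : R) : j != ord0 ->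
  (forall r, r != ord0 -> r != j -> F r = f) ->
  \sum_r F r = F ord0 + F j + n%:R * f.
Proof.
move=> j0 Ff; rewrite (bigD1 ord0)//= (bigD1 j)//= addrA; congr (_ + _).
rewrite (eq_bigr (fun=> f)); last by move=> r /andP[r0 rj]; exact: Ff.
by rewrite sumr_const card_other// mulr_natl.
Qed.

Lemma potts_HE h m :
  potts_H p beta h m = \sum_r potts_k p beta (tnth m r) + h * tnth m ord0.
Proof.
rewrite /potts_H !big_tuple mulr_sumr [m`_0](_ : _ = tnth m ord0); last by rewrite (tnth_nth 0).
by rewrite addrAC -sumrB.
Qed.

(** All coordinates but the first and the j-th are equal to y, so the sum is a
coefficient of (first factor) (j-th factor) (y-factor)^n.  By the Lagrange
condition the constants combine into exp(N H(m)). *)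
Lemma near_sum_loc h m d y lam (j : 'I_q) N g : (0 < N)%N -> j != ord0 ->
  (forall r, d < tnth m r) -> d < y -> \sum_r tnth m r = 1 ->
  (forall r, k1 (tnth m r) + field_at h r = lam) -> k1 y = lam ->
  (forall r, r != ord0 -> r != j -> tnth m r = y) ->
  near_sum h m d N g = stirling_ratio R N * expR (N%:R * potts_H p beta h m) *
    ((\sum_(i < N.+1)
        pinned (coord_loc d (tnth m ord0)) (conv_iter (coord_loc d (tnth m j)) (coord_loc d y) n) N i * g i)
      / Num.sqrt N%:R).
Proof.
move=> N0 j0 dm dy m1 lamE ylam my; have N0' : 0 < N%:R :> R by rewrite ltr0n.
rewrite near_sumE// (bigD1 j)//=.
pose Py := \poly_(i < N.+1) (if `|i%:R / N%:R - y| <= d then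
    expR (beta * N%:R * (i%:R / N%:R) ^+ p) / i`!%:R else 0).
have -> : \prod_(r | (r != ord0) && (r != j)) cut_egf h m d N r = Py ^+ n.
  rewrite (eq_bigr (fun=> Py)); last first.
    move=> r /andP[r0 rj]; apply/polyP => i; rewrite !coef_poly my//.
    by rewrite /field_at (negbTE r0) mul0r addr0.
  by rewrite prodr_const -[in RHS](card_other j0).
have e0 := cut_egf_of N0 (dm ord0) (lamE ord0).
have ej := cut_egf_of N0 (dm j) (lamE j).
have ey : egf_of N (1 - ln N%:R + lam)
    ((Num.sqrt N%:R)^-1 * expR (N%:R * (potts_k p beta y - lam * y))) (coord_loc d y) Py.
  pose cy : q.-tuple R := [tuple y | r < q].
  have := @cut_egf_of h cy d N j lam N0; rewrite tnth_mktuple /field_at (negbTE j0).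
  rewrite mul0r !addr0 => /(_ dy ylam) h1 i iN; rewrite -h1// !coef_poly.
  by rewrite tnth_mktuple /field_at (negbTE j0) mul0r addr0.
rewrite (egf_of_pinned g e0 (egf_of_iter n N0 ej ey)).
set S := \sum_(i < _) _.
have sN : Num.sqrt N%:R != 0 :> R by rewrite gt_eqF// sqrtr_gt0.
pose E x f := expR (N%:R * (potts_k p beta x + f * x - lam * x)).
have -> : expR (N%:R * (potts_k p beta y - lam * y)) = E y 0 by rewrite /E mul0r addr0.
rewrite -/(E _ _) -/(E _ _).
have -> : (Num.sqrt N%:R)^-1 * E y 0 * Num.sqrt N%:R = E y 0 by field.
have EE : E (tnth m ord0) (field_at h ord0) * E (tnth m j) (field_at h j) * E y 0 ^+ n *
    expR (N%:R * (1 - ln N%:R + lam)) =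
    expR (N%:R - N%:R * ln N%:R) * expR (N%:R * potts_H p beta h m).
  rewrite /E -expRM_natl -!expRD; congr expR.
  rewrite potts_HE (@sum_other j _ (potts_k p beta y))//; last first.
    by move=> r r0 rj; rewrite my.
  have := m1; rewrite (@sum_other j _ y)// => m1'.
  have -> : field_at h j = 0 by rewrite /field_at (negbTE j0).
  rewrite /field_at eqxx.
  have -> : tnth m ord0 = 1 - tnth m j - n%:R * y by lra.
  ring.
rewrite /stirling_ratio.
rewrite [LHS](_ : _ = N`!%:R * (E (tnth m ord0) (field_at h ord0) *
    E (tnth m j) (field_at h j) * E y 0 ^+ n * expR (N%:R * (1 - ln N%:R + lam))) /
    (Num.sqrt N%:R * Num.sqrt N%:R) * S).
  by rewrite EE; field.
move: (E _ _) (E _ _) (E _ _ ^+ n) (expR _) => *; by field.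
Qed.

Hypothesis p_gt0 : (0 < p)%N.

(** The uniform bounds lose a little precision, and the positivity conditions
survive a small loss by continuity. *)
Lemma prec_gt0_stable (a0 aj ay : R) : 0 < ay -> 0 < ay + n%:R * aj ->
  0 < a0 + aj * ay / (ay + n%:R * aj) ->
  \forall e \near 0^'+, [/\ 0 < ay - e, 0 < (ay - e) + n%:R * (aj - e) &
    0 < (a0 - e) + (aj - e) * (ay - e) / ((ay - e) + n%:R * (aj - e))].
Proof.
move=> ay0 D0 S0.
have cB (x : R) : x - e @[e --> 0^'+] --> x.
  rewrite -[X in _ --> X]subr0; apply: cvgB; first exact: cvg_cst.
  by apply: cvg_at_right_filter; exact: cvg_id.
have cD : (ay - e) + n%:R * (aj - e) @[e --> 0^'+] --> ay + n%:R * aj.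
  by apply: cvgD => //; apply: cvgM => //; exact: cvg_cst.
have cS : (a0 - e) + (aj - e) * (ay - e) / ((ay - e) + n%:R * (aj - e)) @[e --> 0^'+]
    --> a0 + aj * ay / (ay + n%:R * aj).
  apply: cvgD => //; apply: cvgM; first exact: cvgM.
  by apply: cvgV => //; rewrite gt_eqF.
near=> e; split; near: e; [exact: (cvgr_gt _ (cB ay))|exact: (cvgr_gt _ cD)|exact: (cvgr_gt _ cS)].
Unshelve. all: end_near. Qed.

(** Precision of the first count: its own, plus the precision of the rest, which is
the harmonic combination of one aj and n copies of ay. *)
Definition prec a0 aj ay : R := a0 + aj * ay / (ay + n%:R * aj).

Lemma local_gauss_counts (x0 xj y C : R) :
  0 < x0 -> 0 < xj -> 0 < y -> x0 + xj + n%:R * y = 1 ->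
  0 < - k2 y -> 0 < - k2 y + n%:R * - k2 xj -> 0 < prec (- k2 x0) (- k2 xj) (- k2 y) ->
  stirling_ratio R i @[i --> \oo] --> C -> 0 < C ->
  (forall i, (0 < i)%N -> C <= stirling_ratio R i) ->
  exists2 b : R, 0 < b & \forall d \near 0^'+,
   local_gauss x0 (prec (- k2 x0) (- k2 xj) (- k2 y)) b
     ((Num.sqrt x0 * C)^-1 * ((Num.sqrt xj * C)^-1 * (Num.sqrt y * C)^-1 ^+ n *
       Num.sqrt ((2 * pi / - k2 y) ^+ n * (- k2 y / (- k2 y + n%:R * - k2 xj)))))
     (pinned (coord_loc d x0) (conv_iter (coord_loc d xj) (coord_loc d y) n)).
Proof.
move=> x00 xj0 y0 sum1 ay0 D0 S0 sC C0 Cs.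
(* A common loss e for the three uniform bounds. *)
have [e [e0 [ey eD eS]]] : exists e : R, 0 < e /\
   [/\ 0 < (- k2 y) - e, 0 < ((- k2 y) - e) + n%:R * ((- k2 xj) - e) &
    0 < ((- k2 x0) - e) + ((- k2 xj) - e) * ((- k2 y) - e) /
       (((- k2 y) - e) + n%:R * ((- k2 xj) - e))].
  near (0 : R)^'+ => e; exists e; split; first by [].
  by near: e; exact: prec_gt0_stable.
exists (prec (- k2 x0 - e) (- k2 xj - e) (- k2 y - e)) => //.
have loc_near x : 0 < x -> \forall d \near 0^'+,
    local_gauss x (- k2 x) (- k2 x - e) (Num.sqrt x * C)^-1 (coord_loc d x).
  move=> x_gt0; apply: loc_local_gauss => //.
  - by rewrite gtrBl.
  - by near=> z; apply: der_k; near: z; exact: lt_nbhsr.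
  - by rewrite opprK; exact: der_k1.
near=> d.
have l0 : local_gauss x0 (- k2 x0) (- k2 x0 - e) (Num.sqrt x0 * C)^-1 (coord_loc d x0).
  by near: d; exact: loc_near.
have lj : local_gauss xj (- k2 xj) (- k2 xj - e) (Num.sqrt xj * C)^-1 (coord_loc d xj).
  by near: d; exact: loc_near.
have ly : local_gauss y (- k2 y) (- k2 y - e) (Num.sqrt y * C)^-1 (coord_loc d y).
  by near: d; exact: loc_near.
have := local_gauss_iter xj0 y0 ay0 ey D0 eD lj ly.
apply: local_gauss_pinned => //; last by rewrite addrA.
by rewrite ltr_pwDl// mulr_ge0// ltW.
Unshelve. all: end_near. Qed.

End near_sum.

(** * The Gibbs weight away from the maximizers *)
Section far_region.
Variable R : realType.
Variables (p : nat) (beta : R) (n : nat).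
Notation q := n.+2.
Implicit Types (h d x : R) (m : q.-tuple R).

Lemma cvg_sumr {T I : Type} (F : set_system T) (s : seq I) (P : pred I)
    (f : I -> T -> R) (l : I -> R) : Filter F ->
  (forall i, P i -> f i x @[x --> F] --> l i) ->
  \sum_(i <- s | P i) f i x @[x --> F] --> \sum_(i <- s | P i) l i.
Proof.
move=> FF fl; elim: s => [|i s IH].
  by under eq_fun do rewrite big_nil; rewrite big_nil; exact: cvg_cst.
under eq_fun do rewrite big_cons; rewrite big_cons.
case: ifPn => // Pi; apply: cvgD => //; exact: fl.
Qed.

Lemma continuous_xlnx : continuous (fun x : R => x * ln x).
Proof.
move=> x; have [x0|x0|->] := ltgtP x 0.
- have : cst 0 y @[y --> x] --> (0 : R) by exact: cvg_cst.
  rewrite /continuous_at ln0 ?ltW// mulr0; apply: cvg_trans; apply: near_eq_cvg.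
  near=> y; rewrite ln0 ?mulr0//; apply: ltW; near: y; exact: lt_nbhsl.
- by apply: cvgM; [exact: cvg_id|exact: continuous_ln].
- rewrite /continuous_at mul0r; apply/cvgr0Pnorm_le => e e0.
  have xlnx_le (y : R) : 0 < y -> y < 1 -> `|y * ln y| <= 2 * Num.sqrt y.
    move=> y0 y1; have s0 : 0 < Num.sqrt y by rewrite sqrtr_gt0.
    rewrite normrM (gtr0_norm y0) ltr0_norm ?ln_lt0 ?y0//.
    have : ln (Num.sqrt y)^-1 < (Num.sqrt y)^-1 by apply: ln_sublinear; rewrite invr_gt0.
    rewrite lnV ?posrE// => h.
    have := ler_wpM2l (ltW s0) (ltW h); rewrite divff ?gt_eqF// => {}h.
    have -> : y * - ln y = 2 * Num.sqrt y * (Num.sqrt y * - ln (Num.sqrt y)).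
      have yE := esym (sqr_sqrtr (ltW y0)).
      by rewrite {1 2}yE lnXn//; ring.
    by rewrite ler_piMr// mulr_ge0// ltW.
  near=> y; have [y0|y0] := leP y 0.
    by rewrite ln0// mulr0 normr0 ltW.
  have y1 : y < 1 by near: y; exact: lt_nbhsl.
  apply: (le_trans (xlnx_le _ y0 y1)).
  have : y <= (e / 2) ^+ 2.
    by apply: ltW; near: y; apply: lt_nbhsl; rewrite exprn_gt0// divr_gt0.
  move=> /ler_wsqrtr; rewrite sqrtr_sqr gtr0_norm ?divr_gt0//; lra.
Unshelve. all: end_near. Qed.

Lemma continuous_potts_k : continuous (@potts_k R p beta).
Proof.
move=> x; rewrite /potts_k; apply: cvgB; last exact: continuous_xlnx.
by apply: cvgM; [exact: cvg_cst|exact: exprn_continuous].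
Qed.

Definition row_of (m : q.-tuple R) : 'rV[R]_q := \row_r tnth m r.
Definition of_row (v : 'rV[R]_q) : q.-tuple R := [tuple v ord0 r | r < q].

Lemma row_ofK : cancel row_of of_row.
Proof. by move=> m; apply: eq_from_tnth => r; rewrite tnth_mktuple mxE. Qed.

Lemma prob_vec_le1 m r : prob_vec m -> tnth m r <= 1.
Proof.
move=> [m0 <-]; rewrite big_tuple (bigD1 r)//= lerDl.
by apply: sumr_ge0.
Qed.

(** The probability vectors at distance at least d from all maximizers form a
compact set, on which H attains a value below the maximum. *)
Lemma far_gap h (ms : seq (q.-tuple R)) (m0 : q.-tuple R) d : 0 < d ->
  (forall m, H_maximizers p q beta h m -> m \in ms) -> H_maximizers p q beta h m0 ->
  exists2 eta, 0 < eta & forall t : q.-tuple R, prob_vec t ->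
    (forall m, m \in ms -> exists r, d < `|tnth t r - tnth m r|) ->
    potts_H p beta h t <= potts_H p beta h m0 - eta.
Proof.
move=> d0 msP m0max.
pose coord r (v : 'rV[R]_q) := v ord0 r.
have cc r : continuous (coord r) by exact: coord_continuous.
pose HH (v : 'rV[R]_q) := potts_H p beta h (of_row v).
have HHE : HH = (fun v => \sum_r potts_k p beta (coord r v) + h * coord ord0 v).
  apply/funext => v; rewrite /HH potts_HE tnth_mktuple; congr (_ + _).
  by apply: eq_bigr => r _; rewrite tnth_mktuple.
have cH : continuous HH.
  have c1 : continuous (fun v => \sum_r potts_k p beta (coord r v)).
    move=> v; apply: (@cvg_sumr _ _ (nbhs v)) => r _.
    by apply: continuous_comp; [exact: cc|exact: continuous_potts_k].
  have c2 : continuous (fun v => h * coord ord0 v).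
    by move=> v; exact: (cvgM (cvg_cst h) (cc ord0 v)).
  by rewrite HHE => v; exact: cvgD (c1 v) (c2 v).
(* The sum of distances replaces the existence of a far coordinate by a closed
   condition. *)
pose K := [set v : 'rV[R]_q | forall r, `[0, 1]%classic (v ord0 r)] `&`
   ((fun v => \sum_r coord r v) @^-1` [set x | x = 1] `&`
    \bigcap_(m in [set` ms]) ((fun v => \sum_r `|coord r v - tnth m r|) @^-1` [set x | d <= x])).
have cpK : compact K.
  apply: compact_closedI.
    by apply: (@rV_compact R q (fun=> `[0, 1]%classic)) => r; exact: segment_compact.
  apply: closedI.
    apply: preimage_closed; last exact: closed_eq.
    by move=> v _; apply: (@cvg_sumr _ _ (nbhs v)) => r _; exact: cc.
  apply: closed_bigI => m _; apply: preimage_closed; last exact: closed_ge.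
  move=> v _; apply: (@cvg_sumr _ _ (nbhs v)) => r _; apply: cvg_norm.
  exact: (cvgB (cc r v) (cvg_cst _)).
have KP v : K v -> prob_vec (of_row v).
  move=> [v01 [sv _]]; split.
    by move=> r; rewrite tnth_mktuple; have /= := v01 r; rewrite in_itv/= => /andP[].
  by rewrite big_tuple -[RHS]sv; apply: eq_bigr => r _; rewrite tnth_mktuple.
have PK (t : q.-tuple R) : prob_vec t ->
    (forall m, m \in ms -> exists r, d < `|tnth t r - tnth m r|) -> K (row_of t).
  move=> tP tm; split; first by move=> r /=; rewrite mxE in_itv/= tP.1 prob_vec_le1.
  split; first by rewrite /= -[RHS]tP.2 big_tuple; apply: eq_bigr => r _; rewrite /coord mxE.
  move=> m /= /tm[r tr]; rewrite (bigD1 r)//= /coord mxE.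
  by rewrite (le_trans (ltW tr))// lerDl sumr_ge0.
have [K0|/set0P Kn0] := eqVneq K set0.
  exists 1 => // t tP tm; have := PK t tP tm; by rewrite K0.
have [v Kv vmax] := EVT_max_rV Kn0 cpK (continuous_subspaceT cH).
rewrite inE in Kv.
exists (potts_H p beta h m0 - HH v).
  rewrite subr_gt0 lt_neqAle m0max.2 ?andbT; last exact: KP.
  apply/eqP => vm0.
  have vm : H_maximizers p q beta h (of_row v).
    by split; [exact: KP|move=> t tP; rewrite -/(HH v) vm0; exact: m0max.2].
  case: Kv => _ [_ /(_ _ (msP _ vm))] /=.
  rewrite big1 => [|r _]; first by rewrite leNgt d0.
  by rewrite tnth_mktuple /coord subrr normr0.
move=> t tP tm; rewrite opprB addrC subrK.
have := vmax (row_of t); rewrite inE => /(_ (PK t tP tm)).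
by rewrite {1}/HH row_ofK.
Qed.

Lemma big_freq (F : R -> R) N (X : {ffun 'I_N -> 'I_q}) :
  \sum_(x <- freq R X) F x = \sum_r F (tnth (freq R X) r).
Proof.
rewrite [LHS]big_map big_enum/=; apply: eq_bigr => r _; by rewrite freqE.
Qed.

Lemma prob_vec_freq N (X : {ffun 'I_N -> 'I_q}) : (0 < N)%N -> prob_vec (freq R X).
Proof.
move=> N0; split; first by move=> r; rewrite freqE divr_ge0.
rewrite (big_freq id); under eq_bigr do rewrite freqE.
by rewrite -mulr_suml -natr_sum cnt_sum divff// pnatr_eq0 -lt0n.
Qed.

(** The entropy term turns the weight of X into exp(N H) times the probability of
X under independent letters with law the frequencies of X. *)
Lemma gibbs_weight_entropy h N (X : {ffun 'I_N -> 'I_q}) : (0 < N)%N ->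
  gibbs_weight p beta h X =
  expR (N%:R * potts_H p beta h (freq R X)) * \prod_i tnth (freq R X) (X i).
Proof.
move=> N0; have N0' : 0 < N%:R :> R by rewrite ltr0n.
have -> : \prod_i tnth (freq R X) (X i) =
    expR (N%:R * \sum_(x <- freq R X) x * ln x).
  rewrite (partition_big X predT)//= (big_freq (fun x => x * ln x)) mulr_sumr expR_sum.
  apply: eq_bigr => r _.
  rewrite (eq_bigr (fun=> tnth (freq R X) r)); last by move=> i /eqP ->.
  rewrite prodr_const -/(cnt X r) mulrA.
  have -> : N%:R * tnth (freq R X) r = (cnt X r)%:R.
    by rewrite freqE mulrC divfK// gt_eqF.
  rewrite expRM_natl; have [c0|c0] := posnP (cnt X r); first by rewrite c0 !expr0.
  by rewrite lnK// posrE freqE divr_gt0// ltr0n.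
rewrite -expRD /gibbs_weight /potts_H; congr expR; ring.
Qed.

(** On words with the same counts, the frequencies of X are those of X0, and the
products are probabilities of distinct words. *)
Lemma sum_types N (X0 : {ffun 'I_N -> 'I_q}) : (0 < N)%N ->
  \sum_(X : {ffun 'I_N -> 'I_q} | [forall r, cnt X r == cnt X0 r])
    \prod_i tnth (freq R X) (X i) <= 1.
Proof.
move=> N0.
have t0 r : 0 <= tnth (freq R X0) r by rewrite freqE divr_ge0.
rewrite (eq_bigr (fun X : {ffun 'I_N -> 'I_q} => \prod_i tnth (freq R X0) (X i))); last first.
  move=> X /forallP XX0; apply: eq_bigr => i _.
  by rewrite !freqE (eqP (XX0 _)).
apply: (@le_trans _ _ (\sum_(X : {ffun 'I_N -> 'I_q}) \prod_i tnth (freq R X0) (X i))).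
  rewrite big_mkcond/=; apply: ler_sum => X _; case: ifP => // _.
  exact: prodr_ge0.
(* The sum over all words factors into N sums equal to 1. *)
rewrite -(bigA_distr_bigA (fun _ r => tnth (freq R X0) r)).
have := (prob_vec_freq X0 N0).2; rewrite (big_freq id) => ->.
by rewrite big1.
Qed.

(** There are at most (N + 1)^q vectors of counts, each contributing a
probability times exp(N H). *)
Lemma far_sum_le h (far : forall N, pred {ffun 'I_N -> 'I_q}) (H0 : R) N : (0 < N)%N ->
  (forall X, far N X -> potts_H p beta h (freq R X) <= H0) ->
  \sum_(X | far N X) gibbs_weight p beta h X <= N.+1%:R ^+ q * expR (N%:R * H0).
Proof.
move=> N0 farH.
have ty_gt (X : {ffun 'I_N -> 'I_q}) (r : 'I_q) : (cnt X r < N.+1)%N by rewrite ltnS cnt_le.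
pose ty (X : {ffun 'I_N -> 'I_q}) := [ffun r => Ordinal (ty_gt X r)].
apply: (@le_trans _ _ (\sum_(X : {ffun 'I_N -> 'I_q})
    expR (N%:R * H0) * \prod_i tnth (freq R X) (X i))).
  rewrite big_mkcond/=; apply: ler_sum => X _.
  have P0 : 0 <= \prod_i tnth (freq R X) (X i).
    by apply: prodr_ge0 => i _; rewrite freqE divr_ge0.
  case: ifPn => [fX|_]; last by rewrite mulr_ge0 ?expR_ge0.
  rewrite gibbs_weight_entropy// ler_wpM2r// ler_expR ler_wpM2l//; exact: farH.
rewrite -mulr_sumr mulrC ler_wpM2r ?expR_ge0//.
rewrite (partition_big ty predT)//=.
apply: (@le_trans _ _ (\sum_(c : {ffun 'I_q -> 'I_N.+1}) 1)); last first.
  by rewrite sumr_const card_ffun !card_ord natrX.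
apply: ler_sum => c _.
have [[X0 /eqP X0c]|nX] := pselect (exists X0, ty X0 == c); last first.
  rewrite big1 ?ler01// => X Xc; exfalso; apply: nX; by exists X.
apply: le_trans (sum_types X0 N0); rewrite le_eqVlt; apply/orP; left; apply/eqP.
apply: eq_bigl => X; rewrite -X0c; apply/eqP/forallP => [XX r|XX].
  by have /ffunP/(_ r) := XX; rewrite !ffunE => /(congr1 val) /= ->.
by apply/ffunP => r; rewrite !ffunE; apply: val_inj => /=; exact/eqP.
Qed.

End far_region.

(** * The maximum likelihood estimator as a quantile of the mean *)
Section exp_sums.
Variables (R : realType) (I : finType) (A a : I -> R).
Hypothesis A_gt0 : forall i, 0 < A i.
Hypothesis a_neq0 : exists i, a i != 0.
Implicit Types (s t c : R).

Definition expsum t : R := \sum_i A i * expR (t * a i).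
Definition expsum1 t : R := \sum_i A i * a i * expR (t * a i).

Lemma expsum_ge t i : A i * expR (t * a i) <= expsum t.
Proof.
rewrite /expsum (bigD1 i)//= lerDl; apply: sumr_ge0 => j _.
by rewrite mulr_ge0 ?expR_ge0// ltW.
Qed.

Lemma expsum_gt0 t : 0 < expsum t.
Proof.
have [i _] := a_neq0; apply: lt_le_trans (expsum_ge t i).
by rewrite mulr_gt0// expR_gt0.
Qed.

Lemma continuous_expsum : continuous expsum.
Proof.
move=> t; apply: (@cvg_sumr _ _ _ (nbhs t)) => i _.
apply: cvgM; first exact: cvg_cst.
apply: continuous_cvg; first exact: continuous_expR.
by apply: cvgM; [exact: cvg_id|exact: cvg_cst].
Qed.

Lemma continuous_expsum1 : continuous expsum1.
Proof.
move=> t; apply: (@cvg_sumr _ _ _ (nbhs t)) => i _.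
apply: cvgM; first exact: cvg_cst.
apply: continuous_cvg; first exact: continuous_expR.
by apply: cvgM; [exact: cvg_id|exact: cvg_cst].
Qed.

(** Strict convexity of the exponential. *)
Lemma expsum_tangent s t : s != t -> expsum t + (s - t) * expsum1 t < expsum s.
Proof.
move=> st; rewrite /expsum /expsum1 mulr_sumr -big_split/=.
have expE i : expR (s * a i) = expR (t * a i) * expR ((s - t) * a i).
  by rewrite -expRD; congr expR; ring.
have le1 i : A i * expR (t * a i) + (s - t) * (A i * a i * expR (t * a i)) <=
    A i * expR (s * a i).
  rewrite expE (_ : _ + _ = A i * expR (t * a i) * (1 + (s - t) * a i)); last by ring.
  by rewrite mulrA ler_wpM2l ?expR_ge1Dx// mulr_ge0 ?expR_ge0// ltW.
have [i ai] := a_neq0.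
rewrite (bigD1 i)//= [ltRHS](bigD1 i)//=; apply: ltr_leD; last exact: ler_sum.
rewrite expE (_ : _ + _ = A i * expR (t * a i) * (1 + (s - t) * a i)); last by ring.
rewrite mulrA ltr_pM2l; last by rewrite mulr_gt0// expR_gt0.
by apply: expR_gt1Dx; rewrite mulf_neq0// subr_eq0.
Qed.

Lemma expsum_min_le h0 c : (forall t, expsum h0 <= expsum t) ->
  (h0 <= c) = (0 <= expsum1 c).
Proof.
move=> h0min; have := expsum_tangent; have [hc tg|ch tg|<- tg] := ltgtP h0 c.
- have := tg h0 c (negbT (lt_eqF hc)); have := h0min c.
  have [//|] := leP 0 (expsum1 c); nra.
- have := tg h0 c (negbT (gt_eqF ch)); have := h0min c.
  by have [|//] := leP 0 (expsum1 c); nra.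
- apply/esym; rewrite leNgt; apply/negP => neg.
  have cr : expsum1 s @[s --> h0^'+] --> expsum1 h0.
    exact/cvg_at_right_filter/continuous_expsum1.
  near h0^'+ => s.
  have s1 : expsum1 s < 0 by near: s; exact: (cvgr_lt _ cr).
  have hs : h0 < s by [].
  have := tg h0 s (negbT (lt_eqF hs)); have := h0min s; nra.
Unshelve. all: end_near. Qed.

(** The sum is coercive as soon as both signs occur among the exponents. *)
Lemma expsum_min : (exists i, 0 < a i) -> (exists i, a i < 0) ->
  exists h0, forall t, expsum h0 <= expsum t.
Proof.
move=> [i ai] [j aj].
(* Beyond T1 and -T2 a single term exceeds the value of the sum at 0. *)
pose T1 := expsum 0 / (A i * a i); pose T2 := expsum 0 / (A j * - a j).
have Aa1 : 0 < A i * a i by rewrite mulr_gt0.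
have Aa2 : 0 < A j * - a j by rewrite mulr_gt0// oppr_gt0.
have T10 : 0 <= T1 by rewrite divr_ge0 ?ltW// expsum_gt0.
have T20 : 0 <= T2 by rewrite divr_ge0 ?ltW// expsum_gt0.
have cF : {within `[- T2, T1], continuous expsum}.
  by apply: continuous_subspaceT => x; exact: continuous_expsum.
have [|h0 _ h0min] := EVT_min _ cF; first by lra.
exists h0 => t; have h00 : expsum h0 <= expsum 0.
  by apply: h0min; rewrite in_itv/=; lra.
have [tT2|tT2] := ltP t (- T2).
  apply: (le_trans h00); apply: le_trans (expsum_ge t j).
  have h : expsum 0 <= - t * (A j * - a j) by rewrite -ler_pdivrMr// -/T2; lra.
  have := expR_ge1Dx (t * a j); have := A_gt0 j; nra.
have [tT1|tT1] := ltP T1 t.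
  apply: (le_trans h00); apply: le_trans (expsum_ge t i).
  have h : expsum 0 <= t * (A i * a i) by rewrite -ler_pdivrMr// -/T1; lra.
  have := expR_ge1Dx (t * a i); have := A_gt0 i; nra.
by apply: h0min; rewrite in_itv/= tT1 tT2.
Qed.

Lemma expsum1_gt0 : (forall i, 0 <= a i) -> forall t, 0 < expsum1 t.
Proof.
move=> a0 t; have [i ai] := a_neq0; rewrite /expsum1 (bigD1 i)//=.
apply: ltr_wpDr.
  by apply: sumr_ge0 => j _; rewrite !mulr_ge0 ?expR_ge0// ltW.
by rewrite !mulr_gt0 ?expR_gt0// lt_neqAle eq_sym ai a0.
Qed.

Lemma expsum_incr : (forall i, 0 <= a i) -> {homo expsum : s t / s < t}.
Proof.
move=> a0 s t st; have := expsum_tangent (negbT (gt_eqF st)).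
by have := expsum1_gt0 a0 s; nra.
Qed.

Lemma expsum_cvgy : (exists i, 0 < a i) -> (expsum t)^-1 @[t --> +oo] --> (0 : R).
Proof.
move=> [i ai]; have Aa1 : 0 < A i * a i by rewrite mulr_gt0.
apply/(gtr0_cvgV0 _).2; first by apply: nearW => t; exact: expsum_gt0.
apply/cvgryPge => M; near=> t.
apply: le_trans (expsum_ge t i).
have h : M <= t * (A i * a i).
  rewrite -ler_pdivrMr//; near: t; exact: nbhs_pinfty_ge.
have := expR_ge1Dx (t * a i); have := A_gt0 i; nra.
Unshelve. all: end_near. Qed.

End exp_sums.

Lemma expsum_opp (R : realType) (I : finType) (A a : I -> R) t :
  expsum A (fun i => - a i) (- t) = expsum A a t.
Proof. by apply: eq_bigr => i _; rewrite mulrNN. Qed.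

Lemma expsum1_opp (R : realType) (I : finType) (A a : I -> R) t :
  expsum1 A (fun i => - a i) (- t) = - expsum1 A a t.
Proof. by rewrite /expsum1 -sumrN; apply: eq_bigr => i _; rewrite mulrNN mulrN mulNr. Qed.

Lemma expsum_cvgNy_sup (R : realType) (I : finType) (A a : I -> R) :
  (forall i, 0 < A i) -> (exists i, a i != 0) -> (exists i, a i = 0) ->
  (forall i, 0 <= a i) ->
  (expsum A a t)^-1 @[t --> -oo] --> sup (range (fun t => (expsum A a t)^-1)).
Proof.
move=> A0 an0 [i ai] a0; apply/cvgNy_compNP.
have -> : range (fun t => (expsum A a t)^-1) = range ((fun t => (expsum A a t)^-1) \o -%R).
  apply/seteqP; split => _ [t _ <-]; last by exists (- t).
  by exists (- t) => //=; rewrite opprK.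
have h t : 0 < expsum A a t by exact: expsum_gt0.
apply: nondecreasing_cvgr.
  move=> s t; rewrite le_eqVlt => /predU1P[->//|st] /=.
  rewrite lef_pV2 ?posrE//; apply: ltW; apply: expsum_incr => //; by rewrite ltrN2.
exists (A i)^-1 => _ [t _ <-] /=; rewrite lef_pV2 ?posrE//.
by have := expsum_ge a A0 (- t) i; rewrite ai mulr0 expR0 mulr1.
Qed.

Section mle.
Variable R : realType.
Variables (p : nat) (beta : R) (n : nat).
Notation q := n.+2.
Implicit Types (h c : R).

Definition xbar N (X : {ffun 'I_N -> 'I_q}) : R := (freq R X)`_0.
Definition mean_xbar h N : R := \sum_(X : {ffun 'I_N -> 'I_q}) gibbs p beta h X * xbar X.

Variables (N : nat) (X : {ffun 'I_N -> 'I_q}).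
Hypothesis N_gt0 : (0 < N)%N.

(** The inverse of the likelihood h' |-> P_(h')(X) is the sum over Z of
[rel_weight Z * exp (h' * rel_exponent Z)]: maximizing the likelihood is minimizing
a convex sum of exponentials. *)
Definition rel_weight (Z : {ffun 'I_N -> 'I_q}) : R := gibbs_weight p beta 0 Z / gibbs_weight p beta 0 X.
Definition rel_exponent (Z : {ffun 'I_N -> 'I_q}) : R := N%:R * (xbar Z - xbar X).

Lemma gibbs_weight_h h (Z : {ffun 'I_N -> 'I_q}) :
  gibbs_weight p beta h Z = gibbs_weight p beta 0 Z * expR (h * (N%:R * xbar Z)).
Proof.
by rewrite /gibbs_weight -expRD /xbar; congr expR; ring.
Qed.

Lemma gibbs_weight_gt0 h M (Z : {ffun 'I_M -> 'I_q}) : 0 < gibbs_weight p beta h Z.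
Proof. exact: expR_gt0. Qed.

Lemma rel_weight_gt0 Z : 0 < rel_weight Z.
Proof. by rewrite divr_gt0 ?gibbs_weight_gt0. Qed.

Lemma gibbs_weight_rel h (Z : {ffun 'I_N -> 'I_q}) :
  gibbs_weight p beta h Z = rel_weight Z * expR (h * rel_exponent Z) * gibbs_weight p beta h X.
Proof.
rewrite [LHS]gibbs_weight_h [in RHS]gibbs_weight_h /rel_weight /rel_exponent.
have -> : expR (h * (N%:R * xbar Z)) =
    expR (h * (N%:R * (xbar Z - xbar X))) * expR (h * (N%:R * xbar X)).
  by rewrite -expRD; congr expR; ring.
by field; rewrite gt_eqF// gibbs_weight_gt0.
Qed.

Lemma gibbsE h : gibbs p beta h X = (expsum rel_weight rel_exponent h)^-1.
Proof.
rewrite /gibbs (eq_bigr (fun Z => rel_weight Z * expR (h * rel_exponent Z) * gibbs_weight p beta h X)).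
  rewrite -mulr_suml -/(expsum rel_weight rel_exponent h) invfM mulrCA divff ?mulr1//.
  by rewrite gt_eqF// gibbs_weight_gt0.
by move=> Z _; exact: gibbs_weight_rel.
Qed.

Lemma xbar_cst (r : 'I_q) : xbar [ffun _ : 'I_N => r] = (r == ord0)%:R.
Proof.
rewrite /xbar freq0E; case: eqP => [->|r0].
  have -> : cnt [ffun _ : 'I_N => ord0 : 'I_q] ord0 = N.
    by rewrite -[RHS]card_ord; apply: eq_card => i; rewrite !inE ffunE eqxx.
  by rewrite divff// pnatr_eq0 -lt0n.
have -> : cnt [ffun _ : 'I_N => r] ord0 = 0%N.
  by apply: eq_card0 => i; rewrite !inE ffunE; apply/eqP.
by rewrite mul0r.
Qed.

Lemma rel_exponent_neq0 : exists Z, rel_exponent Z != 0.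
Proof.
have N0 : N%:R != 0 :> R by rewrite pnatr_eq0 -lt0n.
have [x0|x0] := eqVneq (xbar X) 0.
  exists [ffun=> ord0]; rewrite /rel_exponent xbar_cst eqxx x0 subr0 mulr1//.
exists [ffun=> ord_max]; rewrite /rel_exponent xbar_cst/= sub0r mulf_neq0// oppr_eq0//.
Qed.

Lemma mean_xbarE h : (xbar X <= mean_xbar h N) = (0 <= expsum1 rel_weight rel_exponent h).
Proof.
have F0 := expsum_gt0 rel_weight_gt0 rel_exponent_neq0 h.
have N0 : 0 < N%:R :> R by rewrite ltr0n.
have -> : expsum1 rel_weight rel_exponent h = (mean_xbar h N - xbar X) * (N%:R * expsum rel_weight rel_exponent h).
  have gE (Z : {ffun 'I_N -> 'I_q}) : gibbs p beta h Z = rel_weight Z * expR (h * rel_exponent Z) / expsum rel_weight rel_exponent h.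
    rewrite -gibbsE {1}/gibbs gibbs_weight_rel /gibbs; field.
    rewrite gt_eqF//; apply: (lt_le_trans (gibbs_weight_gt0 h X)).
    rewrite (bigD1 X)//= lerDl; apply: sumr_ge0 => Y _; exact/ltW/gibbs_weight_gt0.
  rewrite /mean_xbar mulrBl mulr_suml.
  have -> : xbar X * (N%:R * expsum rel_weight rel_exponent h) =
      \sum_Z rel_weight Z * expR (h * rel_exponent Z) * (N%:R * xbar X).
    by rewrite -mulr_suml -/(expsum rel_weight rel_exponent h); ring.
  rewrite -sumrB; apply: eq_bigr => Z _; rewrite gE.
  move: (expR _) => E; rewrite {1}/rel_exponent.
  by field; rewrite gt_eqF.
by rewrite pmulr_lge0 ?mulr_gt0// subr_ge0.
Qed.

Definition lik h : R := gibbs p beta h X.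

Lemma lik_gt0 h : 0 < lik h.
Proof. by rewrite /lik gibbsE invr_gt0 (expsum_gt0 rel_weight_gt0 rel_exponent_neq0). Qed.

Lemma lik_le s t : (lik s <= lik t) = (expsum rel_weight rel_exponent t <= expsum rel_weight rel_exponent s).
Proof.
by rewrite /lik !gibbsE lef_pV2// posrE (expsum_gt0 rel_weight_gt0 rel_exponent_neq0).
Qed.

Lemma rel_exponent_self : rel_exponent X = 0. Proof. by rewrite /rel_exponent subrr mulr0. Qed.

Let A0 := rel_weight_gt0.
Let an0 := rel_exponent_neq0.
Let aN0 : exists i, - rel_exponent i != 0.
Proof. by have [i ai] := rel_exponent_neq0; exists i; rewrite oppr_eq0. Qed.

Lemma lik_range : range lik = range (fun t => (expsum rel_weight (fun Z => - rel_exponent Z) t)^-1).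
Proof.
apply/seteqP; split => _ [t _ <-]; exists (- t) => //; rewrite /lik gibbsE ?expsum_opp//.
by rewrite -[in RHS](opprK t) expsum_opp.
Qed.

Lemma no_min (a : {ffun 'I_N -> 'I_q} -> R) : (exists i, a i != 0) -> (forall Z, 0 <= a Z) ->
  ~ exists h0, forall t, expsum rel_weight a h0 <= expsum rel_weight a t.
Proof.
move=> ane a0 [h0 h0min]; have := h0min (h0 - 1); apply/negP; rewrite -ltNge.
by apply: expsum_incr => //; rewrite gtrBl.
Qed.

(** Three cases: both signs occur among the exponents and the minimum is attained,
or all of them have the same sign and the supremum is approached at infinity. *)
Lemma mle_exists : exists e, is_mle p beta X e.
Proof.
have [pos|npos] := pselect (exists Z, 0 < rel_exponent Z); last first.
  have a0 Z : 0 <= - rel_exponent Z.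
    by rewrite oppr_ge0 leNgt; apply/negP => h; apply: npos; exists Z.
  exists +oo%E; split.
    move=> [h0 h0max]; apply: (no_min aN0 a0); exists (- h0) => t.
    by have := h0max (- t); rewrite -/(lik _) -/(lik _) lik_le -(opprK t) !expsum_opp opprK.
  rewrite -/lik lik_range; apply/cvgy_compNP.
  have := @expsum_cvgNy_sup R _ rel_weight _ A0 aN0 _ a0.
  move=> /(_ (ex_intro _ X _)); rewrite rel_exponent_self oppr0 => /(_ erefl).
  apply: cvg_trans; apply: near_eq_cvg; apply: nearW => t /=.
  by rewrite gibbsE -(expsum_opp _ _ (- t)) opprK.
have [neg|nneg] := pselect (exists Z, rel_exponent Z < 0); last first.
  have a0 Z : 0 <= rel_exponent Z.
    by rewrite leNgt; apply/negP => h; apply: nneg; exists Z.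
  exists -oo%E; split.
    move=> [h0 h0max]; apply: (no_min an0 a0); exists h0 => t.
    by have := h0max t; rewrite -/(lik _) -/(lik _) lik_le.
  have := @expsum_cvgNy_sup R _ rel_weight _ A0 an0 (ex_intro _ X rel_exponent_self) a0.
  rewrite (_ : (fun t => (expsum rel_weight rel_exponent t)^-1) = lik)//.
  by apply/funext => t; rewrite /lik gibbsE.
have [h0 h0min] := expsum_min A0 an0 pos neg.
by exists h0%:E => /= t; rewrite -[_ <= _]/(lik t <= lik h0) lik_le.
Qed.

(** A convex function has its minimum to the left of c iff its slope at c is
nonnegative.  At infinite values of the estimator all exponents have the same
sign, and so has the slope. *)
Lemma is_mle_le e c : is_mle p beta X e ->
  (e <= c%:E)%E = (xbar X <= mean_xbar c N).
Proof.
rewrite mean_xbarE.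
have sup_gt0 : 0 < sup (range lik).
  apply: (lt_le_trans (lik_gt0 0)); apply: ub_le_sup; last by exists 0.
  exists (rel_weight X)^-1 => _ [t _ <-]; rewrite /lik gibbsE lef_pV2 ?posrE//; last first.
    exact: expsum_gt0.
  by have := expsum_ge rel_exponent A0 t X; rewrite rel_exponent_self mulr0 expR0 mulr1.
case: e => [h0 h0max|[_ Ly]|[_ LNy]].
- rewrite lee_fin; apply: expsum_min_le => // t.
  by have := h0max t; rewrite -[_ <= _]/(lik t <= lik h0) lik_le.
- have npos : ~ exists Z, 0 < rel_exponent Z.
    move=> pos; have L0 : lik t @[t --> +oo] --> (0 : R).
      rewrite (_ : lik = (fun t => (expsum rel_weight rel_exponent t)^-1)); first exact: expsum_cvgy.
      by apply/funext => t; rewrite /lik gibbsE.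
    by move: sup_gt0; rewrite (cvg_unique _ Ly L0) ?ltxx.
  have a0 Z : 0 <= - rel_exponent Z.
    by rewrite oppr_ge0 leNgt; apply/negP => h; apply: npos; exists Z.
  have := expsum1_gt0 A0 aN0 a0 (- c); rewrite expsum1_opp oppr_gt0 ltNge => /negbTE ->.
  by rewrite leNgt ltry.
- have nneg : ~ exists Z, rel_exponent Z < 0.
    move=> [Z Zneg]; have L0 : lik t @[t --> -oo] --> (0 : R).
      apply/cvgNy_compNP.
      rewrite (_ : lik \o -%R = (fun t => (expsum rel_weight (fun Z => - rel_exponent Z) t)^-1)).
        by apply: expsum_cvgy => //; exists Z; rewrite oppr_gt0.
      by apply/funext => t; rewrite /lik /= gibbsE -expsum_opp opprK.
    by move: sup_gt0; rewrite (cvg_unique _ LNy L0) ?ltxx.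
  have a0 Z : 0 <= rel_exponent Z.
    by rewrite leNgt; apply/negP => h; apply: nneg; exists Z.
  by rewrite leNye (ltW (expsum1_gt0 A0 an0 a0 c)).
Qed.

(** Reduces the law of the estimator to that of the first count. *)
Lemma mle_le c : (mle p beta X <= c%:E)%E = (xbar X <= mean_xbar c N).
Proof.
apply: is_mle_le; have [e eX] := mle_exists.
by have := @xgetPex _ 0%E [set e | is_mle p beta X e]; apply; exists e.
Qed.

End mle.

(** * Splitting Gibbs sums over the maximizers *)
Section main_limit.
Variable R : realType.
Variables (p : nat) (beta : R) (n : nat).
Notation q := n.+2.
Implicit Types (d x y : R) (m : q.-tuple R).

Lemma cvg_limit_eq (T : Type) (F : set_system T) (f : T -> R) (a b : R) :
  f @ F --> a -> a = b -> f @ F --> b.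
Proof. by move=> fa <-. Qed.

Lemma near_all_seq (T : eqType) (U : Type) (F : set_system U) (FF : Filter F) (s : seq T)
    (P : T -> U -> Prop) :
  (forall i, i \in s -> \forall d \near F, P i d) ->
  \forall d \near F, forall i, i \in s -> P i d.
Proof.
elim: s => [_|i s IH Ps]; first exact: nearW.
near=> d => j; rewrite inE => /predU1P[->|js].
  by near: d; apply: Ps; rewrite mem_head.
have : forall j, j \in s -> P j d.
  by near: d; apply: IH => k ks; apply: Ps; rewrite inE ks orbT.
exact.
Unshelve. all: end_near. Qed.

Variables (h : R) (ms : seq (q.-tuple R)) (Hmax : R).
Hypothesis ms_uniq : uniq ms.
Hypothesis msP : forall m, m \in ms <-> H_maximizers p q beta h m.
Hypothesis msH : forall m, m \in ms -> potts_H p beta h m = Hmax.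
Hypothesis ms_neq0 : exists m, m \in ms.

Definition norm_cst N : R := stirling_ratio R N * expR (N%:R * Hmax).

Lemma norm_cst_gt0 N : (0 < N)%N -> 0 < norm_cst N.
Proof. by move=> N0; rewrite mulr_gt0 ?stirling_ratio_gt0// expR_gt0. Qed.

Definition gibbs_sum N (g : nat -> R) : R :=
  \sum_(X : {ffun 'I_N -> 'I_q}) gibbs_weight p beta h X * g (cnt X ord0).

(** The windows of radius d around distinct maximizers are then disjoint. *)
Definition max_separated d := forall m m' : q.-tuple R, m \in ms -> m' \in ms -> m != m' ->
  exists r, 2 * d < `|tnth m r - tnth m' r|.

Lemma near_max_separated : \forall d \near 0^'+, max_separated d.
Proof.
suff : \forall d \near 0^'+, forall m, m \in ms -> forall m', m' \in ms -> m != m' ->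
    exists r, 2 * d < `|tnth m r - tnth m' r|.
  by apply: filterS => d H m m' mms m'ms; exact: H.
apply: near_all_seq => m _; apply: near_all_seq => m' _.
have [->|mm'] := eqVneq m m'; first by near=> d.
have [r rP] : exists r, tnth m r != tnth m' r.
  apply: contrapT => nr; move/eqP : mm'; apply; apply: eq_from_tnth => r.
  by apply/eqP/negPn/negP => rr; apply: nr; exists r.
near=> d => _; exists r; rewrite -ltr_pdivlMl//.
near: d; apply: nbhs_right_lt; by rewrite mulr_gt0// normr_gt0 subr_eq0.
Unshelve. all: end_near. Qed.

Lemma gibbs_sum_split d N (g : nat -> R) : max_separated d ->
  gibbs_sum N g = \sum_(m <- ms) near_sum p beta h m d N g +
    \sum_(X : {ffun 'I_N -> 'I_q} | ~~ has (fun m => near_max m d X) ms)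
      gibbs_weight p beta h X * g (cnt X ord0).
Proof.
move=> sep; rewrite /near_sum.
under eq_bigr do rewrite big_mkcond; rewrite exchange_big/=.
rewrite [X in _ + X]big_mkcond/= -big_split/=; apply: eq_bigr => X _.
case: ifPn => [/hasPn nX|/negPn/hasP[m mms mX]].
  by rewrite big1_seq ?add0r// => m /= mms; rewrite (negbTE (nX _ mms)).
rewrite addr0 (bigD1_seq m)//= mX big1_seq ?addr0// => m' /andP[m'm m'ms].
case: ifPn => // m'X; have [r] := sep _ _ m'ms mms m'm.
move/forallP : mX => /(_ r); move/forallP : m'X => /(_ r).
set t := _ / _ => h1 h2; rewrite ltNge => /negP[].
have -> : tnth m' r - tnth m r = (t - tnth m r) - (t - tnth m' r) by ring.
by rewrite (le_trans (ler_normB _ _))//; lra.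
Qed.

Lemma poly_exp_cvg0 (y eta : R) : 0 < eta ->
  N.+1%:R ^+ q * expR (y * Num.sqrt N%:R - N%:R * eta) @[N --> \oo] --> (0 : R).
Proof.
move=> eta0; pose Q := 2 * q%:R : R.
have bound N : N.+1%:R ^+ q <= expR (Q + Q * Num.sqrt N%:R) :> R.
  have N10 : 0 < N.+1%:R :> R by rewrite ltr0n.
  have s0 : 0 < Num.sqrt (N.+1%:R : R) by rewrite sqrtr_gt0.
  rewrite -[X in X ^+ _](@lnK R) ?posrE// -expRM_natl ler_expR.
  have -> : ln N.+1%:R = 2 * ln (Num.sqrt N.+1%:R) :> R.
    by rewrite -[in LHS](sqr_sqrtr (ltW N10)) lnXn// mulr_natl.
  have h1 : ln (Num.sqrt N.+1%:R) <= 1 + Num.sqrt N%:R :> R.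
    apply: (le_trans (ltW (ln_sublinear s0))).
    rewrite -ler_sqr ?nnegrE ?addr_ge0 ?sqrtr_ge0// sqr_sqrtr; last exact: ltW.
    have := sqr_sqrtr (ler0n R N); have := sqrtr_ge0 (N%:R : R).
    rewrite -natr1; move: (Num.sqrt _) => s s0' <-; nra.
  rewrite mulrA -[leRHS](_ : q%:R * 2 * (1 + Num.sqrt N%:R) = _) ?ler_wpM2l//.
  by rewrite /Q; ring.
have e0 : expR (Q - Num.sqrt N%:R) @[N --> \oo] --> (0 : R).
  have -> : (fun N => expR (Q - Num.sqrt N%:R)) = (fun N => expR Q * expR (- Num.sqrt N%:R)).
    by apply/funext => N; rewrite expRD.
  apply: (cvg_limit_eq _ (mulr0 (expR Q))); apply: cvgM; first exact: cvg_cst.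
  exact: (cvg_comp _ _ (@cvg_sqrtn_y R) (@cvgr_expR R)).
apply: (@squeeze_cvgr _ _ _ _ (cst 0) (fun N => expR (Q - Num.sqrt N%:R))) => //; last first.
  exact: cvg_cst.
near=> N; rewrite mulr_ge0 ?expR_ge0 ?exprn_ge0//=.
rewrite (le_trans (ler_wpM2r (expR_ge0 _) (bound N)))// -expRD ler_expR.
have sN : N%:R = Num.sqrt N%:R * Num.sqrt N%:R :> R by rewrite -expr2 sqr_sqrtr.
have : (Q + y + 1) / eta <= Num.sqrt N%:R by near: N; exact: near_sqrtn_ge.
rewrite ler_pdivrMr// => hN.
have := sqrtr_ge0 (N%:R : R).
rewrite [X in _ - X * eta]sN; move: (Num.sqrt _) hN => s hs s0.
nra.
Unshelve. all: end_near. Qed.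

(** The normalized sum splits into finitely many near sums and a far sum, which is
negligible even against the growth exp(y sqrt N) of the tilts. *)
Lemma gibbs_sum_cvg d (g : nat -> nat -> R) (y C : R) (l : q.-tuple R -> R) :
  0 < d -> max_separated d -> 0 < C -> (forall N, (0 < N)%N -> C <= stirling_ratio R N) ->
  (forall N i, (0 < N)%N -> (i <= N)%N -> `|g N i| <= expR (y * Num.sqrt N%:R)) ->
  (forall m, m \in ms -> near_sum p beta h m d N (g N) / norm_cst N @[N --> \oo] --> l m) ->
  gibbs_sum N (g N) / norm_cst N @[N --> \oo] --> \sum_(m <- ms) l m.
Proof.
move=> d0 sep C0 sC gy gl.
have [m0 m0ms] := ms_neq0.
have [eta eta0 etaP] := @far_gap R p beta n h ms m0 d d0 (fun m => (msP m).2) ((msP m0).1 m0ms).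
rewrite msH// in etaP.
pose farsum N := \sum_(X : {ffun 'I_N -> 'I_q} | ~~ has (fun m => near_max m d X) ms)
      gibbs_weight p beta h X * g N (cnt X ord0).
have far0 : farsum N / norm_cst N @[N --> \oo] --> (0 : R).
  have B := poly_exp_cvg0 y eta0.
  have {}B : C^-1 * (N.+1%:R ^+ q * expR (y * Num.sqrt N%:R - N%:R * eta)) @[N --> \oo] --> (0 : R).
    by apply: (cvg_limit_eq _ (mulr0 C^-1)); apply: cvgM => //; exact: cvg_cst.
  apply/norm_cvg0P.
  apply: (@squeeze_cvgr _ _ _ _ (cst 0) _ _ _ _ _ B); last exact: cvg_cst.
  near=> N; rewrite normr_ge0/=.
  have N0 : (0 < N)%N by near: N; exact: nbhs_infty_gt.
  rewrite normrM [X in _ * X]gtr0_norm ?invr_gt0 ?norm_cst_gt0//.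
  rewrite ler_pdivrMr ?norm_cst_gt0//.
  have h1 : `|farsum N| <= expR (y * Num.sqrt N%:R) *
      \sum_(X : {ffun 'I_N -> 'I_q} | ~~ has (fun m => near_max m d X) ms) gibbs_weight p beta h X.
    rewrite mulr_sumr (le_trans (ler_norm_sum _ _ _))//; apply: ler_sum => X _.
    rewrite normrM mulrC ler_pM// ?gy ?cnt_le//.
    by rewrite ger0_norm// ltW// gibbs_weight_gt0.
  apply: (le_trans h1).
  have h2 := @far_sum_le R p beta n h
    (fun N => fun X : {ffun 'I_N -> 'I_q} => ~~ has (fun m => near_max m d X) ms)
    (Hmax - eta) N N0.
  apply: (le_trans (ler_wpM2l (expR_ge0 _) (h2 _))).
    move=> X /hasPn nX; apply: etaP; first exact: prob_vec_freq.
    move=> m mms; have := nX m mms; rewrite negb_forall => /existsP[r].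
    by rewrite -ltNge => rX; exists r; rewrite freqE.
  rewrite (_ : expR _ * (_ * _) = N.+1%:R ^+ q * expR (y * Num.sqrt N%:R - N%:R * eta) *
      expR (N%:R * Hmax)); last first.
    by rewrite mulrCA -mulrA -!expRD; congr (_ * expR _); ring.
  rewrite /norm_cst; set A := N.+1%:R ^+ q * _.
  have A0 : 0 <= A by rewrite mulr_ge0 ?expR_ge0 ?exprn_ge0.
  rewrite (_ : C^-1 * A * _ = (C^-1 * stirling_ratio R N) * (A * expR (N%:R * Hmax))).
    apply: ler_peMl; first by rewrite mulr_ge0 ?expR_ge0.
    by rewrite mulrC ler_pdivlMr// mul1r sC.
  by ring.
apply: (cvg_limit_eq _ (addr0 _)).
have -> : (fun N => gibbs_sum N (g N) / norm_cst N) =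
   (fun N => \sum_(m <- ms) near_sum p beta h m d N (g N) / norm_cst N + farsum N / norm_cst N).
  by apply/funext => N; rewrite (gibbs_sum_split _ _ sep) mulrDl -mulr_suml.
apply: cvgD => //.
rewrite big_seq; under eq_fun do rewrite big_seq.
exact: cvg_sumr.
Unshelve. all: end_near. Qed.

End main_limit.

(** * Contribution of one maximizer *)
Section limit_law.
Variable R : realType.
Variables (p : nat) (beta : R) (n : nat).
Notation q := n.+2.
Implicit Types (d x y : R) (m : q.-tuple R).
Variables (h : R) (Hmax : R).
Notation norm_cst := (norm_cst Hmax).

Definition first m : R := tnth m ord0.

(** What the limit theorem needs to know about the maximizer m: in the window of
radius d its first count is Gaussian with precision al, and its total mass,
in units of the common normalization, is M. *)
Definition loc_ok d m (al M : R) : Prop :=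
  0 < first m /\ 0 < al /\ exists u b c, [/\ 0 < b, local_gauss (first m) al b c u,
    c * Num.sqrt (2 * pi / al) = M, (forall N j, (N < j)%N -> u N j = 0) &
    forall N g, (0 < N)%N -> near_sum p beta h m d N g =
      stirling_ratio R N * expR (N%:R * potts_H p beta h m) *
      ((\sum_(i < N.+1) u N i * g i) / Num.sqrt N%:R)].

(** A change y / sqrt N of the field, centred at mu. *)
Definition tilt (mu y : R) (N i : nat) : R :=
  expR (y * (Num.sqrt N%:R * (i%:R / N%:R - mu))).

(** With precision a for the count, the variable x / a enters because the mean moves by
x / a; the value is the distribution function at x of the normal law with
variance a, see [normal_prob_Phi]. *)
Definition Phi (a x : R) : R := fine (normal_prob 0 (Num.sqrt a)^-1 `]-oo, x / a]).

Lemma scaledE (m : R) N i : (0 < N)%N ->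
  Num.sqrt N%:R * (i%:R / N%:R - m) = scaled m N i.
Proof.
move=> N0; have N0' : 0 < N%:R :> R by rewrite ltr0n.
have s0 : Num.sqrt N%:R != 0 :> R by rewrite gt_eqF// sqrtr_gt0.
rewrite /scaled; apply: (mulIf s0); rewrite mulfVK// mulrAC -expr2 sqr_sqrtr ?ltW//.
by field; rewrite gt_eqF.
Qed.

Lemma cvg_sqrtn_mul (c : R) (z : nat -> R) (l : R) : z N @[N --> \oo] --> l ->
  (0 < c -> z N + Num.sqrt N%:R * c @[N --> \oo] --> +oo) /\
  (c < 0 -> z N + Num.sqrt N%:R * c @[N --> \oo] --> -oo).
Proof.
move=> zl; split=> c0.
- apply/cvgryPge => A; near=> N.
  have h1 : l - 1 <= z N by near: N; apply: (cvgr_ge _ zl); rewrite gtrBl.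
  have : (A - (l - 1)) / c <= Num.sqrt N%:R by near: N; exact: near_sqrtn_ge.
  by rewrite ler_pdivrMr//; lra.
- apply/cvgrNyPle => A; near=> N.
  have h1 : z N <= l + 1 by near: N; apply: (cvgr_le _ zl); rewrite ltrDl.
  have : (A - (l + 1)) / c <= Num.sqrt N%:R by near: N; exact: near_sqrtn_ge.
  by rewrite ler_ndivrMr//; lra.
Unshelve. all: end_near. Qed.

Lemma near_sum_cvg d m (u : nat -> nat -> R) (g : nat -> nat -> R) (l : R) :
  potts_H p beta h m = Hmax ->
  (forall N g, (0 < N)%N -> near_sum p beta h m d N g =
      stirling_ratio R N * expR (N%:R * potts_H p beta h m) *
      ((\sum_(i < N.+1) u N i * g i) / Num.sqrt N%:R)) ->
  (\sum_(i < N.+1) u N i * g N i) / Num.sqrt N%:R @[N --> \oo] --> l ->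
  near_sum p beta h m d N (g N) / norm_cst N @[N --> \oo] --> l.
Proof.
move=> mH nE; apply: cvg_trans; apply: near_eq_cvg; near=> N.
have N0 : (0 < N)%N by near: N; exact: nbhs_infty_gt.
rewrite nE// mH -/(norm_cst N) mulrAC divff ?mul1r//.
by rewrite gt_eqF// norm_cst_gt0.
Unshelve. all: end_near. Qed.

(** A maximizer on the wrong side of mu is killed by the tilt, by a factor
exp(-c sqrt N). *)
Lemma near_tilt d m al M mu y : loc_ok d m al M -> potts_H p beta h m = Hmax ->
  first m = mu \/ y * (first m - mu) < 0 ->
  near_sum p beta h m d N (tilt mu y N) / norm_cst N @[N --> \oo] -->
    (if first m == mu then M * expR (y ^+ 2 / (2 * al)) else 0).
Proof.
move=> [m0 [al0 [u [b [c [b0 lu cM uN nE]]]]]] mH mmu.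
apply: (near_sum_cvg mH nE).
have T := @local_gauss_sum_tilt R (first m) al b c u S y m0 al0 b0 lu uN.
case: eqP mmu => [mmu _|mmu [//|ymu]].
  rewrite -cM; apply: cvg_trans T; apply: near_eq_cvg; near=> N.
  have N0 : (0 < N)%N by near: N; exact: nbhs_infty_gt.
  congr (_ / _); apply: eq_bigr => i _; by rewrite /tilt -mmu scaledE.
have E0 : expR (0 + Num.sqrt N%:R * (y * (first m - mu))) @[N --> \oo] --> (0 : R).
  have h0 := (@cvg_sqrtn_mul (y * (first m - mu)) (fun=> 0) 0 (cvg_cst _)).2 ymu.
  have h1 := (cvgNry _).2 (h0 _).
  apply: cvg_trans (cvg_comp _ _ (h1 _ _) (@cvgr_expR R)); apply: near_eq_cvg.
  by apply: nearW => N /=; rewrite opprK.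
have k : (\sum_(j < N.+1) u N j * expR (y * scaled (first m) N j)) / Num.sqrt N%:R *
    expR (0 + Num.sqrt N%:R * (y * (first m - mu))) @[N --> \oo] --> (0 : R).
  by apply: (cvg_limit_eq _ (mulr0 (c * Num.sqrt (2 * pi / al) * expR (y ^+ 2 / (2 * al)))));
    exact: cvgM.
apply: cvg_trans k; apply: near_eq_cvg; near=> N.
have N0 : (0 < N)%N by near: N; exact: nbhs_infty_gt.
rewrite /= mulrAC mulr_suml; congr (_ / _); apply: eq_bigr => i _.
rewrite -mulrA -expRD /tilt -(scaledE _ _ N0); congr (_ * expR _); ring.
Unshelve. all: end_near. Qed.

(** If first m differs from mu, the threshold is at distance of order sqrt N from the
centre on the rescaled axis, so all or nothing of the mass lies below it. *)
Lemma near_le d m al M mu (v : nat -> R) (z : R) : loc_ok d m al M ->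
  potts_H p beta h m = Hmax ->
  Num.sqrt N%:R * (v N - mu) @[N --> \oo] --> z ->
  near_sum p beta h m d N (fun i => (i%:R / N%:R <= v N)%R%:R) / norm_cst N @[N --> \oo] -->
    (if first m == mu then M * fine (normal_prob 0 (Num.sqrt al)^-1 `]-oo, z])
     else if first m < mu then M else 0).
Proof.
move=> [m0 [al0 [u [b [c [b0 lu cM uN nE]]]]]] mH vz.
apply: (@near_sum_cvg d m u (fun N i => (i%:R / N%:R <= v N)%R%:R) _ mH nE).
pose w N := Num.sqrt N%:R * (v N - mu) + Num.sqrt N%:R * (mu - first m).
suff : (\sum_(i < N.+1) u N i * (scaled (first m) N i <= w N)%R%:R) / Num.sqrt N%:R
    @[N --> \oo] -->
    (if first m == mu then M * fine (normal_prob 0 (Num.sqrt al)^-1 `]-oo, z])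
     else if first m < mu then M else 0).
  apply: cvg_trans; apply: near_eq_cvg; near=> N.
  have N0 : (0 < N)%N by near: N; exact: nbhs_infty_gt.
  have s0 : 0 < Num.sqrt (N%:R : R) by rewrite sqrtr_gt0 ltr0n.
  congr (_ / _); apply: eq_bigr => i _; congr (_ * (nat_of_bool _)%:R).
  by rewrite -scaledE// /w -mulrDr ler_pM2l// addrA subrK lerD2r.
case: ltgtP => mmu.
- rewrite -cM; apply: (@local_gauss_sum_ley R _ _ b) => //.
  by apply: (cvg_sqrtn_mul _ vz).1; rewrite subr_gt0.
- apply: (@local_gauss_sum_leNy R _ al b c) => //.
  by apply: (cvg_sqrtn_mul _ vz).2; rewrite subr_lt0.
- rewrite -cM; apply: (@local_gauss_sum_le R _ _ b) => //.
  rewrite /w mmu subrr; under eq_fun do rewrite mulr0 addr0.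
  exact: vz.
Unshelve. all: end_near. Qed.

End limit_law.

(** * Limit of the distribution function of the estimator *)
Section limit_law2.
Variable R : realType.
Variables (p : nat) (beta : R) (n : nat).
Notation q := n.+2.
Implicit Types (d x y : R) (m : q.-tuple R).
Variables (h : R) (Hmax : R) (ms : seq (q.-tuple R)) (al M : q.-tuple R -> R).
Notation norm_cst := (norm_cst Hmax).
Notation zs := (@gibbs_sum R p beta n h).

Hypothesis ms_uniq : uniq ms.
Hypothesis msP : forall m, m \in ms <-> H_maximizers p q beta h m.
Hypothesis msH : forall m, m \in ms -> potts_H p beta h m = Hmax.
Hypothesis ms_loc : forall m, m \in ms ->
  \forall d \near 0^'+, loc_ok p beta h d m (al m) (M m).

Variables (mu a x : R).
Hypothesis x_neq0 : x != 0.
Hypothesis mu_ex : exists2 m, m \in ms & first m = mu.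
Hypothesis mu_extr : forall m, m \in ms -> first m = mu \/ x * (first m - mu) < 0.
Hypothesis mu_al : forall m, m \in ms -> first m = mu -> al m = a.
Hypothesis M_gt0 : forall m, m \in ms -> 0 < M m.

Lemma mu_01 : 0 <= mu <= 1.
Proof.
have [m mms <-] := mu_ex; have [mp _] := (msP m).1 mms.
by rewrite /first prob_vec_le1// andbT; exact: mp.1.
Qed.

Lemma a_gt0 : 0 < a.
Proof.
have [m mms mmu] := mu_ex; rewrite -(mu_al mms mmu).
near (0 : R)^'+ => d.
have : loc_ok p beta h d m (al m) (M m) by near: d; exact: ms_loc.
by move=> [_ []].
Unshelve. all: end_near. Qed.

Lemma common_radius : exists d, [/\ 0 < d, max_separated ms d &
  forall m, m \in ms -> loc_ok p beta h d m (al m) (M m)].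
Proof.
near (0 : R)^'+ => d; exists d; split => //; near: d; last exact: near_all_seq.
exact: near_max_separated.
Unshelve. all: end_near. Qed.

Definition top_mass : R := \sum_(m <- ms | first m == mu) M m.

Lemma top_mass_gt0 : 0 < top_mass.
Proof.
have [m mms mmu] := mu_ex; rewrite /top_mass -big_filter.
have mf : m \in [seq i <- ms | first i == mu] by rewrite mem_filter mmu eqxx.
rewrite (perm_big _ (perm_to_rem mf)) big_cons/= ltr_wpDr ?M_gt0//.
rewrite big_seq; apply: sumr_ge0 => m' /mem_rem; rewrite mem_filter => /andP[_ m'ms].
exact/ltW/M_gt0.
Qed.

Lemma gibbs_sum_tilt_cvg y : 0 < x * y ->
  zs N (tilt mu y N) / norm_cst N @[N --> \oo] --> top_mass * expR (y ^+ 2 / (2 * a)).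
Proof.
move=> xy; have [d [d0 sep lok]] := common_radius.
have [C C0 [sC Cs]] := @stirling_ratio_cvg R.
have [m0 m0ms _] := mu_ex.
have : zs N (tilt mu y N) / norm_cst N @[N --> \oo] -->
    \sum_(m <- ms) (if first m == mu then M m * expR (y ^+ 2 / (2 * al m)) else 0).
  apply: (@gibbs_sum_cvg R p beta n h ms Hmax ms_uniq msP msH _ d _ `|y| C) => //.
  - by exists m0.
  - move=> N i N0 iN; rewrite /tilt ger0_norm ?expR_ge0// ler_expR.
    apply: (le_trans (ler_norm _)); rewrite normrM ler_wpM2l// normrM.
    rewrite ger0_norm ?sqrtr_ge0// ler_piMr ?sqrtr_ge0//.
    have : 0 <= (i%:R / N%:R : R) <= 1.
      by rewrite divr_ge0//= ler_pdivrMr ?ltr0n// mul1r ler_nat.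
    by have := mu_01; rewrite ler_norml; lra.
  - move=> m mms; apply: near_tilt (lok m mms) (msH mms) _.
    have [->|xm] := mu_extr mms; first by left.
    right; have x2 : 0 < x ^+ 2 by rewrite exprn_even_gt0.
    have : (x * y) * (x * (first m - mu)) < 0 by rewrite nmulr_llt0.
    rewrite (_ : _ * _ = x ^+ 2 * (y * (first m - mu))); last by ring.
    by rewrite pmulr_rlt0.
move=> H; apply: (cvg_limit_eq H).
rewrite /top_mass mulr_suml [RHS]big_mkcond/= big_seq [RHS]big_seq.
apply: eq_bigr => m mms; case: eqP => // mmu.
by rewrite (mu_al mms mmu).
Qed.

Definition shifted N : R := h + x / Num.sqrt N%:R.
Definition mean_dev N : R := Num.sqrt N%:R * (mean_xbar p beta n (shifted N) N - mu).

Lemma gibbs_sum_tilt_gt0 N y : 0 < zs N (tilt mu y N).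
Proof.
rewrite /gibbs_sum (bigD1 [ffun=> ord0])//= ltr_wpDr//.
  by apply: sumr_ge0 => X _; rewrite mulr_ge0 ?expR_ge0// ltW// gibbs_weight_gt0.
by rewrite mulr_gt0 ?expR_gt0// gibbs_weight_gt0.
Qed.

Lemma mean_devE N : (0 < N)%N ->
  mean_dev N * zs N (tilt mu x N) =
  zs N (fun i => tilt mu x N i * (Num.sqrt N%:R * (i%:R / N%:R - mu))).
Proof.
move=> N0; have N0' : 0 < N%:R :> R by rewrite ltr0n.
have s0 : Num.sqrt N%:R != 0 :> R by rewrite gt_eqF// sqrtr_gt0.
have wE (X : {ffun 'I_N -> 'I_q}) : gibbs_weight p beta (shifted N) X =
    gibbs_weight p beta h X * tilt mu x N (cnt X ord0) * expR (x * Num.sqrt N%:R * mu).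
  rewrite /tilt gibbs_weight_h [in RHS]gibbs_weight_h -!mulrA; congr (_ * _); rewrite -!expRD; congr expR.
  rewrite /shifted /xbar freq0E.
  have : N%:R = Num.sqrt N%:R * Num.sqrt N%:R :> R by rewrite -expr2 sqr_sqrtr ?ltW.
  move: s0; set S := Num.sqrt _ => S0 NS; rewrite NS.
  by field.
pose E := expR (x * Num.sqrt N%:R * mu).
have E0 : E != 0 by rewrite gt_eqF// expR_gt0.
pose Z := zs N (tilt mu x N).
have Z0 : Z != 0 by rewrite gt_eqF// gibbs_sum_tilt_gt0.
have ZE : \sum_(X : {ffun 'I_N -> 'I_q}) gibbs_weight p beta (shifted N) X = Z * E.
  by rewrite /Z /gibbs_sum mulr_suml; apply: eq_bigr => X _; rewrite wE.
have mE : mean_xbar p beta n (shifted N) N * Z = zs N (fun i => tilt mu x N i * (i%:R / N%:R)).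
  rewrite /mean_xbar mulr_suml; apply: eq_bigr => X _.
  rewrite /gibbs ZE wE /xbar freq0E -/E; field.
  by rewrite Z0 E0 gt_eqF.
rewrite /mean_dev -/Z -mulrA mulrBl mE /Z /gibbs_sum mulr_sumr -sumrB mulr_sumr.
by apply: eq_bigr => X _; ring.
Qed.

(** The inequality exp w >= 1 + w bounds the mean, which involves an unbounded
function, by ratios of exponential moments. *)
Lemma tilt_jensen N y : (0 < N)%N ->
  y * mean_dev N <= zs N (tilt mu (x + y) N) / zs N (tilt mu x N) - 1.
Proof.
move=> N0; rewrite lerBrDr ler_pdivlMr ?gibbs_sum_tilt_gt0//.
rewrite mulrDl mul1r -mulrA mean_devE// /gibbs_sum mulr_sumr -big_split/=.
apply: ler_sum => X _; set W := Num.sqrt _ * _.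
have -> : tilt mu (x + y) N (cnt X ord0) = tilt mu x N (cnt X ord0) * expR (y * W).
  by rewrite /tilt -/W mulrDl expRD.
rewrite [leRHS]mulrA; set A := gibbs_weight p beta h X * tilt mu x N (cnt X ord0).
have A0 : 0 <= A by rewrite mulr_ge0 ?expR_ge0// ltW// gibbs_weight_gt0.
rewrite (_ : _ + _ = A * (1 + y * W)); last by rewrite /A; ring.
by rewrite ler_wpM2l// expR_ge1Dx.
Qed.

Lemma tilt_ratio_cvg y : 0 < x * (x + y) ->
  zs N (tilt mu (x + y) N) / zs N (tilt mu x N) @[N --> \oo] -->
  expR ((2 * x * y + y ^+ 2) / (2 * a)).
Proof.
move=> xy; have xx : 0 < x * x by rewrite -expr2 exprn_even_gt0.
have T1 := gibbs_sum_tilt_cvg xy; have T2 := gibbs_sum_tilt_cvg xx.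
have S0 := top_mass_gt0; have a0 := a_gt0.
have lE : top_mass * expR ((x + y) ^+ 2 / (2 * a)) / (top_mass * expR (x ^+ 2 / (2 * a))) =
    expR ((2 * x * y + y ^+ 2) / (2 * a)).
  have -> : expR ((x + y) ^+ 2 / (2 * a)) =
      expR ((2 * x * y + y ^+ 2) / (2 * a)) * expR (x ^+ 2 / (2 * a)).
    by rewrite -expRD; congr expR; field; rewrite gt_eqF.
  by field; rewrite !gt_eqF// expR_gt0.
apply: (cvg_limit_eq _ lE).
have T3 : (zs N (tilt mu (x + y) N) / norm_cst N) / (zs N (tilt mu x N) / norm_cst N)
   @[N --> \oo] --> top_mass * expR ((x + y) ^+ 2 / (2 * a)) / (top_mass * expR (x ^+ 2 / (2 * a))).
  by apply: cvgM => //; apply: cvgV => //; rewrite gt_eqF// mulr_gt0// expR_gt0.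
apply: cvg_trans T3; apply: near_eq_cvg; near=> N.
have N0 : (0 < N)%N by near: N; exact: nbhs_infty_gt.
field; by rewrite !gt_eqF// ?gibbs_sum_tilt_gt0// norm_cst_gt0.
Unshelve. all: end_near. Qed.

(** For small y of either sign, [tilt_jensen] compares y times the mean with
phi y - 1, where phi is the limit of the ratio of the moments; both one-sided
bounds tend to phi'(0) = x / a. *)
Lemma mean_dev_cvg : mean_dev N @[N --> \oo] --> x / a.
Proof.
have a0 := a_gt0; apply/cvgrPdist_le => e e0.
pose phi y := expR ((2 * x * y + y ^+ 2) / (2 * a)).
have phi0 : phi 0 = 1 by rewrite /phi mulr0 expr0n/= addr0 mul0r expR0.
have dphi : der phi 0 (x / a).
  apply: der_eq; first by rewrite /phi; der_tac.
  by rewrite /= mulr0 expr0n/= addr0 mul0r expR0; field; rewrite gt_eqF.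
have slope : \forall y \near 0^', `|x / a - y^-1 * (phi y - 1)| <= e / 2.
  case: dphi => dd dv.
  have : y^-1 *: (phi y - 1) @[y --> 0^'] --> x / a.
    have -> : (fun y => y^-1 *: (phi y - 1)) =
        (fun y => y^-1 *: ((phi \o shift 0) (y *: (1 : R)) - phi 0)).
      by apply/funext => y /=; rewrite phi0 addr0 [y *: 1]mulr1.
    by rewrite -dv; exact: dd.
  by move=> /cvgrPdist_le; apply; rewrite divr_gt0.
have x0 : 0 < `|x| by rewrite normr_gt0.
(* |y| < |x| keeps x + y on the side of x, so that the same maximizers dominate
   in both moments. *)
have key s : (s = 1 \/ s = -1) -> exists y, [/\ 0 < s * y, 0 < x * (x + y) &
    `|x / a - y^-1 * (phi y - 1)| <= e / 2].
  move=> s1; move: slope => /nbhs_ballP[r /= r0 hr].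
  pose y := s * (Num.min r `|x| / 2).
  have mn : 0 < Num.min r `|x| / 2 by rewrite divr_gt0// lt_min r0.
  have ss : s * s = 1 by case: s1 => ->; ring.
  have sn : `|s| = 1 by case: s1 => ->; rewrite ?normrN normr1.
  have yn : `|y| = Num.min r `|x| / 2 by rewrite normrM sn mul1r gtr0_norm.
  exists y; split.
  - by rewrite mulrA ss mul1r.
  - have : `|y| < `|x|.
      rewrite yn ltr_pdivrMr//; apply: (@le_lt_trans _ _ `|x|); first by rewrite ge_min lexx orbT.
      lra.
    have [xp|xn] := leP 0 x.
      by rewrite (ger0_norm xp) ltr_norml; move: x_neq0; nra.
    by rewrite (ltr0_norm xn) ltr_norml; nra.
  - apply: hr; last by rewrite -normr_gt0 yn.
    rewrite /ball/= sub0r normrN yn; apply: (@lt_le_trans _ _ r).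
      rewrite ltr_pdivrMr//; apply: (@le_lt_trans _ _ r); first by rewrite ge_min lexx.
      lra.
    by [].
have [y1 [y10 xy1 h1]] := key 1 (or_introl erefl).
have [y2 [y20 xy2 h2]] := key (-1) (or_intror erefl).
rewrite mul1r in y10; rewrite mulN1r oppr_gt0 in y20.
have T1 := tilt_ratio_cvg xy1; have T2 := tilt_ratio_cvg xy2.
rewrite -/(phi y1) in T1; rewrite -/(phi y2) in T2.
have e1 : 0 < e / 2 * y1 by rewrite mulr_gt0// divr_gt0.
have e2 : 0 < e / 2 * - y2 by rewrite mulr_gt0 ?divr_gt0// oppr_gt0.
near=> N.
have N0 : (0 < N)%N by near: N; exact: nbhs_infty_gt.
have j1 := tilt_jensen y1 N0; have j2 := tilt_jensen y2 N0.
have t1 : zs N (tilt mu (x + y1) N) / zs N (tilt mu x N) <= phi y1 + e / 2 * y1.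
  by near: N; apply: (cvgr_le _ T1); rewrite ltrDl.
have t2 : zs N (tilt mu (x + y2) N) / zs N (tilt mu x N) <= phi y2 + e / 2 * - y2.
  by near: N; apply: (cvgr_le _ T2); rewrite ltrDl.
have b1 : mean_dev N <= y1^-1 * (phi y1 - 1) + e / 2.
  rewrite -(ler_pM2l y10) mulrDr mulVKf ?gt_eqF//; lra.
have b2 : y2^-1 * (phi y2 - 1) - e / 2 <= mean_dev N.
  rewrite -(ler_nM2l y20) mulrBr mulVKf ?lt_eqF//; lra.
move: h1 h2; rewrite !ler_norml => /andP[h11 h12] /andP[h21 h22].
lra.
Unshelve. all: end_near. Qed.

(** The event is that the first frequency is at most its mean under the shifted
field.  Maximizers with first coordinate below mu lie in the event, those above
do not, and those at mu are cut at x / a on the scale sqrt N. *)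
Lemma mle_cdf_cvg :
  \sum_(X : {ffun 'I_N -> 'I_q} |
     ((Num.sqrt (N%:R : R))%:E * (mle p beta X - h%:E) <= x%:E)%E) gibbs p beta h X
  @[N --> \oo] -->
  (\sum_(m <- ms) (if first m == mu then M m * Phi a x
                   else if first m < mu then M m else 0)) / \sum_(m <- ms) M m.
Proof.
have [d [d0 sep lok]] := common_radius.
have [C C0 [sC Cs]] := @stirling_ratio_cvg R.
have [m0 m0ms m0mu] := mu_ex.
have exm : exists m, m \in ms by exists m0.
pose v N := mean_xbar p beta n (shifted N) N.
have tilt0 (c : R) N : tilt c 0 N = (fun=> 1).
  by apply/funext => i; rewrite /tilt mul0r expR0.
have Z1 : zs N (fun=> 1) / norm_cst N @[N --> \oo] --> \sum_(m <- ms) M m.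
  apply: (@gibbs_sum_cvg R p beta n h ms Hmax ms_uniq msP msH exm d (fun _ _ => 1) 0 C) => //.
    by move=> N i _ _; rewrite mul0r expR0 normr1.
  move=> m mms; have := near_tilt (lok m mms) (msH mms) (y := 0) (or_introl erefl).
  rewrite eqxx expr0n/= mul0r expR0 mulr1.
  by apply: cvg_trans; apply: near_eq_cvg; apply: nearW => N; rewrite tilt0.
have Z2 : zs N (fun i => (i%:R / N%:R <= v N)%R%:R) / norm_cst N @[N --> \oo] -->
   \sum_(m <- ms) (if first m == mu then M m * Phi a x
                   else if first m < mu then M m else 0).
  have : zs N (fun i => (i%:R / N%:R <= v N)%R%:R) / norm_cst N @[N --> \oo] -->
     \sum_(m <- ms) (if first m == mu then
         M m * fine (normal_prob 0 (Num.sqrt (al m))^-1 `]-oo, x / a])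
       else if first m < mu then M m else 0).
    apply: (@gibbs_sum_cvg R p beta n h ms Hmax ms_uniq msP msH exm d
       (fun N i => (i%:R / N%:R <= v N)%R%:R) 0 C) => //.
      by move=> N i _ _; rewrite mul0r expR0 ger0_norm// lern1 leq_b1.
    move=> m mms; exact: near_le (lok m mms) (msH mms) mean_dev_cvg.
  move=> H; apply: (cvg_limit_eq H).
  apply: eq_big_seq => m mms.
  case: eqP => [mmu|_]; last by reflexivity.
  rewrite /Phi (mu_al mms mmu); reflexivity.
have SM : 0 < \sum_(m <- ms) M m.
  rewrite (perm_big _ (perm_to_rem m0ms)) big_cons/= ltr_wpDr ?M_gt0//.
  by rewrite big_seq; apply: sumr_ge0 => m' /mem_rem m'ms; exact/ltW/M_gt0.
have Z3 : (zs N (fun i => (i%:R / N%:R <= v N)%R%:R) / norm_cst N) /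
     (zs N (fun=> 1) / norm_cst N) @[N --> \oo] -->
   (\sum_(m <- ms) (if first m == mu then M m * Phi a x
                   else if first m < mu then M m else 0)) / \sum_(m <- ms) M m.
  by apply: cvgM => //; apply: cvgV => //; rewrite gt_eqF.
apply: cvg_trans Z3; apply: near_eq_cvg; near=> N.
have N0 : (0 < N)%N by near: N; exact: nbhs_infty_gt.
have s0 : 0 < Num.sqrt (N%:R : R) by rewrite sqrtr_gt0 ltr0n.
have Y (X : {ffun 'I_N -> 'I_q}) :
   ((Num.sqrt (N%:R : R))%:E * (mle p beta X - h%:E) <= x%:E)%E =
   ((cnt X ord0)%:R / N%:R <= v N)%R.
  rewrite -freq0E -[(freq R X)`_0]/(xbar R X) -mle_le//.
  case: (mle p beta X) => [r||].
  - by rewrite -EFinB -EFinM !lee_fin mulrC -ler_pdivlMr// lerBlDl.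
  - by rewrite addye// gt0_muley ?lte_fin// !leye_eq.
  - by rewrite addNye gt0_muleNy ?lte_fin// !leNye.
have Zpos : 0 < zs N (fun=> 1).
  have := gibbs_sum_tilt_gt0 N 0; congr (0 < _); apply: eq_bigr => X _.
  by rewrite /tilt mul0r expR0.
rewrite invf_div mulrA divfK; last by rewrite gt_eqF// norm_cst_gt0.
rewrite /gibbs_sum mulr_suml [RHS]big_mkcond/=; apply: eq_bigr => X _.
rewrite Y; case: ifP => _; rewrite ?mulr1 ?mulr0 ?mul0r//.
rewrite /gibbs; congr (_ / _); apply: eq_bigr => Z _; by rewrite mulr1.
Unshelve. all: end_near. Qed.

End limit_law2.

(** * Structure of the maximizers of H *)
Section maximizers.
Variable R : realType.
Variables (p : nat) (beta : R) (n : nat).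
Notation q := n.+2.
Notation k := (potts_k p beta).
Notation k1 := (k1 p beta).
Notation k2 := (k2 p beta).
Implicit Types (s x y : R) (m t : q.-tuple R).
Hypothesis p_ge2 : (2 <= p)%N.
Hypothesis beta_gt0 : 0 < beta.
Variable h : R.
Hypothesis h_ge0 : 0 <= h.

Lemma sum_tnth (F : R -> R) t : \sum_(x <- t) F x = \sum_r F (tnth t r).
Proof. exact: big_tuple. Qed.

Lemma sum_neq (j : 'I_q) (c : R) : \sum_(r | r != j) c = n.+1%:R * c.
Proof. by rewrite sumr_const cardC1 card_ord mulr_natl. Qed.

Lemma potts_H_field m :
  potts_H p beta h m = \sum_r (k (tnth m r) + field_at h r * tnth m r).
Proof.
rewrite potts_HE [RHS]big_split/=; congr (_ + _).
rewrite (bigD1 ord0)//= big1 ?addr0 /field_at ?eqxx// => r /negbTE ->.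
by rewrite mul0r.
Qed.

Definition transfer m (r r' : 'I_q) (e : R) : q.-tuple R :=
  [tuple if i == r then tnth m r + e else if i == r' then tnth m r' - e
         else tnth m i | i < q].

Lemma sum_transfer (F : 'I_q -> R -> R) m r r' e : r' != r ->
  \sum_i F i (tnth (transfer m r r' e) i) = \sum_i F i (tnth m i) +
    (F r (tnth m r + e) - F r (tnth m r)) + (F r' (tnth m r' - e) - F r' (tnth m r')).
Proof.
move=> rr'; rewrite (bigD1 r)//= (bigD1 r')//= [in RHS](bigD1 r)//= [in RHS](bigD1 r')//=.
rewrite !tnth_mktuple eqxx (negbTE rr') eqxx.
rewrite (eq_bigr (fun i => F i (tnth m i))); first by ring.
by move=> i /andP[ir ir']; rewrite tnth_mktuple (negbTE ir) (negbTE ir').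
Qed.

Lemma prob_vec_transfer m r r' e : prob_vec m -> r' != r ->
  0 <= tnth m r + e -> 0 <= tnth m r' - e -> prob_vec (transfer m r r' e).
Proof.
move=> [m0 m1] rr' re re'; split.
  by move=> i; rewrite tnth_mktuple; case: eqP => // _; case: eqP.
rewrite (sum_tnth id) (sum_transfer (fun _ x => x))// -[RHS]m1 [in RHS](sum_tnth id); ring.
Qed.

Lemma max_transfer m r r' e : H_maximizers p q beta h m -> r' != r ->
  0 <= tnth m r + e -> 0 <= tnth m r' - e ->
  k (tnth m r + e) + k (tnth m r' - e) + e * (field_at h r - field_at h r') <=
  k (tnth m r) + k (tnth m r').
Proof.
move=> [mp mmax] rr' re re'; have := mmax _ (prob_vec_transfer mp rr' re re').
rewrite !potts_H_field (sum_transfer (fun i x => k x + field_at h i * x))//; lra.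
Qed.

Lemma ex_pos_coord m : prob_vec m -> exists r, 0 < tnth m r.
Proof.
move=> [m0 m1]; apply: contrapT => nr; have : \sum_(x <- m) x = 0 :> R.
  rewrite big_tuple big1// => r _; apply/eqP; rewrite eq_le m0 andbT leNgt.
  by apply/negP => mr; apply: nr; exists r.
by rewrite m1 => /eqP; rewrite oner_eq0.
Qed.

(** Entropy: moving a mass e to an empty coordinate gains -e ln e, while the
remaining terms change by O(e). *)
Lemma max_gt0 m r : H_maximizers p q beta h m -> 0 < tnth m r.
Proof.
move=> mmax; have [mp _] := mmax; have [r' r'0] := ex_pos_coord mp.
rewrite lt_neqAle mp.1 andbT eq_sym; apply/negP => /eqP mr0.
have rr' : r' != r by apply: contraTneq r'0 => ->; rewrite mr0 ltxx.
have c0 : 0 < 1 :> R by [].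
(* The coordinate r' is positive, so k is smooth there and the loss is O(e). *)
have nk : \forall x \near tnth m r', der k x (k1 x).
  by near=> z; apply: der_k; near: z; exact: lt_nbhsr.
have /nbhs_ballP[d /= d0 hd] := peano2 nk (der_k1 beta (ltnW p_ge2) r'0) c0.
pose B := `|k1 (tnth m r')| + `|k2 (tnth m r') / 2| + 1 + h.
have B0 : 0 <= B by rewrite !addr_ge0.
near (0 : R)^'+ => e.
have e0 : 0 < e by [].
have e1 : e < 1 by near: e; exact: nbhs_right_lt.
have er' : e < tnth m r' by near: e; exact: nbhs_right_lt.
have ed : e < d by near: e; exact: nbhs_right_lt.
have lne : ln e < - B - 1.
  by near: e; have := @lnNy R; move/cvgrNyPlt; exact.
have := max_transfer (r := r) (r' := r') (e := e) mmax rr'.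
rewrite mr0 add0r subr_ge0 => /(_ (ltW e0) (ltW er')).
have k0 : k 0 = 0 by rewrite /potts_k expr0n gtn_eqF ?(ltnW p_ge2)//= mulr0 mul0r subr0.
rewrite k0 add0r.
have ke : - (e * ln e) <= k e.
  by rewrite /potts_k lerDr mulr_ge0 ?exprn_ge0 ?ltW.
have := hd (tnth m r' - e); rewrite /ball/= opprB addrCA subrr addr0 gtr0_norm//.
move=> /(_ ed); rewrite (_ : _ - e - _ = - e); last by ring.
rewrite sqrrN mulrN mul1r.
have f1 : - h <= field_at h r - field_at h r'.
  by rewrite /field_at; have := h_ge0; case: ifP => _; case: ifP => _; lra.
have a1 := ler_norm (k1 (tnth m r')); have a2 := ler_norm (- (k2 (tnth m r') / 2)).
rewrite normrN in a2.
rewrite ler_norml => /andP[P1 _].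
have ee : e ^+ 2 <= e by rewrite expr2 ler_piMl ?ltW.
rewrite /B in lne; move=> P2.
have Q1 : k1 (tnth m r') * e <= `|k1 (tnth m r')| * e by rewrite ler_pM2r.
have Q2 : - `|k2 (tnth m r') / 2| * e <= k2 (tnth m r') / 2 * e ^+ 2.
  apply: (@le_trans _ _ (- `|k2 (tnth m r') / 2| * e ^+ 2)).
    by rewrite !mulNr lerN2 ler_wpM2l.
  by rewrite ler_wpM2r ?sqr_ge0//; lra.
have Q3 : e * - h <= e * (field_at h r - field_at h r') by rewrite ler_pM2l.
have Q4 : e * (`|k1 (tnth m r')| + `|k2 (tnth m r') / 2| + 1 + h + 1) <= e * - ln e.
  by rewrite ler_pM2l//; lra.
lra.
Unshelve. all: end_near. Qed.

(** First-order condition along the transfers of mass between two colours. *)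
Lemma max_lagrange m r r' : H_maximizers p q beta h m ->
  k1 (tnth m r) + field_at h r = k1 (tnth m r') + field_at h r'.
Proof.
move=> mmax; have [->//|rr'] := eqVneq r' r.
have mr := max_gt0 r mmax; have mr' := max_gt0 r' mmax.
pose phi e := k (tnth m r + e) + k (tnth m r' - e) + e * (field_at h r - field_at h r').
pose c := Num.min (tnth m r) (tnth m r').
have c0 : 0 < c by rewrite lt_min mr.
have cr : c <= tnth m r by rewrite ge_min lexx.
have cr' : c <= tnth m r' by rewrite ge_min lexx orbT.
have dphi e : - c < e < c -> der phi e (k1 (tnth m r + e) - k1 (tnth m r' - e) +
    (field_at h r - field_at h r')).
  move=> ec; have h1 : 0 < tnth m r + e by lra.
  have h2 : 0 < tnth m r' - e by lra.
  apply: der_eq; first by rewrite /phi /potts_k; der_tac => //.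
  by rewrite /k1 /=; field; rewrite !gt_eqF.
have c1 : (0 : R) \in `]- c, c[ by rewrite in_itv/= oppr_lt0 c0.
have cc : - c <= c by lra.
have [|e|_ d1] := @derive1_at_max R phi (- c) c 0 cc _ c1.
- by move=> e; rewrite in_itv/= => /dphi[].
- rewrite in_itv/= => ec; rewrite /phi !addr0 subr0 mul0r addr0.
  by apply: max_transfer => //; lra.
have [_ d2] := dphi 0 c1.
move: d2; rewrite d1 addr0 subr0; lra.
Qed.

(** Swapping two coordinates changes H only through the field. *)
Lemma max_first m r : 0 < h -> H_maximizers p q beta h m -> tnth m r <= tnth m ord0.
Proof.
move=> h0 mmax; have [->//|r0] := eqVneq r ord0.
have mr := max_gt0 r mmax; have m0 := max_gt0 ord0 mmax.
have := max_transfer (r := ord0) (r' := r) (e := tnth m r - tnth m ord0) mmax r0.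
rewrite addrC subrK opprB addrC subrK => /(_ (ltW mr) (ltW m0)).
rewrite /field_at eqxx (negbTE r0) subr0 [k _ + k _]addrC gerDl.
by rewrite pmulr_lle0// subr_le0.
Qed.

Hypothesis Qneg : forall m, H_maximizers p q beta h m ->
   forall t : q.-tuple R, \sum_(x <- t) x = 0 -> t <> [tuple 0 | _ < q] ->
   potts_Q p beta m t < 0.

Lemma potts_QE m t : potts_Q p beta m t = \sum_r k2 (tnth m r) * tnth t r ^+ 2.
Proof. by []. Qed.

Lemma Q_ineq m (w : 'I_q -> R) (r0 : 'I_q) : H_maximizers p q beta h m ->
  \sum_r w r = 0 -> w r0 != 0 -> \sum_r k2 (tnth m r) * w r ^+ 2 < 0.
Proof.
move=> mmax w0 wr; pose t := [tuple w r | r < q].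
have tE r : tnth t r = w r by rewrite tnth_mktuple.
have t0 : \sum_(x <- t) x = 0.
  by rewrite -[RHS]w0 (sum_tnth id); apply: eq_bigr => r _; rewrite tE.
have tn0 : t <> [tuple 0 | _ < q].
  move=> /(congr1 (fun u => tnth u r0)); rewrite tE tnth_mktuple => /eqP.
  by rewrite (negbTE wr).
have := Qneg mmax t0 tn0; rewrite potts_QE; under eq_bigr do rewrite tE.
by [].
Qed.

(** Negative definiteness in the direction e_r - e_r'. *)
Lemma Q_pair m r r' : H_maximizers p q beta h m -> r' != r ->
  k2 (tnth m r) + k2 (tnth m r') < 0.
Proof.
move=> mmax rr'.
pose w (i : 'I_q) : R := if i == r then 1 else if i == r' then -1 else 0.
have E (F : 'I_q -> R -> R) : (forall i, F i 0 = 0) ->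
    \sum_i F i (w i) = F r 1 + F r' (-1).
  move=> F0; rewrite (bigD1 r)//= (bigD1 r')//= /w eqxx (negbTE rr') eqxx.
  rewrite [X in _ + (_ + X)]big1 ?addr0// => i /andP[ir ir'].
  by rewrite (negbTE ir) (negbTE ir').
have := @Q_ineq m w r mmax; rewrite (E (fun _ x => x))// subrr => /(_ erefl).
rewrite /w eqxx oner_eq0 => /(_ isT).
rewrite (E (fun i x => k2 (tnth m i) * x ^+ 2)); last by move=> i; rewrite expr0n mulr0.
by rewrite sqrrN expr1n !mulr1.
Qed.

Lemma k2E x : 0 < x -> k2 x = x^-1 * (beta * p%:R * (p%:R - 1) * x ^+ p.-1 - 1).
Proof.
move=> x0; rewrite /k2; have -> : p.-1 = (p - 2).+1 by move: p_ge2; case: (p) => [//|[//|p']] _; rewrite subn2.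
by rewrite exprS; field; rewrite gt_eqF.
Qed.

(** x k''(x) is increasing. *)
Lemma k2_ge0_mono x y : 0 < x -> x <= y -> 0 <= k2 x -> 0 <= k2 y.
Proof.
move=> x0 xy; have y0 := lt_le_trans x0 xy.
rewrite !k2E// !pmulr_rge0 ?invr_gt0// !subr_ge0 => /le_trans; apply.
have p1 : 0 <= p%:R - 1 :> R by rewrite subr_ge0 ler1n (ltn_trans _ p_ge2).
rewrite ler_wpM2l//; first by rewrite !mulr_ge0// ltW.
by apply: lerXn2r; rewrite // nnegrE ltW.
Qed.

(** k'' changes sign at most once, from negative to positive, so k' is injective on
the region k'' < 0. *)
Lemma k1_inj x y : 0 < x -> 0 < y -> k2 x < 0 -> k2 y < 0 -> k1 x = k1 y -> x = y.
Proof.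
wlog xy : x y / x <= y.
  move=> W x0 y0 kx ky kxy; have [xy|xy] := leP x y; first exact: W.
  by apply/esym/W => //; exact: ltW.
move=> x0 y0 kx ky kxy; apply/eqP; rewrite eq_le xy/= leNgt; apply/negP => {}xy.
have [z /andP[xz zy]|c /andP[xc cy]] := @mvt _ k1 k2 x y xy.
  by apply: der_k1; [exact: ltnW|exact: lt_le_trans xz].
rewrite kxy subrr => /esym/eqP; rewrite mulf_eq0 [y - x == 0]gt_eqF ?subr_gt0// orbF => /eqP kc.
have := @k2_ge0_mono c y (lt_trans x0 xc) (ltW cy); rewrite kc lexx => /(_ isT).
by rewrite leNgt ky.
Qed.

Definition big s : R := (1 + (q%:R - 1) * s) / q%:R.
Definition small s : R := (1 - s) / q%:R.
(** The permutation of x_s that puts the distinguished coordinate at place j. *)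
Definition pvec (j : 'I_q) s : q.-tuple R := [tuple if r == j then big s else small s | r < q].

Lemma q_gt0 : 0 < q%:R :> R. Proof. by rewrite ltr0n. Qed.

Lemma xvecE s : xvec q s = pvec ord0 s.
Proof. by apply: eq_from_tnth => r; rewrite !tnth_mktuple. Qed.

(** Let j be a place of the largest coordinate (the first place if h > 0).  By [Q_pair] at most one coordinate
has k'' >= 0, and by [k2_ge0_mono] it can only be the j-th one; the other
coordinates solve the same Lagrange equation in the region where k' is
injective, hence are equal. *)
Lemma max_pvec m : H_maximizers p q beta h m ->
  exists j s, [/\ 0 <= s < 1, m = pvec j s, 0 < h -> j = ord0 &
    forall r, r != j -> k2 (tnth m r) < 0].
Proof.
move=> mmax.
have [j [jmax jh]] : exists j, (forall r, tnth m r <= tnth m j) /\ (0 < h -> j = ord0).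
  have [h0|h0] := ltP 0 h; first by exists ord0; split => // r; exact: max_first.
  case: (@Order.TotalTheory.arg_maxP _ _ _ ord0 predT (fun r => tnth m r) isT) => j _ jm.
  by exists j; split => // r; exact: jm.
have mr r := max_gt0 r mmax.
have kneg r : r != j -> k2 (tnth m r) < 0.
  move=> rj; rewrite ltNge; apply/negP => kr.
  have kj := k2_ge0_mono (mr r) (jmax r) kr.
  by have := Q_pair mmax rj; lra.
have [r0 r0j] : exists r0 : 'I_q, r0 != j.
  have [->|j0] := eqVneq j ord0; first by exists ord_max.
  by exists ord0; rewrite eq_sym.
have meq r : r != j -> tnth m r = tnth m r0.
  move=> rj; apply: k1_inj; rewrite ?mr ?kneg//.
  have := max_lagrange r r0 mmax.
  have [h0|h0] := ltP 0 h.
    by rewrite /field_at -(jh h0) (negbTE rj) (negbTE r0j) !addr0.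
  have -> : h = 0 by apply/eqP; rewrite eq_le h0 h_ge0.
  by rewrite /field_at !if_same !addr0.
have [[_ m1] _] := mmax.
have m1' : tnth m j + (n.+1)%:R * tnth m r0 = 1.
  rewrite -[RHS]m1 (sum_tnth id) [RHS](bigD1 j)//=; congr (_ + _).
  rewrite (eq_bigr (fun=> tnth m r0)); last by move=> r rj; exact: meq.
  by rewrite sum_neq.
have q0 := q_gt0; have qE : q%:R = n.+1%:R + 1 :> R by rewrite natr1.
exists j, (1 - q%:R * tnth m r0); split => //.
- have := jmax r0; have := mr r0; have n0 : 0 <= n.+1%:R :> R by [].
  rewrite qE; nra.
- apply: eq_from_tnth => r; rewrite tnth_mktuple; case: eqP => [->|/eqP rj].
    rewrite /big; have -> : tnth m j = 1 - n.+1%:R * tnth m r0 by lra.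
    have -> : n.+1%:R = q%:R - 1 :> R by rewrite qE addrK.
    by move: (q%:R : R) q0 => Q Q0; field; rewrite gt_eqF.
  by rewrite meq// /small; move: (q%:R : R) q0 => Q Q0; field; rewrite gt_eqF.
Qed.

Lemma pvec_tnth j s r : tnth (pvec j s) r = if r == j then big s else small s.
Proof. by rewrite tnth_mktuple. Qed.

Lemma sum_pvec (F : R -> R) j s :
  \sum_r F (tnth (pvec j s) r) = F (big s) + n.+1%:R * F (small s).
Proof.
rewrite (bigD1 j)//= pvec_tnth eqxx; congr (_ + _).
rewrite (eq_bigr (fun=> F (small s))); last first.
  by move=> r rj; rewrite pvec_tnth (negbTE rj).
exact: sum_neq.
Qed.

Lemma big_small s : big s + n.+1%:R * small s = 1.
Proof.
have q0 := q_gt0; have qE : q%:R = n.+1%:R + 1 :> R by rewrite natr1.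
have -> : n.+1%:R = q%:R - 1 :> R by rewrite qE addrK.
by rewrite /big /small; move: (q%:R : R) q0 => Q Q0; field; rewrite gt_eqF.
Qed.

Lemma prob_vec_pvec j s : 0 <= s <= 1 -> prob_vec (pvec j s).
Proof.
move=> /andP[s0 s1]; have q0 := q_gt0; split.
  have q1 : 0 <= q%:R - 1 :> R by rewrite subr_ge0 ler1n.
  move=> r; rewrite pvec_tnth /big /small.
  case: ifP => _; apply: divr_ge0; rewrite ?ler0n// ?subr_ge0//.
  by rewrite addr_ge0// mulr_ge0.
by rewrite (sum_tnth id) (sum_pvec id) big_small.
Qed.

Lemma small_le_big s : 0 <= s -> small s <= big s.
Proof.
move=> s0; have q0 := q_gt0; rewrite /small /big ler_pM2r ?invr_gt0//.
have : 0 <= q%:R :> R by []; nra.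
Qed.

Lemma potts_H_pvec j s : potts_H p beta h (pvec j s) =
  k (big s) + n.+1%:R * k (small s) + h * (if ord0 == j then big s else small s).
Proof. by rewrite potts_HE (sum_pvec k) pvec_tnth. Qed.

Lemma potts_H_pvec_le j s : 0 <= s -> potts_H p beta h (pvec j s) <= potts_f p q beta h s.
Proof.
move=> s0; rewrite /potts_f xvecE !potts_H_pvec eqxx lerD2l ler_wpM2l//.
by case: eqP => // _; exact: small_le_big.
Qed.

Hypothesis max_ex : exists m, H_maximizers p q beta h m.

(** By [max_pvec] the maximum of H is attained at some [pvec j s], where H is at most f(s). *)
Lemma f_maxP s : f_maximizers p q beta h s <->
  0 <= s <= 1 /\ H_maximizers p q beta h (pvec ord0 s).
Proof.
split=> [[s01 smax]|[s01 [_ smax]]]; split => //; last first.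
  move=> u u01; rewrite /potts_f !xvecE; apply: smax; exact: prob_vec_pvec.
split; first exact: prob_vec_pvec.
move=> t tp; have [m mmax] := max_ex; apply: (le_trans (mmax.2 _ tp)).
have [j [u [/andP[u0 u1] -> _ _]]] := max_pvec mmax.
apply: (le_trans (potts_H_pvec_le j u0)).
rewrite -xvecE; apply: smax; by rewrite u0 ltW.
Qed.

(** Necessity is [max_pvec].  Conversely, permuting x_s leaves H unchanged if h = 0. *)
Lemma H_maxP m : H_maximizers p q beta h m <->
  exists j s, [/\ f_maximizers p q beta h s, m = pvec j s & 0 < h -> j = ord0].
Proof.
split=> [mmax|[j [s [smax -> jh]]]].
  have [j [s [/andP[s0 s1] mE jh _]]] := max_pvec mmax.
  exists j, s; split => //; apply/f_maxP; split; first by rewrite s0 ltW.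
  split; first by apply: prob_vec_pvec; rewrite s0 ltW.
  move=> t tp; apply: (le_trans (mmax.2 _ tp)); rewrite mE.
  by rewrite -xvecE; exact: potts_H_pvec_le.
have [s01 smax'] := (f_maxP s).1 smax.
split; first exact: prob_vec_pvec.
move=> t tp; apply: (le_trans (smax'.2 _ tp)).
rewrite !potts_H_pvec lerD2l eqxx.
have [h0|h0] := ltP 0 h; first by rewrite (jh h0) eqxx.
by have -> : h = 0; [apply/eqP; rewrite eq_le h0 h_ge0|rewrite !mul0r].
Qed.

Lemma f_max_lt1 s : f_maximizers p q beta h s -> 0 <= s < 1.
Proof.
move=> smax; have [/andP[s0 _] smax'] := (f_maxP s).1 smax; rewrite s0/=.
have := max_gt0 ord_max smax'; rewrite pvec_tnth/= /small.
by rewrite pmulr_lgt0 ?invr_gt0 ?q_gt0// subr_gt0.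
Qed.

(** The second inequality is negative definiteness in the direction
(q - 1, -1, ..., -1). *)
Lemma f_max_curv s : f_maximizers p q beta h s ->
  k2 (small s) < 0 /\ n.+1%:R * k2 (big s) + k2 (small s) < 0.
Proof.
move=> smax; have [/andP[s0 _] smax'] := (f_maxP s).1 smax.
have n0 : 0 < n.+1%:R :> R by rewrite ltr0n.
split.
  have mr r := max_gt0 r smax'.
  rewrite ltNge; apply/negP => kr.
  have := mr ord_max; rewrite pvec_tnth/= => s'0.
  have kj := k2_ge0_mono s'0 (small_le_big s0) kr.
  have := @Q_pair _ ord0 ord_max smax' isT; rewrite !pvec_tnth/=; lra.
pose w (r : 'I_q) : R := if r == ord0 then n.+1%:R else -1.
have wE (F : 'I_q -> R -> R) f : (forall r, r != ord0 -> F r (-1) = f) ->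
    \sum_r F r (w r) = F ord0 n.+1%:R + n.+1%:R * f.
  move=> Ff; rewrite (bigD1 ord0)//= /w eqxx; congr (_ + _).
  rewrite (eq_bigr (fun=> f)); last by move=> r r0; rewrite (negbTE r0) Ff.
  exact: sum_neq.
have := @Q_ineq _ w ord0 smax'; rewrite (wE (fun _ x => x) (-1))// mulrN1 subrr.
move=> /(_ erefl); rewrite /w eqxx gt_eqF// => /(_ isT).
rewrite -/w (wE (fun r x => k2 (tnth (pvec ord0 s) r) * x ^+ 2) (k2 (small s))); last first.
  by move=> r r0; rewrite pvec_tnth (negbTE r0) sqrrN expr1n mulr1.
rewrite pvec_tnth eqxx => H.
have : n.+1%:R * (n.+1%:R * k2 (big s) + k2 (small s)) < 0.
  by rewrite mulrDr mulrA [X in X + _]mulrC.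
by rewrite pmulr_rlt0.
Qed.

End maximizers.

(** * The local law at a maximizer *)
Section local_at_maximizer.
Variable R : realType.
Variables (p : nat) (beta : R) (n : nat).
Notation q := n.+2.
Notation k := (potts_k p beta).
Notation k1 := (k1 p beta).
Notation k2 := (k2 p beta).
Notation big := (big n).
Notation small := (small n).
Implicit Types (s x y : R) (m t : q.-tuple R).
Hypothesis p_ge2 : (2 <= p)%N.
Variable h : R.

(** Up to a positive constant this is -f''(s), see [potts_ddfE]. *)
Definition curv s : R := - k2 (small s) + n.+1%:R * - k2 (big s).

(** Precision of the first count near [pvec j s]. *)
Definition prec_of (j : 'I_q) s : R :=
  if j == ord0 then - k2 (big s) + - k2 (small s) / n.+1%:R
  else - k2 (small s) * curv s / (- k2 (small s) + n%:R * - k2 (big s)).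

(** Total mass of the window around [pvec j s]; C stands for the limit of the
Stirling ratio. *)
Definition mass (C s : R) : R :=
  (Num.sqrt (big s * small s ^+ n.+1) * C ^+ q)^-1 *
  Num.sqrt ((2 * pi) ^+ n.+1 / ((- k2 (small s)) ^+ n * curv s)).

Lemma curv_part s : 0 < - k2 (small s) -> 0 < curv s ->
  0 < - k2 (small s) + n%:R * - k2 (big s).
Proof.
rewrite /curv; move: (- k2 (small s)) (- k2 (big s)) => b a b0.
have n0 : 0 <= n%:R :> R by [].
have [a0 _|a0] := leP 0 a; first by rewrite ltr_wpDr// mulr_ge0.
by rewrite -natr1 mulrDl mul1r; lra.
Qed.

Lemma mass_gt0 C s : 0 < C -> 0 < big s -> 0 < small s -> 0 < - k2 (small s) ->
  0 < curv s -> 0 < mass C s.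
Proof.
move=> C0 b0 s0 k0 c0; apply: mulr_gt0.
  rewrite invr_gt0; apply: mulr_gt0; last exact: exprn_gt0.
  by rewrite sqrtr_gt0; apply: mulr_gt0 => //; exact: exprn_gt0.
rewrite sqrtr_gt0; apply: divr_gt0; first by apply: exprn_gt0; rewrite mulr_gt0// pi_gt0.
by apply: mulr_gt0 => //; exact: exprn_gt0.
Qed.

Lemma prec_same (a b : R) : 0 < b -> prec n a b b = a + b / n.+1%:R.
Proof.
move=> b0; rewrite /prec (_ : b + n%:R * b = (1 + n%:R) * b); last by ring.
by rewrite -nat1r; field; rewrite !gt_eqF.
Qed.

Lemma prec_diff (a b : R) : 0 < b + n%:R * a ->
  prec n b a b = b * (b + n.+1%:R * a) / (b + n%:R * a).
Proof. by move=> b0; rewrite /prec -nat1r; field; rewrite gt_eqF. Qed.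

(** With [var_diff]: the total mass is symmetric in the colours although the first
one is singled out in the computation. *)
Lemma var_same (a b : R) : 0 < b -> 0 < b + n.+1%:R * a ->
  (2 * pi / b) ^+ n * (b / (b + n%:R * b)) * (2 * pi / (a + b / n.+1%:R)) =
  (2 * pi) ^+ n.+1 / (b ^+ n * (b + n.+1%:R * a)).
Proof.
move=> b0 D0; rewrite (_ : b + n%:R * b = (1 + n%:R) * b); last by ring.
rewrite (_ : a + b / n.+1%:R = (b + n.+1%:R * a) / (1 + n%:R)); last first.
  by rewrite -nat1r; field; rewrite gt_eqF.
rewrite exprMn exprVn exprSr; move: (b + _) D0 => D D0; field.
by rewrite !gt_eqF// exprn_gt0.
Qed.

Lemma var_diff (a b : R) : 0 < b -> 0 < b + n.+1%:R * a -> 0 < b + n%:R * a ->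
  (2 * pi / b) ^+ n * (b / (b + n%:R * a)) *
    (2 * pi / (b * (b + n.+1%:R * a) / (b + n%:R * a))) =
  (2 * pi) ^+ n.+1 / (b ^+ n * (b + n.+1%:R * a)).
Proof.
move=> b0 D0 E0; rewrite exprMn exprVn exprSr.
move: (b + _ * _) (b + _ * _) D0 E0 => E D D0 E0; field.
by rewrite !gt_eqF// exprn_gt0.
Qed.

Lemma sqrtrX (y : R) i : 0 <= y -> Num.sqrt y ^+ i = Num.sqrt (y ^+ i).
Proof.
move=> y0; elim: i => [|i IH]; first by rewrite !expr0 sqrtr1.
by rewrite !exprS sqrtrM// IH.
Qed.

(** Besides the first coordinate, one further coordinate may be exceptional; it
is j itself, or an arbitrary one if j is the first place. *)
Lemma pvec_loc_ok (C : R) j s : 0 < C -> stirling_ratio R i @[i --> \oo] --> C ->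
  (forall i, (0 < i)%N -> C <= stirling_ratio R i) ->
  0 < big s -> 0 < small s -> 0 < - k2 (small s) -> 0 < curv s ->
  (forall r r', k1 (tnth (pvec j s) r) + field_at h r =
                k1 (tnth (pvec j s) r') + field_at h r') ->
  (j != ord0 -> h = 0) ->
  \forall d \near 0^'+, loc_ok p beta h d (pvec j s) (prec_of j s) (mass C s).
Proof.
move=> C0 sC Cs X0 y0 b0 D0 lag jh.
set X := big s in X0 *; set y := small s in y0 b0 *.
have p0 : (0 < p)%N by exact: ltnW.
have bna := curv_part b0 D0.
have n10 : 0 < n.+1%:R :> R by rewrite ltr0n.
have pi20 : 0 < 2 * pi :> R by rewrite mulr_gt0// pi_gt0.
pose x0 := if j == ord0 then X else y.
pose xj := if j == ord0 then y else X.
pose jj : 'I_q := if j == ord0 then ord_max else j.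
have jj0 : jj != ord0 by rewrite /jj; case: (eqVneq j ord0).
have t0 : tnth (pvec j s) ord0 = x0.
  by rewrite pvec_tnth /x0 eq_sym.
have tj : tnth (pvec j s) jj = xj.
  rewrite pvec_tnth /jj /xj; case: (eqVneq j ord0) => [->|_]; last by rewrite eqxx.
  by [].
have x00 : 0 < x0 by rewrite /x0; case: ifP.
have xj0 : 0 < xj by rewrite /xj; case: ifP.
have oth r : r != ord0 -> r != jj -> tnth (pvec j s) r = y.
  rewrite pvec_tnth /jj; case: (eqVneq j ord0) => [-> /negbTE -> //|_ _ /negbTE ->//].
have sum1 : x0 + xj + n%:R * y = 1.
  rewrite -[RHS](big_small n s) -/X -/y /x0 /xj -natr1; case: ifP => _; ring.
have yj : - k2 y + n%:R * - k2 xj > 0.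
  rewrite /xj; case: ifP => _ //; by rewrite ltr_wpDr// mulr_ge0// ltW.
have precE : prec n (- k2 x0) (- k2 xj) (- k2 y) = prec_of j s.
  rewrite /prec_of /x0 /xj -/X -/y; case: ifP => _; first exact: prec_same.
  exact: prec_diff.
have al0 : 0 < prec_of j s.
  rewrite /prec_of -/X -/y; case: ifP => _; last by apply: divr_gt0 => //; exact: mulr_gt0.
  have -> : - k2 X + - k2 y / n.+1%:R = curv s / n.+1%:R.
    rewrite /curv -/X -/y mulrDl addrC; congr (_ + _).
    by rewrite mulrC mulrA mulVf ?mul1r// gt_eqF.
  exact: divr_gt0.
have al0' : 0 < prec n (- k2 x0) (- k2 xj) (- k2 y) by rewrite precE.
have [b bpos lg] := local_gauss_counts p0 x00 xj0 y0 sum1 b0 yj al0' sC C0 Cs.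
near=> d.
have d0 : 0 < d by [].
have dX : d < X by near: d; exact: nbhs_right_lt.
have dy : d < y by near: d; exact: nbhs_right_lt.
have lgd : local_gauss x0 (prec n (- k2 x0) (- k2 xj) (- k2 y)) b
     ((Num.sqrt x0 * C)^-1 * ((Num.sqrt xj * C)^-1 * (Num.sqrt y * C)^-1 ^+ n *
       Num.sqrt ((2 * pi / - k2 y) ^+ n * (- k2 y / (- k2 y + n%:R * - k2 xj)))))
     (pinned (coord_loc p beta d x0) (conv_iter (coord_loc p beta d xj) (coord_loc p beta d y) n)).
  by near: d.
have kn : - k2 y != 0 by rewrite gt_eqF.
split; first by rewrite /first t0.
split=> //; rewrite precE in lgd.
exists (pinned (coord_loc p beta d x0) (conv_iter (coord_loc p beta d xj) (coord_loc p beta d y) n)).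
eexists; eexists; split; [exact: bpos|rewrite /first t0; exact: lgd| | |].
- have sx0 : 0 < Num.sqrt x0 by rewrite sqrtr_gt0.
  have sxj : 0 < Num.sqrt xj by rewrite sqrtr_gt0.
  have sy : 0 < Num.sqrt y by rewrite sqrtr_gt0.
  set V := Num.sqrt (_ ^+ n * _); set W := Num.sqrt (2 * pi / _).
  rewrite (_ : _ * W = (Num.sqrt x0 * C)^-1 * (Num.sqrt xj * C)^-1 *
    (Num.sqrt y * C)^-1 ^+ n * (V * W)); last by rewrite !mulrA.
  rewrite /V /W -sqrtrM; last first.
    apply: mulr_ge0; last by apply: divr_ge0; exact: ltW.
    by apply: exprn_ge0; apply: divr_ge0; exact: ltW.
  rewrite /mass -/X -/y.
  have -> : (2 * pi / - k2 y) ^+ n * (- k2 y / (- k2 y + n%:R * - k2 xj)) * (2 * pi / prec_of j s) =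
      (2 * pi) ^+ n.+1 / ((- k2 y) ^+ n * curv s).
    rewrite /prec_of /xj -/X -/y; case: ifP => _; first exact: var_same.
    exact: var_diff.
  congr (_ * _).
  have -> : Num.sqrt (X * y ^+ n.+1) = Num.sqrt x0 * Num.sqrt xj * Num.sqrt y ^+ n.
    rewrite sqrtrX ?(ltW y0)// -!sqrtrM; try by rewrite ?mulr_ge0 // ltW.
    by congr Num.sqrt; rewrite /x0 /xj exprS; case: ifP => _; ring.
  rewrite exprVn exprMn !exprS; field.
  by rewrite !gt_eqF ?exprn_gt0.
- by move=> N i Ni; rewrite /pinned leqNgt Ni.
- move=> N g N0; pose lam := k1 x0 + @field_at R n h ord0.
  have NS := @near_sum_loc R p beta n h (pvec j s) d y lam jj N g N0 jj0.
  rewrite t0 tj in NS; apply: NS => //.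
  + by move=> r; rewrite pvec_tnth; case: ifP.
  + by rewrite (sum_pvec id) big_small.
  + by move=> r; rewrite /lam -t0; exact: lag.
  + have yE : y = tnth (pvec j s) (if j == ord0 then ord_max else ord0).
      by rewrite pvec_tnth; case: (eqVneq j ord0) => [->|j0]//; rewrite eq_sym (negbTE j0).
    rewrite {1}yE /lam -t0 -(lag (if j == ord0 then ord_max else ord0)) /field_at.
    by case: (eqVneq j ord0) => [_|j0]/=; rewrite ?jh ?addr0.
Unshelve. all: end_near. Qed.

End local_at_maximizer.

(** * Derivatives of f and identification of the constants *)
Section second_derivatives.
Variable R : realType.
Implicit Types (f : R -> R) (x a b : R).

Lemma dcomp f (g : R -> R) x a b : der f (g x) a -> der g x b ->
  der (fun y => f (g y)) x (a * b).
Proof. by rewrite /der => fa gb; exact: (@is_derive1_comp _ f g x _ _ fa gb). Qed.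

Lemma der_derive1n2 f (f1 : R -> R) x a : (\forall y \near x, der f y (f1 y)) -> der f1 x a ->
  (f^`(2))%classic x = a.
Proof.
move=> fd f1d; rewrite derive1nS derive1n1 derive1E.
have E : \forall y \near x, (f^`())%classic y = f1 y.
  by apply: filterS fd => y [_ yd]; rewrite derive1E.
by rewrite (near_eq_derive _ E); case: f1d.
Qed.
End second_derivatives.

Section potts_derivatives.
Variable R : realType.
Variables (p : nat) (beta : R) (n : nat).
Notation q := n.+2.
Notation k := (potts_k p beta).
Notation k1 := (k1 p beta).
Notation k2 := (k2 p beta).
Notation big := (@big R n).
Notation small := (@small R n).
Implicit Types (s x y : R) (m t : q.-tuple R).
Hypothesis p_ge2 : (2 <= p)%N.
Variable h : R.

Lemma potts_k2E x : 0 < x -> potts_k2 p beta x = k2 x.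
Proof.
move=> x0; apply: (der_derive1n2 (f1 := k1)); last by apply: der_k1 => //; exact: ltnW.
by near=> y; apply: der_k; near: y; exact: lt_nbhsr.
Unshelve. all: end_near. Qed.

(** Closed forms of f' and f'', valid wherever both coordinates are positive. *)
Definition potts_df s : R := n.+1%:R / q%:R * (k1 (big s) + h - k1 (small s)).
Definition potts_ddf s : R :=
  (n.+1%:R ^+ 2 * k2 (big s) + n.+1%:R * k2 (small s)) / q%:R ^+ 2.

Let qE : q%:R = 1 + n.+1%:R :> R. Proof. by rewrite nat1r. Qed.
Let q0 : 0 < q%:R :> R. Proof. by rewrite ltr0n. Qed.

Lemma der_big s : der big s (n.+1%:R / q%:R).
Proof.
apply: der_eq; first by rewrite /big; der_tac; rewrite gt_eqF.
by rewrite /= qE; move: q0; rewrite qE => ?; field; rewrite gt_eqF.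
Qed.

Lemma der_small s : der small s (- q%:R^-1).
Proof.
apply: der_eq; first by rewrite /small; der_tac; rewrite gt_eqF.
by rewrite /=; move: (q%:R : R) q0 => Q Q0; field; rewrite gt_eqF.
Qed.

Lemma potts_fE s : potts_f p q beta h s = k (big s) + n.+1%:R * k (small s) + h * big s.
Proof. by rewrite /potts_f xvecE potts_H_pvec eqxx. Qed.

Lemma der_potts_f s : 0 < big s -> 0 < small s -> der (potts_f p q beta h) s (potts_df s).
Proof.
move=> b0 s0.
rewrite (_ : potts_f p q beta h = fun s => k (big s) + n.+1%:R * k (small s) + h * big s).
  have d1 := dcomp (der_k p beta b0) (der_big s).
  have d2 := dM (dcst n.+1%:R s) (dcomp (der_k p beta s0) (der_small s)).
  have d3 := dM (dcst h s) (der_big s).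
  apply: (der_eq (dD (dD d1 d2) d3)).
  by rewrite /potts_df /=; ring.
by apply/funext => u; rewrite potts_fE.
Qed.

Lemma der_potts_df s : 0 < big s -> 0 < small s -> der potts_df s (potts_ddf s).
Proof.
move=> b0 s0; have p0 : (0 < p)%N by exact: ltnW.
have d1 := dcomp (der_k1 beta p0 b0) (der_big s).
have d2 := dN (dcomp (der_k1 beta p0 s0) (der_small s)).
have d3 := dM (dcst (n.+1%:R / q%:R) s) (dD (dD d1 (dcst h s)) d2).
apply: (der_eq d3).
rewrite /potts_ddf /=; move: (n.+1%:R : R) (q%:R : R) q0 => M Q Q0; field.
by rewrite gt_eqF.
Qed.

Lemma continuous_big : continuous big.
Proof. by move=> s; exact: is_derive_continuous (der_big s). Qed.

Lemma continuous_small : continuous small.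
Proof. by move=> s; exact: is_derive_continuous (der_small s). Qed.

Lemma near_pos s : 0 < big s -> 0 < small s ->
  \forall u \near s, 0 < big u /\ 0 < small u.
Proof.
move=> b0 s0; near=> u; split; near: u.
  have c1 : big u @[u --> s] --> big s := @continuous_big s.
  exact: (cvgr_gt (big s) c1).
have c2 : small u @[u --> s] --> small s := @continuous_small s.
exact: (cvgr_gt (small s) c2).
Unshelve. all: end_near. Qed.

Lemma potts_f2_ddf s : 0 < big s -> 0 < small s -> potts_f2 p q beta h s = potts_ddf s.
Proof.
move=> b0 s0; apply: (der_derive1n2 (f1 := potts_df)); last exact: der_potts_df.
near=> u; have [] : 0 < big u /\ 0 < small u by near: u; exact: near_pos.
exact: der_potts_f.
Unshelve. all: end_near. Qed.

Lemma big_gt0 s : 0 <= s -> 0 < big s.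
Proof.
move=> s0; rewrite /big divr_gt0// ltr_wpDr// mulr_ge0//.
Qed.

Lemma small_gt0 s : s < 1 -> 0 < small s.
Proof. by move=> s1; rewrite /small divr_gt0// subr_gt0. Qed.

Notation curv := (curv p beta n).
Notation prec_of := (prec_of p beta).

Lemma potts_ddfE s : potts_ddf s = - (n.+1%:R * curv s / q%:R ^+ 2).
Proof. by rewrite /potts_ddf /curv; move: (q%:R ^+ 2)^-1 => Q; ring. Qed.

(** With [var_otherE]: the variances of the limit laws are the precisions of the first
count at the two kinds of maximizers. *)
Lemma var_firstE s : 0 <= s < 1 ->
  - (q%:R ^+ 2 / (q%:R - 1) ^+ 2) * potts_f2 p q beta h s = prec_of (ord0 : 'I_q) s.
Proof.
move=> /andP[s0 s1]; rewrite potts_f2_ddf ?big_gt0 ?small_gt0// potts_ddfE /prec_of eqxx /curv.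
have -> : q%:R - 1 = n.+1%:R :> R by rewrite qE addrAC subrr add0r.
have n0 : 0 < n.+1%:R :> R by rewrite ltr0n.
move: (n.+1%:R : R) (q%:R : R) q0 n0 => N Q Q0 N0; field.
by rewrite !gt_eqF.
Qed.

Lemma var_otherE s (j : 'I_q) : 0 <= s < 1 -> j != ord0 -> 0 < - k2 (small s) ->
  0 < curv s ->
  - (q%:R ^+ 2 * potts_f2 p q beta h s /
     ((q%:R - 1) * (1 + (q%:R - 2) * rho p q beta s))) = prec_of j s.
Proof.
move=> /andP[s0 s1] j0 b0 D0; have := curv_part b0 D0.
rewrite potts_f2_ddf ?big_gt0 ?small_gt0// potts_ddfE /prec_of (negbTE j0).
have -> : q%:R - 1 = n.+1%:R :> R by rewrite qE addrAC subrr add0r.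
have -> : q%:R - 2 = n%:R :> R by rewrite -addn2 natrD addrK.
rewrite /rho -/(big s) -/(small s) !potts_k2E ?big_gt0 ?small_gt0//.
move: (curv s) D0 => D D0; move: (k2 (big s)) => A.
have n0 : 0 < n.+1%:R :> R by rewrite ltr0n.
have kE : k2 (small s) = - - k2 (small s) by rewrite opprK.
rewrite kE; move: (- k2 (small s)) b0 {kE} => b b0; rewrite !opprK => E0.
have -> : 1 + n%:R * (A / - b) = (b + n%:R * - A) / b.
  by rewrite invrN mulrDl divff ?gt_eqF//; ring.
move: (b + _) E0 (n.+1%:R : R) (q%:R : R) q0 n0 => E E0 N Q Q0 N0; field.
by rewrite !gt_eqF.
Qed.

Lemma perm_pvec (j : 'I_q) s : perm_eq (pvec j s) (xvec q s).
Proof.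
rewrite xvecE; apply/tuple_permP; exists (tperm ord0 j); congr tval.
apply: eq_from_tnth => r; rewrite !tnth_mktuple.
congr (if _ then _ else _).
by rewrite -[RHS](inj_eq (@perm_inj _ (tperm ord0 j))) tpermK tpermL.
Qed.

(** The sum of the squares of the coordinates of x_s is (1 + (q - 1) s^2) / q, which
determines s >= 0. *)
Lemma s_of_pvec (j : 'I_q) s : 0 <= s < 1 -> s_of (pvec j s) = s.
Proof.
move=> s01; rewrite /s_of; case: xgetP => [u _ [/andP[u0 u1] pu]|]; last first.
  by move=> /(_ s) []; split => //; exact: perm_pvec.
have E : \sum_(x <- xvec q s) x ^+ 2 = \sum_(x <- xvec q u) x ^+ 2.
  rewrite -(perm_big _ (perm_pvec j s)); exact: perm_big.
have sqE (v : R) : \sum_(x <- xvec q v) x ^+ 2 = (1 + n.+1%:R * v ^+ 2) / q%:R.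
  rewrite xvecE; apply: etrans; first exact: (sum_tnth (fun x : R => x ^+ 2)).
  apply: etrans; first exact: (sum_pvec (fun x : R => x ^+ 2) ord0 v).
  rewrite /big /small.
  rewrite qE; move: q0; rewrite qE => h0; field; by rewrite gt_eqF.
move: E; rewrite !sqE => /(mulIf (invr_neq0 (lt0r_neq0 q0))) /addrI.
move=> /(mulfI (_ : n.+1%:R != 0)) E.
have /andP[s0 _] := s01.
by apply/eqP; rewrite -(@eqrXn2 _ 2)// E; rewrite ?pnatr_eq0.
Qed.

(** The factor common to all maximizers between mass and tau. *)
Definition kappa (C : R) : R :=
  (C ^+ q)^-1 * Num.sqrt ((2 * pi) ^+ n.+1 * n.+1%:R / q%:R ^+ 2).

Lemma kappa_gt0 C : 0 < C -> 0 < kappa C.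
Proof.
move=> C0; rewrite mulr_gt0 ?invr_gt0 ?exprn_gt0// sqrtr_gt0.
by rewrite divr_gt0 ?exprn_gt0// mulr_gt0// exprn_gt0// mulr_gt0// pi_gt0.
Qed.

(** This turns ratios of masses into the weights built from tau. *)
Lemma mass_tau C (j : 'I_q) s : 0 < C -> 0 <= s < 1 -> 0 < - k2 (small s) -> 0 < curv s ->
  mass p beta n C s = kappa C * tau p beta h (pvec j s).
Proof.
move=> C0 s01 b0 D0; rewrite /tau s_of_pvec//.
have /andP[s0 s1] := s01; have X0 := big_gt0 s0; have y0 := small_gt0 s1.
rewrite potts_f2_ddf// potts_ddfE -/(small s) potts_k2E//.
have -> : \prod_(x <- pvec j s) x = big s * small s ^+ n.+1.
  rewrite big_tuple (bigD1 j)//= pvec_tnth eqxx; congr (_ * _).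
  rewrite (eq_bigr (fun=> small s)); last by move=> r rj; rewrite pvec_tnth (negbTE rj).
  by rewrite prodr_const cardC1 card_ord.
have -> : (- k2 (small s)) ^ (2 - q%:Z) = ((- k2 (small s)) ^+ n)^-1.
  have -> : 2 - q%:Z = - n%:Z by rewrite -(addn2 n) PoszD opprD addrCA subrr addr0.
  by rewrite -exprnN.
have n0 : 0 < n.+1%:R :> R by rewrite ltr0n.
have pi20 : 0 < 2 * pi :> R by rewrite mulr_gt0// pi_gt0.
rewrite /mass /kappa; move: (curv s) D0 (- k2 (small s)) b0 => D D0 b b0.
have bn0 : 0 < b ^+ n by exact: exprn_gt0.
have P0 : 0 < big s * small s ^+ n.+1 by rewrite mulr_gt0// exprn_gt0.
have V0 : 0 < (2 * pi) ^+ n.+1 :> R by exact: exprn_gt0.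
have Q0 : 0 < q%:R ^+ 2 :> R by exact: exprn_gt0.
move: (big s * _) P0 (b ^+ n) bn0 ((2 * pi) ^+ _) V0 (q%:R ^+ 2) Q0 (n.+1%:R : R) n0.
move=> P P0 B B0 V V0 Q Q0 N N0.
rewrite -[RHS]mulrA -sqrtrM; last by apply: divr_ge0; [apply: mulr_ge0|]; exact: ltW.
have -> : V * N / Q * (- (- (N * D / Q))^-1 / B / P) = V / (B * D) / P.
  by field; rewrite !gt_eqF.
rewrite [in RHS]sqrtrM; last by apply: divr_ge0; [|apply: mulr_ge0]; exact: ltW.
rewrite sqrtrV; last exact: ltW.
rewrite invfM; ring.
Qed.
End potts_derivatives.

(** * Quasi-concavity of the sign of the second derivative of f *)
Section sign_change.
Variable R : realType.
Implicit Types (z t : R) (c : nat -> R).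

(** If all coefficients below the top degree m are nonnegative, then the
polynomial divided by z^m is nonincreasing, so its sign changes at most once,
from positive to negative. *)
Lemma descartes (m : nat) c z1 z2 : 0 < z1 -> z1 < z2 -> (forall j, (j < m)%N -> 0 <= c j) ->
  z1 ^+ m * (\sum_(j < m.+1) c j * z2 ^+ j) <= z2 ^+ m * (\sum_(j < m.+1) c j * z1 ^+ j).
Proof.
move=> z10 z12 c0; have z20 := lt_trans z10 z12.
rewrite !mulr_sumr; apply: ler_sum => j _.
have [jm|jm] := eqVneq (j : nat) m.
  by rewrite jm mulrCA [leRHS]mulrCA [z1 ^+ m * _]mulrC.
have {}jm : (j < m)%N by rewrite ltn_neqAle jm -ltnS ltn_ord.
rewrite mulrCA [leRHS]mulrCA; apply: ler_wpM2l; first exact: c0.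
have E z : z ^+ m = z ^+ (m - j) * z ^+ j by rewrite -exprD subnK// ltnW.
rewrite !E -!mulrA [z1 ^+ j * _]mulrC.
apply: ler_wpM2r; first by rewrite mulr_ge0// exprn_ge0// ltW.
by apply: lerXn2r; rewrite ?nnegrE// ltW.
Qed.

Variables (M m : nat).

(** The derivative of [curvature_profile] in s, up to a positive factor, as a
function of the ratio t of the two coordinates, with q = M + 2 and p = m + 2. *)
Definition phi t : R := M.+1%:R ^+ 2 * m.+1%:R * t ^+ m - M.+1%:R * t ^+ m.+1 + M.+1%:R - m.+1%:R * t.

Let phic (j : nat) : R := M.+1%:R ^+ 2 * (m.+1%:R * 'C(m, j)%:R) - M.+1%:R * 'C(m.+1, j)%:R
   + M.+1%:R * (j == 0%N)%:R - m.+1%:R * (j <= 1)%:R.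

Let binE i z : (1 + z) ^+ i = \sum_(j < i.+1) 'C(i, j)%:R * z ^+ j.
Proof.
by rewrite exprDn; apply: eq_bigr => j _; rewrite expr1n mul1r mulr_natl.
Qed.

Let phi_expand z : phi (1 + z) = \sum_(j < m.+2) phic j * z ^+ j.
Proof.
have E : \sum_(j < m.+2) phic j * z ^+ j =
  M.+1%:R ^+ 2 * m.+1%:R * (\sum_(j < m.+2) 'C(m, j)%:R * z ^+ j)
  - M.+1%:R * (\sum_(j < m.+2) 'C(m.+1, j)%:R * z ^+ j)
  + M.+1%:R * (\sum_(j < m.+2) (j == 0%N :> nat)%:R * z ^+ j)
  - m.+1%:R * (\sum_(j < m.+2) (j <= 1)%N%:R * z ^+ j).
  rewrite !mulr_sumr -!sumrN -!big_split/=; apply: eq_bigr => j _.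
  by rewrite /phic; ring.
rewrite E -binE big_ord_recr/= bin_small// mul0r addr0 -binE /phi.
rewrite !big_ord_recl/= !expr0 !expr1 !big1 ?addr0; try by move=> i _; rewrite /bump/= mul0r.
by rewrite mul0r addr0 !mul1r mulr1.
Qed.

Let phi_neg2 t : M = 0%N -> m = 1%N -> 1 < t -> phi t < 0.
Proof.
move=> M0 m1 t1; rewrite /phi M0 m1 (_ : _ - _ = (1 - t) * (1 + t)); last by ring.
by rewrite pmulr_llt0 ?subr_lt0// addr_gt0// (lt_trans _ t1).
Qed.

Section generic.
Hypothesis Mm : (0 < M)%N || (m != 1%N).

Let phic_ge0 j : (j < m.+1)%N -> 0 <= phic j.
Proof.
move=> jm; rewrite /phic; case: j jm => [|[|j]] jm.
- rewrite !bin0 !mulr1/= addrNK subr_ge0.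
  by rewrite ler_peMl// -natrX ler1n expn_gt0.
- rewrite mulr0 addr0 !bin1 mulr1.
  rewrite (_ : _ - _ = m.+1%:R * ((M.+1 ^ 2 * m)%N%:R - M.+2%:R)).
    by rewrite mulr_ge0// subr_ge0 ler_nat; move: Mm jm; nia.
  by rewrite natrM natrX -[M.+2]addn1 natrD; ring.
- rewrite mulr0 mulr0 addr0 subr0 -natrM mul_bin_down.
  rewrite subr_ge0 -natrX -!natrM ler_nat.
  by move: jm 'C(_, _) => + c; rewrite -subn_gt0; move: (_ - _)%N => i; nia.
Qed.

Lemma phi_neg1 t1 t2 : 1 < t1 -> t1 < t2 -> phi t1 < 0 -> phi t2 < 0.
Proof.
move=> t11 t12; have z10 : 0 < t1 - 1 by rewrite subr_gt0.
have z12 : t1 - 1 < t2 - 1 by rewrite ltrD2r.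
rewrite -(subrKC 1 t1) -(subrKC 1 t2) !phi_expand => s0.
have := @descartes m.+1 phic _ _ z10 z12 phic_ge0.
rewrite -(pmulr_rlt0 _ (exprn_gt0 m.+1 z10)) => /le_lt_trans; apply.
by rewrite pmulr_rlt0// exprn_gt0// (lt_trans z10).
Qed.
End generic.

(** Expanded at t = 1, all coefficients of [phi] below the top one are nonnegative,
except for q = 2 and p = 3, where phi t = 1 - t^2. *)
Lemma phi_neg t1 t2 : 1 < t1 -> t1 < t2 -> phi t1 < 0 -> phi t2 < 0.
Proof.
have [Mm|] := boolP ((0 < M)%N || (m != 1%N)); first exact: phi_neg1.
rewrite negb_or -leqNgt leqn0 negbK => /andP[/eqP M0 /eqP m1] t11 t12 _.
by apply: phi_neg2 => //; exact: lt_trans t12.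
Qed.
End sign_change.

Section curvature.
Variable R : realType.
Variables (m : nat) (beta : R) (n : nat).
Notation q := n.+2.
Notation p := m.+2.
Notation big := (@big R n).
Notation small := (@small R n).
Implicit Types s : R.
Hypothesis beta_gt0 : 0 < beta.

(** f'' has the sign of a constant multiple of this function minus 1, see
[ddf_profileE]. *)
Definition curvature_profile s := n.+1%:R * big s ^+ m.+1 * small s + big s * small s ^+ m.+1.

Lemma ddf_profileE s : 0 < big s -> 0 < small s ->
  q%:R ^+ 2 / n.+1%:R * (big s * small s) * potts_ddf p beta n s =
  beta * p%:R * m.+1%:R * curvature_profile s - 1.
Proof.
move=> b0 s0; rewrite /potts_ddf !k2E//= /curvature_profile -[X in _ = _ - X](big_small n s).
have -> : p%:R - 1 = m.+1%:R :> R by rewrite -addn1 natrD addrK.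
have Q0 : 0 < q%:R :> R by rewrite ltr0n.
have N0 : 0 < n.+1%:R :> R by rewrite ltr0n.
move: (big s) (small s) b0 s0 (q%:R : R) (n.+1%:R : R) Q0 N0 => x y x0 y0 Q N Q0 N0.
move: (p%:R : R) (m.+1%:R : R) => P M1.
rewrite !exprS.
field.
by rewrite !gt_eqF.
Qed.

Lemma der_curvature_profile s : 0 < big s -> 0 < small s ->
  der curvature_profile s (q%:R^-1 * small s ^+ m.+1 * phi n m (big s / small s)).
Proof.
move=> b0 s0.
have d1 := dM (dM (dcst n.+1%:R s) (dX m.+1 (der_big n s))) (der_small n s).
have d2 := dM (der_big n s) (dX m.+1 (der_small n s)).
apply: (der_eq (dD d1 d2)).
rewrite /phi /=; set t := big s / small s.
have -> : big s = t * small s by rewrite divfK ?gt_eqF.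
move: t (small s) => t y; rewrite !exprMn !exprS.
move: (y ^+ m) (t ^+ m) (n.+1%:R : R) (m.+1%:R : R) (q%:R^-1 : R) => Y T N M1 Q.
ring.
Qed.

Let ratio_lt s u : 0 <= s -> s < u -> u < 1 -> big s / small s < big u / small u.
Proof.
move=> s0 su u1.
rewrite ltr_pdivrMr ?small_gt0 ?(lt_trans su)// mulrAC ltr_pdivlMr ?small_gt0//.
have u0 := le_lt_trans s0 su.
have Q0 : 0 < q%:R^-1 :> R by rewrite invr_gt0.
apply: ltr_pM; rewrite ?(ltW (big_gt0 _ _)) ?(ltW (small_gt0 _ _))//.
  rewrite /big ltr_pM2r// ltrD2l ltr_pM2l// subr_gt0 ltr1n//.
by rewrite /small ltr_pM2r// ltrD2l ltrN2.
Qed.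

(** A drop of the profile below the level followed by a rise would give a point
where [phi] is negative before a point where it is positive. *)
Lemma ddf_sign_qconcave s1 s2 s3 : 0 <= s1 -> s1 < s2 -> s2 < s3 -> s3 < 1 ->
  0 < potts_ddf p beta n s1 -> 0 < potts_ddf p beta n s3 -> 0 <= potts_ddf p beta n s2.
Proof.
move=> s10 s12 s23 s31 f1 f3; rewrite leNgt; apply/negP => f2.
have s20 : 0 <= s2 by rewrite (le_trans s10)// ltW.
have s30 : 0 <= s3 by rewrite (le_trans s20)// ltW.
have s21 : s2 < 1 by exact: lt_trans s31.
have s11 : s1 < 1 by exact: lt_trans s21.
have c0 s : 0 <= s -> s < 1 -> 0 < q%:R ^+ 2 / n.+1%:R * (big s * small s).
  move=> ? ?; apply: mulr_gt0; last by apply: mulr_gt0; rewrite ?big_gt0 ?small_gt0.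
  by apply: divr_gt0 => //; exact: exprn_gt0.
have A0 : 0 < beta * p%:R * m.+1%:R by rewrite !mulr_gt0.
have g1 : 1 < beta * p%:R * m.+1%:R * curvature_profile s1.
  by rewrite -subr_gt0 -ddf_profileE ?big_gt0 ?small_gt0// mulr_gt0// c0.
have g3 : 1 < beta * p%:R * m.+1%:R * curvature_profile s3.
  by rewrite -subr_gt0 -ddf_profileE ?big_gt0 ?small_gt0// mulr_gt0// c0.
have g2 : beta * p%:R * m.+1%:R * curvature_profile s2 < 1.
  by rewrite -subr_lt0 -ddf_profileE ?big_gt0 ?small_gt0// pmulr_rlt0// c0.
have b12 : curvature_profile s2 < curvature_profile s1 by rewrite -(ltr_pM2l A0) (lt_trans g2).
have b23 : curvature_profile s2 < curvature_profile s3 by rewrite -(ltr_pM2l A0) (lt_trans g2).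
have db s : 0 <= s -> s < 1 -> der curvature_profile s (q%:R^-1 * small s ^+ m.+1 * phi n m (big s / small s)).
  by move=> ? ?; apply: der_curvature_profile; rewrite ?big_gt0 ?small_gt0.
have w0 s : s < 1 -> 0 < q%:R^-1 * small s ^+ m.+1.
  by move=> ?; rewrite mulr_gt0 ?invr_gt0// exprn_gt0// small_gt0.
have ds a b : 0 <= a -> b < 1 -> forall s, a <= s <= b ->
    der curvature_profile s (q%:R^-1 * small s ^+ m.+1 * phi n m (big s / small s)).
  move=> a0 b1 s /andP[? ?]; apply: db; first exact: le_trans a0 _.
  exact: le_lt_trans b1.
have [u /andP[u1 u2] E1] := mvt s12 (ds _ _ s10 s21).
have [v /andP[v1 v2] E2] := mvt s23 (ds _ _ s20 s31).
have uv : u < v by exact: lt_trans v1.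
have u0 : 0 < u by exact: le_lt_trans u1.
have v11 : v < 1 by exact: lt_trans s31.
have u11 : u < 1 by exact: lt_trans v11.
have p1 : phi n m (big u / small u) < 0.
  by rewrite -(pmulr_rlt0 _ (w0 _ u11)) -(@pmulr_llt0 _ (s2 - s1)) ?subr_gt0// -E1 subr_lt0.
have t1 : 1 < big u / small u.
  have := ratio_lt (lexx 0) u0 u11; rewrite {1}/big {1}/small mulr0 addr0 subr0 divff//.
have := phi_neg t1 (ratio_lt (ltW u0) uv v11) p1.
rewrite -(pmulr_rlt0 _ (w0 _ v11)) -(@pmulr_llt0 _ (s3 - s2)) ?subr_gt0// -E2 subr_lt0.
by rewrite ltNge ltW.
Qed.
End curvature.

(** * At most two maximizers of f *)
Section maximizer_count.
Variable R : realType.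
Variables (p : nat) (beta : R) (n : nat).
Notation q := n.+2.
Notation big := (@big R n).
Notation small := (@small R n).
Implicit Types s u : R.
Hypothesis p_ge2 : (2 <= p)%N.
Hypothesis beta_gt0 : 0 < beta.
Variable h : R.
Hypothesis h_ge0 : 0 <= h.
Hypothesis Qneg : forall m, H_maximizers p q beta h m ->
   forall t : q.-tuple R, \sum_(x <- t) x = 0 -> t <> [tuple 0 | _ < q] ->
   potts_Q p beta m t < 0.
Hypothesis max_ex : exists m, H_maximizers p q beta h m.
Notation Sf := (f_maximizers p q beta h).
Notation dF := (potts_df p beta n h).
Notation ddF := (potts_ddf p beta n).

Lemma f_max_df_eq0 s : Sf s -> dF s = 0.
Proof.
move=> smax; have [_ smax'] := (f_maxP p_ge2 beta_gt0 h_ge0 Qneg max_ex s).1 smax.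
have := max_lagrange p_ge2 beta_gt0 h_ge0 ord0 ord_max smax'.
rewrite !pvec_tnth/= /field_at/= addr0 => E.
by rewrite /potts_df E subrr mulr0.
Qed.

Lemma f_max_ddf_lt0 s : Sf s -> ddF s < 0.
Proof.
move=> smax; have [_ c0] := f_max_curv p_ge2 beta_gt0 h_ge0 Qneg max_ex smax.
rewrite /potts_ddf (_ : _ + _ = n.+1%:R * (n.+1%:R * k2 p beta (big s) + k2 p beta (small s))); last by ring.
by rewrite pmulr_llt0 ?invr_gt0 ?exprn_gt0// pmulr_rlt0.
Qed.

Lemma f_max01 s : Sf s -> 0 <= s /\ s < 1.
Proof. by move=> /(f_max_lt1 p_ge2 beta_gt0 h_ge0 Qneg max_ex)/andP. Qed.

(** Otherwise f' would be nonincreasing between its zeros a and b, hence zero, and f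
constant; but then all points in between would be maximizers, where f'' < 0. *)
Lemma convex_between a b : 0 <= a -> a < b -> dF a = 0 -> Sf b ->
  exists u, [/\ a < u, u < b & 0 < ddF u].
Proof.
move=> a0 ab f1a bmax; have [b0 b1] := f_max01 bmax; apply: contrapT => Nu.
have f2le u : a < u -> u < b -> ddF u <= 0.
  by move=> au ub; rewrite leNgt; apply/negP => f2u; apply: Nu; exists u.
have pos u : a <= u <= b -> 0 < big u /\ 0 < small u.
  by move=> /andP[au ub]; rewrite big_gt0 ?small_gt0 ?(le_trans a0)// (le_lt_trans ub).
have d1 u : a <= u <= b -> der dF u (ddF u).
  by move=> /pos[? ?]; exact: der_potts_df.
have d0 u : a <= u <= b -> der (potts_f p q beta h) u (dF u).
  by move=> /pos[? ?]; exact: der_potts_f.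
have f1b := f_max_df_eq0 bmax.
have noninc x y : a <= x -> x <= y -> y <= b -> dF y <= dF x.
  move=> ax xy yb; rewrite -lerN2.
  have D u : x <= u <= y -> der (fun z => - dF z) u (- ddF u).
    move=> /andP[xu uy]; apply: dN; apply: d1.
    by rewrite (le_trans ax xu) (le_trans uy yb).
  apply: (deriv_ge0_le xy D) => u /andP[xu uy].
  by rewrite oppr_ge0; apply: f2le; [exact: le_lt_trans xu|exact: lt_le_trans yb].
have f1E u : a <= u -> u <= b -> dF u = 0.
  move=> au ub; apply/eqP; rewrite eq_le; apply/andP; split.
    by have := noninc _ _ (lexx a) au ub; rewrite f1a.
  by have := noninc _ _ au ub (lexx b); rewrite f1b.
have [c /andP[ac cb]] := mvt ab d1.
rewrite f1a f1b subrr => /esym/eqP; rewrite mulf_eq0 [_ - _ == 0]subr_eq0 (gt_eqF ab) orbF => /eqP c0.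
suff cmax : Sf c by have := f_max_ddf_lt0 cmax; rewrite c0 ltxx.
split; first by rewrite (ltW (lt_trans cb b1)) (le_trans a0 (ltW ac)).
move=> v v01; apply: le_trans (bmax.2 _ v01) _.
have D x : c <= x <= b -> der (potts_f p q beta h) x (dF x).
  by move=> /andP[cx xb]; apply: d0; rewrite xb (le_trans (ltW ac)).
have [x /andP[cx xb] E] := mvt cb D.
rewrite -subr_le0 E f1E ?mul0r// ltW//; exact: lt_trans cx.
Qed.

(** By [convex_between] there are points with f'' > 0 on both sides of the maximizer
s1, where f'' < 0; this contradicts [ddf_sign_qconcave].  The point a need not be a
maximizer: for h = 0 it can be 0, which is always a zero of f'. *)
Lemma f_max_not_three a s1 s2 : 0 <= a -> a < s1 -> s1 < s2 -> dF a = 0 -> Sf s1 -> Sf s2 -> False.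
Proof.
move=> a0 as1 s12 fa m1 m2; have [s10 s11] := f_max01 m1; have [_ s21] := f_max01 m2.
have [u [au u1 fu]] := convex_between a0 as1 fa m1.
have [v [v1 v2 fv]] := convex_between s10 s12 (f_max_df_eq0 m1) m2.
have := f_max_ddf_lt0 m1; rewrite ltNge => /negP; apply.
have [m pE] : exists m, p = m.+2 by case: (p) p_ge2 => [|[|m]]// _; exists m.
move: fu fv; rewrite pE => fu fv; apply: ddf_sign_qconcave fu fv => //.
  exact: le_trans (ltW au).
exact: lt_trans s21.
Qed.

Lemma f_max_gt0 s : 0 < h -> Sf s -> 0 < s.
Proof.
move=> h0 smax; have [s0 _] := f_max01 smax; rewrite lt0r s0 andbT; apply/eqP => sE.
have := f_max_df_eq0 smax; rewrite sE /potts_df /big /small mulr0 addr0 subr0 addrAC subrr add0r.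
by apply/eqP; rewrite gt_eqF// mulr_gt0.
Qed.

Lemma df_at0 : h = 0 -> dF 0 = 0.
Proof. by move=> ->; rewrite /potts_df /big /small mulr0 addr0 subr0 addr0 subrr mulr0. Qed.

Lemma f_max_pair s s' : Sf s -> Sf s' -> s <> s' ->
  exists s1 s2, [/\ 0 <= s1, s1 < s2, Sf = [set s1; s2], h = 0 -> s1 = 0 & 0 < h -> 0 < s1].
Proof.
wlog ss' : s s' / s < s'.
  move=> W m m' ne; have [?|?|//] := ltgtP s s'; first exact: (W s s').
  by apply: (W s' s) => // /esym.
move=> m1 m2 _; exists s, s'; have [s0 _] := f_max01 m1; split => //.
- apply/seteqP; split=> [u mu|u [->|->]]//=; apply: contrapT => /not_orP[us us'].
  have [su|us1|E] := ltgtP s u; last by apply: us.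
    have [u2|u2|E] := ltgtP u s'; last by apply: us'.
      exact: (f_max_not_three s0 su u2 (f_max_df_eq0 m1) mu m2).
    exact: (f_max_not_three s0 ss' u2 (f_max_df_eq0 m1) m2 mu).
  have [u0 _] := f_max01 mu; exact: (f_max_not_three u0 us1 ss' (f_max_df_eq0 mu) m1 m2).
- move=> h0; apply/eqP; rewrite eq_le s0 andbT leNgt; apply/negP => s1.
  exact: (f_max_not_three (lexx 0) s1 ss' (df_at0 h0) m1 m2).
- by move=> h0; exact: f_max_gt0 m1.
Qed.
End maximizer_count.

(** * The critical inverse temperature *)
Section critical_temperature.
Variable R : realType.
Variables (p : nat) (n : nat).
Notation q := n.+2.
Notation big := (@big R n).
Notation small := (@small R n).
Notation f b := (potts_f p q b 0).
Notation Sf b := (f_maximizers p q b 0).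
Implicit Types s u beta : R.
Hypothesis p_ge2 : (2 <= p)%N.

(** The coefficient of beta in f. *)
Definition power_sum u : R := big u ^+ p + n.+1%:R * small u ^+ p.

Lemma potts_f_shift beta beta' u : f beta' u = f beta u - (beta - beta') * power_sum u.
Proof. by rewrite !potts_fE /power_sum /potts_k; ring. Qed.

(** f(s) - f(0) is thus strictly increasing in beta. *)
Lemma power_sum_gt u : 0 < u -> u <= 1 -> power_sum 0 < power_sum u.
Proof.
move=> u0 u1.
have D v : 0 <= v <= u -> der power_sum v (n.+1%:R / q%:R * p%:R * (big v ^+ p.-1 - small v ^+ p.-1)).
  move=> _.
  have d := dD (dX p (der_big n v)) (dM (dcst n.+1%:R v) (dX p (der_small n v))).
  by apply: (der_eq d); rewrite /=; ring.
apply: (deriv_gt0_lt u0 D) => v /andP[v0 vu].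
rewrite mulr_gt0// ?mulr_gt0 ?invr_gt0 ?ltr0n// ?(ltnW p_ge2)// subr_gt0.
have s0 := small_gt0 n (lt_le_trans vu u1).
have p1 : (0 < p.-1)%N by case: (p) p_ge2 => [|[]].
rewrite ltrXn2r ?nnegrE ?(ltW s0)// -?lt0n//.
rewrite /big /small ltr_pM2r ?invr_gt0// ltrD2l (@lt_trans _ _ 0)// ?oppr_lt0//.
by rewrite mulr_gt0// subr_gt0 ltr1n.
Qed.

Lemma power_sum_le1 u : 0 <= u <= 1 -> power_sum u <= 1.
Proof.
move=> /andP[u0 u1]; rewrite /power_sum -[leRHS](big_small n u).
have b0 := ltW (big_gt0 n u0).
have s0 : 0 <= small u by rewrite /small divr_ge0// subr_ge0.
have E := big_small n u.
have b1 : big u <= 1 by rewrite -[leRHS]E lerDl mulr_ge0.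
have s1 : small u <= 1.
  apply: le_trans b1; exact: small_le_big.
have p0 : (0 < p)%N by exact: ltnW.
apply: lerD; first by rewrite ler_iXnr.
by apply: ler_wpM2l => //; rewrite ler_iXnr.
Qed.

Lemma power_sum_ge0 u : 0 <= u <= 1 -> 0 <= power_sum u.
Proof.
move=> /andP[u0 u1]; rewrite /power_sum addr_ge0 ?mulr_ge0// exprn_ge0 ?(ltW (big_gt0 n u0))//.
by rewrite /small divr_ge0// subr_ge0.
Qed.

(** For a smaller beta', passing from beta to beta' costs every s > 0 strictly more
than it costs 0, so 0 becomes the only maximizer. *)
Lemma beta_c_of_pair beta s : 0 <= beta -> Sf beta 0 -> 0 < s -> Sf beta s ->
  beta_c R p q = beta.
Proof.
move=> b0 m0 s0 ms; rewrite /beta_c; set B := (X in inf X).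
have Bb : B beta by split => //; exists s.
have lb : lbound B beta.
  move=> b' [b'0 [u [u0 mu]]]; rewrite leNgt; apply/negP => bb.
  have := mu.2 0; rewrite lexx ler01 => /(_ isT).
  have u01 := mu.1; have /andP[_ u1] := u01.
  rewrite !(potts_f_shift beta b') leNgt => /negP; apply.
  apply: (@le_lt_trans _ _ (f beta 0 - (beta - b') * power_sum u)).
    by rewrite lerD2r m0.2.
  by rewrite ltrD2l ltrN2 ltr_pM2l ?subr_gt0// power_sum_gt.
apply/eqP; rewrite eq_le; apply/andP; split.
  by apply: ge_inf => //; exists beta.
by apply: lb_le_inf => //; exists beta.
Qed.

Lemma continuous_potts_f beta : continuous (f beta).
Proof.
move=> u; have -> : f beta = fun u => potts_k p beta (big u) + n.+1%:R * potts_k p beta (small u).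
  by apply/funext => v; rewrite potts_fE mul0r addr0.
apply: cvgD.
  by apply: continuous_comp; [exact: continuous_big|exact: continuous_potts_k].
apply: cvgM; first exact: cvg_cst.
by apply: continuous_comp; [exact: continuous_small|exact: continuous_potts_k].
Qed.

(** For beta slightly below beta_c no positive point is a maximizer, hence 0 is one;
a positive gap f(u) - f(0) at beta_c would persist there. *)
Lemma zero_max_at_beta_c : 0 < beta_c R p q -> Sf (beta_c R p q) 0.
Proof.
set b := beta_c _ _ _ => b0; split; first by rewrite lexx ler01.
move=> u u01; rewrite leNgt; apply/negP => d0.
set d := f b u - f b 0; have {}d0 : 0 < d by rewrite subr_gt0.
set e := Num.min (b / 2) (d / 2).
have e0 : 0 < e by rewrite lt_min !divr_gt0.
have eb : e <= b / 2 by rewrite ge_min lexx.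
have ed : e <= d / 2 by rewrite ge_min lexx orbT.
have [c] := @EVT_max R (f (b - e)) 0 1 ler01 (continuous_subspaceT (@continuous_potts_f _)).
rewrite in_itv/= => c01 cmax.
have cm : Sf (b - e) c by split => // v v01; apply: cmax; rewrite in_itv.
have /andP[c0 c1] := c01.
have [c00|c00] := ltP 0 c.
  suff : b <= b - e by lra.
  by apply: ge_inf; [exists 0 => ? []|split; [lra|exists c]].
have cE : c = 0 by apply/eqP; rewrite eq_le c00.
have := cm.2 u u01; rewrite cE !(potts_f_shift b (b - e)) subKr.
have P1 : power_sum u <= 1 := power_sum_le1 u01.
have P0 : 0 <= power_sum 0 by apply: power_sum_ge0; rewrite lexx ler01.
have : e * power_sum u <= e by rewrite ger_pMr.
have : 0 <= e * power_sum 0 by rewrite mulr_ge0// ltW.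
by move: ed d0; rewrite /d; lra.
Qed.
End critical_temperature.

(** * Distribution functions of half-normal mixtures *)
Section normal_cdf.
Variable R : realType.
Implicit Types (a v w x y s : R).
Notation mu := (@lebesgue_measure R).

Lemma normal_pdf_even s x : s != 0 -> normal_pdf 0 s (- x) = normal_pdf 0 s x.
Proof. by move=> s0; rewrite !normal_pdfE// /normal_fun !subr0 sqrrN. Qed.

Let measurable_pdf s (D : set R) : measurable_fun D (EFin \o normal_pdf 0 s).
Proof. by apply/measurable_EFinP; apply: measurable_funTS; exact: measurable_normal_pdf. Qed.

Lemma normal_prob_sym s x : s != 0 ->
  normal_prob 0 s `]-oo, - x] = normal_prob 0 s `[x, +oo[.
Proof.
move=> s0; rewrite /normal_prob ge0_integration_by_substitutionNy.
- by apply: eq_integral => u _; rewrite /= normal_pdf_even.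
- by apply: continuous_subspaceT; exact: continuous_normal_pdf.
- by move=> u _; exact: normal_pdf_ge0.
Qed.

Lemma normal_prob_Nyo s x : normal_prob 0 s `]-oo, x[ = normal_prob 0 s `]-oo, x].
Proof. by apply: integral_itv_bndo_bndc; exact: measurable_pdf. Qed.

Lemma normal_prob_oy s x : normal_prob 0 s `]x, +oo[ = normal_prob 0 s `[x, +oo[.
Proof. by apply: integral_itv_obnd_cbnd; exact: measurable_pdf. Qed.

(** The change of variables u |-> a u exchanges the standard deviations sqrt a and
1 / sqrt a. *)
Lemma normal_prob_scale a x : 0 < a ->
  normal_prob 0 (Num.sqrt a) `]-oo, x] = normal_prob 0 (Num.sqrt a)^-1 `]-oo, x / a].
Proof.
move=> a0; rewrite /normal_prob.
have dF : ((fun u : R => a * u)^`())%classic = cst a.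
  by apply/funext => u; rewrite derive1E; have [] := dM (dcst a u) (did u); rewrite mulr1 mulr0 addr0.
have cF : continuous (fun u : R => a * u).
  by move=> u; apply: cvgM; [exact: cvg_cst|exact: cvg_id].
have s0 : Num.sqrt a != 0 by rewrite gt_eqF// sqrtr_gt0.
have xE : x = a * (x / a) by rewrite mulrCA divff ?mulr1// gt_eqF.
rewrite [in LHS]xE.
rewrite increasing_ge0_integration_by_substitutionNy.
- apply: eq_integral => u _; congr EFin; rewrite dF !fctE.
  have E : Num.sqrt a = (Num.sqrt a^-1)^-1 by rewrite sqrtrV ?invrK// ltW.
  rewrite normal_pdf_gauss// [in LHS]E normal_pdf_gauss ?invr_gt0// /gauss !subr0.
  rewrite (_ : - (a^-1 / 2) * (a * u) ^+ 2 = - (a / 2) * u ^+ 2); last first.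
    by field; rewrite gt_eqF.
  rewrite mulrAC; congr (_ * _).
  have pi2 : 0 < 2 * pi :> R by rewrite mulr_gt0// pi_gt0.
  move: (2 * pi) pi2 => P P0.
  rewrite invrK !sqrtrM ?(ltW P0)// sqrtrV ?(ltW a0)//.
  rewrite -[X in _ * X](sqr_sqrtr (ltW a0)).
  have r0 : 0 < Num.sqrt P by rewrite sqrtr_gt0.
  have r1 : 0 < Num.sqrt a by rewrite sqrtr_gt0.
  by field; rewrite !gt_eqF.
- by move=> y z _ _; rewrite ltr_pM2l.
- by rewrite dF => u _; exact: cst_continuous.
- by rewrite dF; exact: is_cvg_cst.
- by rewrite dF; exact: cvg_cst.
- split; last by apply: cvg_at_left_filter; exact: cF.
  by move=> u _; have [] := dM (dcst a u) (did u).
- by apply: gt0_cvgMrNy => //; exact: cvg_id.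
- by apply: continuous_subspaceT; exact: continuous_normal_pdf.
- by move=> u _; exact: normal_pdf_ge0.
Qed.

Lemma normal_prob_Phi a x : 0 < a -> normal_prob 0 (Num.sqrt a) `]-oo, x] = (Phi a x)%:E.
Proof.
move=> a0; rewrite normal_prob_scale// /Phi fineK//.
exact: (fin_num_measure (normal_prob 0 (Num.sqrt a)^-1)).
Qed.

Lemma normal_prob_tail a x : 0 < a -> normal_prob 0 (Num.sqrt a) `]x, +oo[ = (1 - Phi a x)%:E.
Proof.
move=> a0; rewrite EFinB -normal_prob_Phi// -setCitvl.
exact: (probability_setC (normal_prob 0 (Num.sqrt a))).
Qed.

Lemma Phi_opp a x : 0 < a -> Phi a (- x) = 1 - Phi a x.
Proof.
move=> a0; apply: EFin_inj; rewrite -normal_prob_Phi// -normal_prob_tail//.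
by rewrite normal_prob_sym ?normal_prob_oy// gt_eqF// sqrtr_gt0.
Qed.

Lemma normal_probU s (A B : set R) : measurable A -> measurable B -> A `&` B = set0 ->
  normal_prob 0 s (A `|` B) = (normal_prob 0 s A + normal_prob 0 s B)%E.
Proof. exact: (measureU (normal_prob 0 s)). Qed.

Lemma normal_probC s (A : set R) : measurable A ->
  normal_prob 0 s (~` A) = (1 - normal_prob 0 s A)%E.
Proof. exact: (probability_setC (normal_prob 0 s)). Qed.

Lemma normal_prob_two_tails a x : 0 < a -> 0 <= x ->
  normal_prob 0 (Num.sqrt a) (`]-oo, - x[ `|` `]x, +oo[) = (2 * Phi a (- x))%:E.
Proof.
move=> a0 x0; rewrite normal_probU//; last first.
  apply/seteqP; split => // u; rewrite /= !in_itv/= andbT => -[ux xu].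
  have := lt_trans xu ux; lra.
rewrite normal_prob_Nyo normal_prob_Phi// normal_prob_tail// -Phi_opp// -EFinD.
by congr EFin; ring.
Qed.

Lemma half_normal_neg_lt0 a x : 0 < a -> x < 0 ->
  half_normal_neg a `]-oo, x] = (2 * Phi a x)%:E.
Proof.
move=> a0 x0; rewrite /half_normal_neg /pushforward.
rewrite (_ : _ @^-1` _ = `]-oo, x] `|` `[- x, +oo[); last first.
  apply/seteqP; split => u; rewrite /= !in_itv/= andbT [- `|u| <= x]lerNl ler_normr lerN2.
    by case/orP; [right|left].
  by case=> ->; rewrite ?orbT.
rewrite normal_probU//; last first.
  apply/seteqP; split => // u; rewrite /= !in_itv/= andbT => -[ux xu].
  have := le_trans xu ux; lra.
rewrite -normal_prob_sym ?gt_eqF ?sqrtr_gt0// opprK normal_prob_Phi// -EFinD.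
by congr EFin; ring.
Qed.

Lemma half_normal_neg_ge0 a x : 0 < a -> 0 <= x -> half_normal_neg a `]-oo, x] = 1%E.
Proof.
move=> a0 x0; rewrite /half_normal_neg /pushforward.
rewrite (_ : _ @^-1` _ = setT); first exact: (probability_setT (normal_prob 0 (Num.sqrt a))).
apply/seteqP; split => // u _; rewrite /= in_itv/= (le_trans _ x0)// oppr_le0//.
Qed.

Lemma half_normal_pos_lt0 a x : 0 < a -> x < 0 -> half_normal_pos a `]-oo, x] = 0%E.
Proof.
move=> a0 x0; rewrite /half_normal_pos /pushforward.
rewrite (_ : _ @^-1` _ = set0); first exact: (measure0 (normal_prob 0 (Num.sqrt a))).
apply/seteqP; split => // u; rewrite /= in_itv/= => ux.
by have := le_lt_trans ux x0; rewrite normr_lt0.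
Qed.

Lemma half_normal_pos_ge0 a x : 0 < a -> 0 <= x ->
  half_normal_pos a `]-oo, x] = (2 * Phi a x - 1)%:E.
Proof.
move=> a0 x0; rewrite /half_normal_pos /pushforward.
rewrite (_ : _ @^-1` _ = ~` (`]-oo, - x[ `|` `]x, +oo[)).
  rewrite normal_probC; last exact: measurableU.
  rewrite normal_prob_two_tails// Phi_opp// -EFinB; congr EFin; ring.
apply/seteqP; split => u; rewrite /= !in_itv/= andbT ler_norml.
  by move=> /andP[h1 h2] [|]; rewrite ltNge ?h1 ?h2.
by move=> /not_orP[/negP]; rewrite -leNgt => -> /negP; rewrite -leNgt.
Qed.

Lemma Phi_le_half a x : 0 < a -> 0 <= x -> 2 * Phi a (- x) <= 1.
Proof.
move=> a0 x0; rewrite -lee_fin -normal_prob_two_tails//.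
by apply: (probability_le1 (normal_prob 0 (Num.sqrt a))); exact: measurableU.
Qed.

Section mixture_cdf.
Variables (a v b w c : R).
Hypotheses (v0 : 0 < v) (w0 : 0 < w).
Notation F := (fun x : R => fine (mixture a v b w c `]-oo, x])).

Lemma mixture_cdf_pos x : 0 <= x -> F x = a + b * (2 * Phi w x - 1) + c.
Proof.
move=> x0; rewrite /mixture half_normal_neg_ge0 ?half_normal_pos_ge0//.
have M : (0 : R) \in (`]-oo, x]%classic : set R) by rewrite inE/= in_itv.
by rewrite diracE M/= !mulr1.
Qed.

Lemma mixture_cdf_neg x : x < 0 -> F x = a * (2 * Phi v x).
Proof.
move=> x0; rewrite /mixture half_normal_neg_lt0 ?half_normal_pos_lt0//.
have M : ((0 : R) \in (`]-oo, x]%classic : set R)) = false.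
  by apply: memNset; rewrite /= in_itv/= leNgt x0.
by rewrite diracE M/= !mulr0 !addr0.
Qed.
End mixture_cdf.

(** The atom at 0 makes the distribution function jump there, so 0 is not a
continuity point. *)
Lemma mixture_cdf_jump a v b w c : 0 < v -> 0 < w -> 0 <= a -> 0 <= b -> 0 < c ->
  ~ {for 0, continuous (fun x : R => fine (mixture a v b w c `]-oo, x]))}.
Proof.
move=> v0 w0 a0 b0 c0 /cvgrPdist_lt /(_ c c0).
move=> /nbhs_ballP[d /= d0 /(_ (- (d / 2)))]; have d20 : 0 < d / 2 by rewrite divr_gt0.
rewrite /ball/= sub0r opprK gtr0_norm// => /(_ _)/wrap[]; first by lra.
rewrite mixture_cdf_pos// mixture_cdf_neg ?oppr_lt0//.
have P0 : 2 * Phi w 0 - 1 = 0 by have := Phi_opp 0 w0; rewrite oppr0; lra.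
rewrite P0 mulr0 addr0.
have : a * (2 * Phi v (- (d / 2))) <= a by rewrite ler_piMr// Phi_le_half// ltW.
set y := a * _ => ya; rewrite gtr0_norm; lra.
Qed.
End normal_cdf.

(** * From the limit of the distribution functions to the law *)
Section law.
Variable R : realType.
Variables (p : nat) (beta : R) (n : nat).
Notation q := n.+2.
Notation big := (@big R n).
Notation small := (@small R n).
Notation k2 := (k2 p beta).
Notation curv := (curv p beta n).
Notation prec_of := (prec_of p beta).
Implicit Types (s x : R) (m : q.-tuple R).
Hypothesis p_ge2 : (2 <= p)%N.
Hypothesis beta_gt0 : 0 < beta.
Variable h : R.
Hypothesis h_ge0 : 0 <= h.
Hypothesis Qneg : forall m, H_maximizers p q beta h m ->
   forall t : q.-tuple R, \sum_(x <- t) x = 0 -> t <> [tuple 0 | _ < q] ->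
   potts_Q p beta m t < 0.
Hypothesis max_ex : exists m, H_maximizers p q beta h m.
Notation Sf := (f_maximizers p q beta h).
Notation tau := (tau p beta h).

(** The precision as a function of the maximizer alone: for s > 0 the place of the
distinguished coordinate is first iff the first coordinate is the large one. *)
Definition prec_at m : R :=
  if first m == big (s_of m) then prec_of (ord0 : 'I_q) (s_of m)
  else prec_of (ord_max : 'I_q) (s_of m).

Lemma small_lt_big s : 0 < s -> small s < big s.
Proof.
move=> s0; rewrite /big /small ltr_pM2r ?invr_gt0// ltrD2l (@lt_trans _ _ 0)// ?oppr_lt0//.
by rewrite mulr_gt0// subr_gt0 ltr1n.
Qed.

Lemma first_pvec (j : 'I_q) s : first (pvec j s) = if j == ord0 then big s else small s.
Proof. by rewrite /first pvec_tnth eq_sym. Qed.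

Let Sf01 s : Sf s -> 0 <= s < 1.
Proof. exact: f_max_lt1. Qed.

Let Sf_k2 s : Sf s -> 0 < - k2 (small s).
Proof. by move=> /(f_max_curv p_ge2 beta_gt0 h_ge0 Qneg max_ex)[]; rewrite oppr_gt0. Qed.

Lemma Sf_curv s : Sf s -> 0 < curv s.
Proof.
move=> /(f_max_curv p_ge2 beta_gt0 h_ge0 Qneg max_ex)[_ c0].
by rewrite /curv mulrN -opprD oppr_gt0 addrC.
Qed.

Lemma prec_at_pvec (j : 'I_q) s : Sf s -> (j != ord0 -> 0 < s) -> prec_at (pvec j s) = prec_of j s.
Proof.
move=> smax js; rewrite /prec_at s_of_pvec ?Sf01// first_pvec.
have [->|j0] := eqVneq j ord0; first by rewrite eqxx.
by rewrite lt_eqF ?small_lt_big ?js// /prec_of (negbTE j0).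
Qed.

Lemma prec_of_gt0 (j : 'I_q) s : Sf s -> 0 < prec_of j s.
Proof.
move=> smax; have b0 := Sf_k2 smax; have D0 := Sf_curv smax; rewrite /prec_of.
case: ifP => _; last by rewrite divr_gt0 ?mulr_gt0// curv_part.
rewrite (_ : _ + _ = curv s / n.+1%:R) ?divr_gt0//.
have N0 : n.+1%:R != 0 :> R by rewrite pnatr_eq0.
by rewrite /curv mulrDl addrC; congr (_ + _); rewrite mulrC mulKf.
Qed.

(** For s = 0 all the [pvec j s] coincide, and the first place can be chosen. *)
Lemma max_rep m : H_maximizers p q beta h m -> exists j s,
  [/\ Sf s, m = pvec j s, (j != ord0 -> 0 < s) & (j != ord0 -> h = 0)].
Proof.
move=> /(H_maxP p_ge2 beta_gt0 h_ge0 Qneg max_ex)[j [s [smax -> jh]]].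
have [s0|s0] := ltP 0 s.
  exists j, s; split=> // j0; apply/eqP; rewrite eq_le h_ge0 andbT leNgt; apply/negP => /jh jE.
  by rewrite jE eqxx in j0.
exists ord0, s; split => //; rewrite ?eqxx//.
have /andP[s0' _] := Sf01 smax; have -> : s = 0 by apply/eqP; rewrite eq_le s0.
apply: eq_from_tnth => r; rewrite !pvec_tnth /big /small mulr0 subr0 addr0.
by case: ifP; case: ifP.
Qed.

Lemma tau_gt0 m : H_maximizers p q beta h m -> 0 < tau m.
Proof.
move=> /max_rep[j [s [smax -> _ _]]].
have /andP[s0 s1] := Sf01 smax.
have := mass_gt0 (@ltr01 R) (big_gt0 n s0) (small_gt0 n s1) (Sf_k2 smax) (Sf_curv smax).
rewrite (mass_tau p_ge2 h j (@ltr01 R) (Sf01 smax) (Sf_k2 smax) (Sf_curv smax)).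
by rewrite pmulr_rgt0// kappa_gt0.
Qed.

Section split.
Variables (L mid U : seq (q.-tuple R)) (mu1 mu2 v w : R).
Let ms := L ++ mid ++ U.
Hypothesis ms_uniq : uniq ms.
Hypothesis msP : forall m, m \in ms <-> H_maximizers p q beta h m.
Hypothesis LP : forall m, m \in L -> first m = mu1 /\ prec_at m = v.
Hypothesis UP : forall m, m \in U -> first m = mu2 /\ prec_at m = w.
Hypothesis midP : forall m, m \in mid -> mu1 < first m < mu2.
Hypothesis mu12 : mu1 < mu2.
Hypothesis L_ex : exists m, m \in L.
Hypothesis U_ex : exists m, m \in U.
Hypothesis v_gt0 : 0 < v.
Hypothesis w_gt0 : 0 < w.
Let TL := \sum_(m <- L) tau m.
Let T0 := \sum_(m <- mid) tau m.
Let TU := \sum_(m <- U) tau m.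
Let S := TL + T0 + TU.

Let in_ms m : m \in ms -> [\/ m \in L, m \in mid | m \in U].
Proof.
by rewrite !mem_cat => /or3P[]; [constructor 1|constructor 2|constructor 3].
Qed.

Let cdf mu a x : x != 0 -> (exists2 m, m \in ms & first m = mu) ->
  (forall m, m \in ms -> first m = mu \/ x * (first m - mu) < 0) ->
  (forall m, m \in ms -> first m = mu -> prec_at m = a) ->
  \sum_(X : {ffun 'I_N -> 'I_q} | ((Num.sqrt (N%:R : R))%:E * (mle p beta X - h%:E) <= x%:E)%E)
     gibbs p beta h X @[N --> \oo] -->
  (\sum_(m <- ms) (if first m == mu then tau m * Phi a x else if first m < mu then tau m else 0)) / S.
Proof.
move=> x0 mu_ex mu_extr mu_al.
have [C C0 [sC Cs]] := stirling_ratio_cvg R.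
have [m0 m0max] := max_ex.
have K0 := kappa_gt0 n C0.
have T := @mle_cdf_cvg R p beta n h (potts_H p beta h m0) ms prec_at (fun m => kappa n C * tau m)
  ms_uniq msP _ _ mu a x x0 mu_ex mu_extr mu_al _.
have E : (\sum_(m <- ms) (if first m == mu then tau m * Phi a x else if first m < mu then tau m else 0)) / S =
  (\sum_(m <- ms) (if first m == mu then kappa n C * tau m * Phi a x else
                   if first m < mu then kappa n C * tau m else 0)) / \sum_(m <- ms) kappa n C * tau m.
  rewrite -mulr_sumr (_ : \sum_(m <- ms) tau m = S); last by rewrite !big_cat/= addrA.
  rewrite [in RHS](eq_bigr (fun m => kappa n C * (if first m == mu then tau m * Phi a x
                             else if first m < mu then tau m else 0))); last first.
    move=> m _; case: (first m == mu); first by rewrite mulrA.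
    by case: (first m < mu); rewrite ?mulr0.
  by rewrite -mulr_sumr -mulf_div divff ?mul1r// gt_eqF.
rewrite E; apply: T.
- move=> m /msP mmax; apply/eqP; rewrite eq_le m0max.2 ?mmax.2//; first by case: m0max.
  by case: mmax.
- move=> m /msP/[dup] mmax /max_rep[j [s [smax mE js jh]]]; rewrite mE prec_at_pvec//.
  have /andP[s0 s1] := Sf01 smax.
  rewrite -(mass_tau p_ge2 h j C0 (Sf01 smax) (Sf_k2 smax) (Sf_curv smax)).
  apply: pvec_loc_ok => //; rewrite ?big_gt0 ?small_gt0 ?Sf_k2 ?Sf_curv//.
  by move=> r r'; apply: max_lagrange => //; rewrite -mE.
- by move=> m /msP mmax; rewrite mulr_gt0// tau_gt0.
Qed.

Let tau_ms m : m \in ms -> 0 < tau m. Proof. by move=> /msP; exact: tau_gt0. Qed.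

Let T_ge0 (s : seq (q.-tuple R)) : {subset s <= ms} -> 0 <= \sum_(m <- s) tau m.
Proof. by move=> sm; rewrite big_seq; apply: sumr_ge0 => m /sm/tau_ms/ltW. Qed.

Let subL : {subset L <= ms}. Proof. by move=> m mL; rewrite mem_cat mL. Qed.
Let subm : {subset mid <= ms}. Proof. by move=> m mL; rewrite !mem_cat mL orbT. Qed.
Let subU : {subset U <= ms}. Proof. by move=> m mL; rewrite !mem_cat mL !orbT. Qed.

Let S_gt0 : 0 < S.
Proof.
rewrite /S ltr_wpDl ?addr_ge0 ?T_ge0//.
have [m mU] := U_ex; rewrite /TU (perm_big _ (perm_to_rem mU)) big_cons.
rewrite ltr_pwDl ?tau_ms ?subU//; apply: T_ge0 => m' /mem_rem; exact: subU.
Qed.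

Let first_ms m : m \in ms -> [\/ m \in L /\ first m = mu1, m \in mid /\ mu1 < first m < mu2 |
  m \in U /\ first m = mu2].
Proof.
by move=> /in_ms[ml|ml|ml]; [constructor 1; case: (LP ml)|constructor 2; rewrite midP
  |constructor 3; case: (UP ml)].
Qed.

Let cdf_pos x : 0 < x ->
  \sum_(X : {ffun 'I_N -> 'I_q} | ((Num.sqrt (N%:R : R))%:E * (mle p beta X - h%:E) <= x%:E)%E)
     gibbs p beta h X @[N --> \oo] --> (TL + T0 + TU * Phi w x) / S.
Proof.
move=> x0; have [m1 m1U] := U_ex.
have -> : TL + T0 + TU * Phi w x = \sum_(m <- ms) (if first m == mu2 then tau m * Phi w x
    else if first m < mu2 then tau m else 0).
  rewrite !big_cat/= addrA /TL /T0 /TU mulr_suml; congr (_ + _ + _).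
  - by apply: eq_big_seq => m /LP[-> _]; rewrite lt_eqF// mu12.
  - by apply: eq_big_seq => m /midP/andP[_ mm]; rewrite lt_eqF// mm.
  - by apply: eq_big_seq => m /UP[-> _]; rewrite eqxx.
apply: cdf; first by rewrite gt_eqF.
- by exists m1; [exact: subU|case: (UP m1U)].
- move=> m /first_ms[[_ ->]|[_ /andP[_ mm]]|[_ ->]]; [right|right|by left].
    by rewrite pmulr_rlt0// subr_lt0.
  by rewrite pmulr_rlt0// subr_lt0.
- move=> m /first_ms[[_ ->]|[_ /andP[_ mm]] E|[mU _] _]; last by case: (UP mU).
    by move=> E; move: mu12; rewrite E ltxx.
  by move: mm; rewrite E ltxx.
Qed.

Let cdf_neg x : x < 0 ->
  \sum_(X : {ffun 'I_N -> 'I_q} | ((Num.sqrt (N%:R : R))%:E * (mle p beta X - h%:E) <= x%:E)%E)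
     gibbs p beta h X @[N --> \oo] --> TL * Phi v x / S.
Proof.
move=> x0; have [m1 m1L] := L_ex.
have -> : TL * Phi v x = \sum_(m <- ms) (if first m == mu1 then tau m * Phi v x
    else if first m < mu1 then tau m else 0).
  rewrite !big_cat/= -[LHS]addr0 -[X in _ = _ + X]addr0 /TL mulr_suml.
  congr (_ + _).
    by apply: eq_big_seq => m /LP[-> _]; rewrite eqxx.
  rewrite addr0 !big_seq !big1 ?addr0// => m.
    by move=> /UP[-> _]; rewrite gt_eqF// ltNge ltW.
  by move=> /midP/andP[mm _]; rewrite gt_eqF// ltNge ltW.
apply: cdf; first by rewrite lt_eqF.
- by exists m1; [exact: subL|case: (LP m1L)].
- move=> m /first_ms[[_ ->]|[_ /andP[mm _]]|[_ ->]]; [by left|right|right].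
    by rewrite nmulr_rlt0// subr_gt0.
  by rewrite nmulr_rlt0// subr_gt0.
- move=> m /first_ms[[mL _] _|[_ /andP[mm _]] E|[_ ->] E]; first by case: (LP mL).
    by move: mm; rewrite E ltxx.
  by move: mu12; rewrite E ltxx.
Qed.

(** The maximizers split into those with smallest first coordinate L, those with
largest one U, and the rest.  For x < 0 only L matters, for x > 0 everything
below U lies in the event; this gives half of each extreme group to the atom. *)
Lemma law_of_split :
  mle_cvg_in_law p q beta h (mixture (TL / (2 * S)) v (TU / (2 * S)) w ((S + T0) / (2 * S))).
Proof.
have T00 : 0 <= T0 by exact: T_ge0 subm.
have TL0 : 0 <= TL by exact: T_ge0 subL.
have TU0 : 0 <= TU by exact: T_ge0 subU.
have S2 : 0 < 2 * S by rewrite mulr_gt0.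
have Sn : S != 0 by rewrite gt_eqF.
move=> x; have [->|] := eqVneq x 0.
  move=> /mixture_cdf_jump; case=> //; rewrite ?divr_ge0 ?(ltW S2)//.
  by rewrite divr_gt0// ltr_wpDr.
have [x0 _ _|x0 _ _|//] := ltgtP x 0.
  rewrite mixture_cdf_neg//.
  rewrite (_ : _ * _ = TL * Phi v x / S); last by field.
  exact: cdf_neg.
rewrite mixture_cdf_pos ?(ltW x0)//.
apply: cvg_limit_eq (cdf_pos x0) _.
by move: Sn; rewrite /S => Sn; field.
Qed.
End split.
End law.

(** * Listings of the maximizers and the three regimes *)
Section cases.
Variable R : realType.
Variables (p : nat) (beta : R) (n : nat).
Notation q := n.+2.
Notation big := (@big R n).
Notation small := (@small R n).
Notation k2 := (k2 p beta).
Notation prec_of := (prec_of p beta).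
Implicit Types (s x : R) (m : q.-tuple R) (ms : seq (q.-tuple R)).
Hypothesis p_ge2 : (2 <= p)%N.
Hypothesis beta_gt0 : 0 < beta.
Variable h : R.
Hypothesis h_ge0 : 0 <= h.
Hypothesis Qneg : forall m, H_maximizers p q beta h m ->
   forall t : q.-tuple R, \sum_(x <- t) x = 0 -> t <> [tuple 0 | _ < q] ->
   potts_Q p beta m t < 0.
Hypothesis max_ex : exists m, H_maximizers p q beta h m.
Notation Sf := (f_maximizers p q beta h).
Notation tau := (tau p beta h).
Notation lists := (lists_maximizers p beta h).
Notation weight := (weight p beta h).

Lemma firstE m : m`_0 = first m.
Proof. by rewrite /first (tnth_nth 0). Qed.

Lemma Sf_s01 s : Sf s -> 0 <= s < 1.
Proof. exact: f_max_lt1. Qed.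

Lemma big_lt s u : s < u -> big s < big u.
Proof. by move=> su; rewrite /big ltr_pM2r ?invr_gt0// ltrD2l ltr_pM2l// subr_gt0 ltr1n. Qed.

Lemma lists_perm ms ms0 : lists ms -> lists ms0 -> perm_eq ms ms0.
Proof.
move=> [u ms_P _] [u0 ms0_P _]; apply: uniq_perm => // m.
by apply/idP/idP => [/ms_P/ms0_P|/ms0_P/ms_P].
Qed.

(** A listing is only determined up to the order of maximizers with equal first
coordinates, but the sequence of first coordinates is unique. *)
Lemma lists_first ms ms0 : lists ms -> lists ms0 -> map (@first R n) ms = map (@first R n) ms0.
Proof.
move=> l l0; apply: (sorted_eq (leT := <=%R)) => //.
- exact: le_trans.
- exact: le_anti.
- rewrite sorted_map; case: l => _ _; congr sorted; apply/funext => u; apply/funext => v.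
  by rewrite /relpre/= !firstE.
- rewrite sorted_map; case: l0 => _ _; congr sorted; apply/funext => u; apply/funext => v.
  by rewrite /relpre/= !firstE.
- exact/perm_map/lists_perm.
Qed.

(** The weights do not depend on the listing, as tau only depends on the first
coordinate. *)
Lemma weightE ms ms0 (g : R -> R) i : lists ms -> lists ms0 ->
  (forall m, m \in ms0 -> tau m = g (first m)) -> weight ms i = weight ms0 i.
Proof.
move=> l l0 tg; rewrite /Defs.weight (perm_big _ (lists_perm l l0)); congr (_`_ _ / _).
have E (r : seq (q.-tuple R)) : {subset r <= ms0} -> map tau r = map g (map (@first R n) r).
  by move=> sm; rewrite -map_comp; apply/eq_in_map => m /sm/tg.
rewrite !E// ?(lists_first l l0)// => m.
by rewrite (perm_mem (lists_perm l l0)).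
Qed.

Lemma lists_of_f_maximizers (ss : seq R) : (forall s, s \in ss <-> Sf s) -> exists ms : seq (q.-tuple R), lists ms.
Proof.
move=> ssP.
pose c := [seq pvec j s | j <- if 0 < h then [:: ord0 : 'I_q] else enum 'I_q, s <- ss].
pose le1 := fun u v : q.-tuple R => u`_0 <= v`_0.
exists (sort le1 (undup c)); split.
- by rewrite sort_uniq undup_uniq.
- move=> m; rewrite mem_sort mem_undup; split.
    move=> /allpairsP[[j s] /= [jj /ssP smax ->]].
    apply/(H_maxP p_ge2 beta_gt0 h_ge0 Qneg max_ex); exists j, s; split => // h0.
    by move: jj; rewrite h0 inE => /eqP.
  move=> /(H_maxP p_ge2 beta_gt0 h_ge0 Qneg max_ex)[j [s [/ssP smax -> jh]]].
  apply: allpairs_f => //; case: ifP => h0; last by rewrite mem_enum.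
  by rewrite jh// inE.
- by apply: sort_sorted => u v; exact: le_total.
Qed.

Lemma lists_maximizers_ex : exists ms : seq (q.-tuple R), lists ms.
Proof.
have [[s [s' [ms ms' ne]]]|N] := pselect (exists s s', [/\ Sf s, Sf s' & s <> s']).
  have [s1 [s2 [_ _ E _ _]]] := f_max_pair p_ge2 beta_gt0 h_ge0 Qneg max_ex ms ms' ne.
  apply: (@lists_of_f_maximizers [:: s1; s2]) => u; rewrite E !inE; split.
    by case/orP => /eqP ->; [left|right].
  by case=> ->; rewrite eqxx ?orbT.
have [[s ms]|N1] := pselect (exists s, Sf s).
  apply: (@lists_of_f_maximizers [:: s]) => u; rewrite inE; split=> [/eqP->//|mu].
  by apply/eqP; apply: contrapT => us; apply: N; exists u, s.
apply: (@lists_of_f_maximizers [::]) => u; split => // mu; exfalso; apply: N1; by exists u.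
Qed.

(** The masses of permuted maximizers agree by construction, and tau is
proportional to the mass. *)
Lemma tau_pvec (j : 'I_q) s : Sf s -> tau (pvec j s) = tau (pvec (ord0 : 'I_q) s).
Proof.
move=> smax; have [b0 _] := f_max_curv p_ge2 beta_gt0 h_ge0 Qneg max_ex smax.
rewrite -oppr_gt0 in b0.
have c0 := Sf_curv p_ge2 beta_gt0 h_ge0 Qneg max_ex smax.
have K0 : kappa n (1 : R) != 0 by rewrite gt_eqF// kappa_gt0.
apply: (mulfI K0).
by rewrite -!(mass_tau p_ge2 h _ (@ltr01 R) (Sf_s01 smax) b0 c0).
Qed.

Let alE (j : 'I_q) s : Sf s -> (j != ord0 -> 0 < s) -> prec_at p beta (pvec j s) = prec_of j s.
Proof. exact: prec_at_pvec. Qed.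

Let al0 (j : 'I_q) s : Sf s -> 0 < prec_of j s.
Proof. exact: prec_of_gt0. Qed.

(** Each extreme group consists of one maximizer. *)
Lemma law_positive_field ms s1 s2 : 0 < h -> s1 < s2 -> Sf = [set s1; s2] -> lists ms ->
  mle_cvg_in_law p q beta h (mixture
    (weight ms 1 / 2) (prec_of (ord0 : 'I_q) s1)
    ((1 - weight ms 1) / 2) (prec_of (ord0 : 'I_q) s2) (1 / 2)).
Proof.
move=> h0 s12 SfE l.
have m1 : Sf s1 by rewrite SfE; left.
have m2 : Sf s2 by rewrite SfE; right.
pose u1 : q.-tuple R := pvec ord0 s1; pose u2 : q.-tuple R := pvec ord0 s2.
have b12 := big_lt s12.
have f1 : first u1 = big s1 by rewrite first_pvec eqxx.
have f2 : first u2 = big s2 by rewrite first_pvec eqxx.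
have U : uniq [:: u1; u2].
  by rewrite /= inE andbT; apply: contraTneq b12 => E; rewrite -f1 -f2 E ltxx.
have P m : m \in [:: u1; u2] <-> H_maximizers p q beta h m.
  rewrite !inE; split.
    by case/orP => /eqP ->; apply/(H_maxP p_ge2 beta_gt0 h_ge0 Qneg max_ex);
      [exists ord0, s1|exists ord0, s2].
  move=> /(H_maxP p_ge2 beta_gt0 h_ge0 Qneg max_ex)[j [s [+ -> jh]]].
  by rewrite (jh h0) SfE => -[->|->]; rewrite eqxx ?orbT.
have l0 : lists [:: u1; u2] by split => //; rewrite /sorted /path andbT !firstE f1 f2 ltW.
have T1 : 0 < tau u1 by apply: tau_gt0 => //; apply/P; rewrite inE eqxx.
have T2 : 0 < tau u2 by apply: tau_gt0 => //; apply/P; rewrite !inE eqxx orbT.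
have wE : weight ms 1 = tau u1 / (tau u1 + tau u2).
  rewrite (@weightE _ _ (fun r => if r == big s1 then tau u1 else tau u2) _ l l0).
    by rewrite /Defs.weight !big_cons big_nil addr0.
  move=> m; rewrite !inE => /orP[] /eqP ->; rewrite ?f1 ?f2 ?eqxx//.
  by rewrite gt_eqF.
have := @law_of_split R p beta n p_ge2 beta_gt0 h h_ge0 Qneg max_ex [:: u1] [::] [:: u2]
  (big s1) (big s2) (prec_of (ord0 : 'I_q) s1) (prec_of (ord0 : 'I_q) s2) U P _ _ _ b12 _ _ _ _.
rewrite !big_cons !big_nil !addr0 => /(_ _ _ _ _ _ _ _)/wrap[].
- by move=> m; rewrite inE => /eqP ->; rewrite f1 alE.
- by move=> m; rewrite inE => /eqP ->; rewrite f2 alE.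
- by [].
- by exists u1; rewrite inE.
- by exists u2; rewrite inE.
- exact: al0.
- exact: al0.
rewrite wE; set T := mixture _ _ _ _ _; set T' := mixture _ _ _ _ _.
suff -> : T = T' by [].
rewrite /T /T'; have S0 : tau u1 + tau u2 != 0 by rewrite gt_eqF// addr_gt0.
by congr mixture; field.
Qed.

(** Without field the maximizers are the q permutations of x_s, q - 1 of which have
the small first coordinate, and, if b holds, the uniform vector x_0, whose first
coordinate lies strictly in between. *)
Lemma law_zero_field ms s (b : bool) : h = 0 -> 0 < s ->
  (forall u, Sf u <-> u = s \/ (b /\ u = 0)) -> lists ms ->
  mle_cvg_in_law p q beta h (if b then mixture
      ((1 - weight ms q) * (q%:R - 1) / (2 * q%:R)) (prec_of (ord_max : 'I_q) s)
      ((1 - weight ms q) / (2 * q%:R)) (prec_of (ord0 : 'I_q) s) ((1 + weight ms q) / 2)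
    else mixture
      ((1 - weight ms q) / 2) (prec_of (ord_max : 'I_q) s)
      (weight ms q / 2) (prec_of (ord0 : 'I_q) s) (1 / 2)).
Proof.
move=> h0 s0 SfP l.
have ms_ : Sf s by apply/SfP; left.
pose u (i : 'I_n.+1) : q.-tuple R := pvec (lift ord0 i) s.
pose us : q.-tuple R := pvec ord0 s; pose x0 : q.-tuple R := pvec ord0 0.
pose L := [seq u i | i <- enum 'I_n.+1]; pose mid := if b then [:: x0] else [::].
have sb0 : small s < big 0.
  by rewrite /small /big mulr0 addr0 ltr_pM2r ?invr_gt0// ltrBlDr ltrDl.
have b0s : big 0 < big s by exact: big_lt.
have sbs := lt_trans sb0 b0s.
have fu m : m \in L -> first m = small s by move=> /mapP[i _ ->]; rewrite first_pvec.
have sL : size L = n.+1 by rewrite size_map size_enum_ord.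
have fus : first us = big s by rewrite first_pvec eqxx.
have fx0 : first x0 = big 0 by rewrite first_pvec eqxx.
have fmid m : m \in mid -> b /\ m = x0 by rewrite /mid; case: (b) => //; rewrite inE => /eqP.
have u_inj : injective u.
  move=> i j /(congr1 (fun t : q.-tuple R => tnth t (lift ord0 i))).
  rewrite !pvec_tnth eqxx; case: eqP => [/lift_inj//|_ E].
  by move: sbs; rewrite E ltxx.
pose ms0 := L ++ mid ++ [:: us].
have U : uniq ms0.
  rewrite /ms0 cat_uniq (map_inj_uniq u_inj) enum_uniq/=; apply/andP; split.
    apply/hasPn => m; rewrite mem_cat inE => /orP[/fmid[_ ->]|/eqP ->];
    by apply/negP => /fu; rewrite ?fx0 ?fus => E; move: sb0 sbs; rewrite -E ?ltxx// => _; rewrite ltxx.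
  rewrite cats1 rcons_uniq; apply/andP; split; last by rewrite /mid; case: (b).
  by apply/negP => /fmid[_ E]; move: b0s; rewrite -fx0 -fus E ltxx.
have P m : m \in ms0 <-> H_maximizers p q beta h m.
  rewrite !mem_cat inE; split.
    case/or3P => [/mapP[i _ ->]|/fmid[bt ->]|/eqP ->];
      apply/(H_maxP p_ge2 beta_gt0 h_ge0 Qneg max_ex).
    - by exists (lift ord0 i), s; split => //; rewrite h0 ltxx.
    - by exists ord0, 0; split => //; apply/SfP; right.
    - by exists ord0, s.
  move=> /(H_maxP p_ge2 beta_gt0 h_ge0 Qneg max_ex)[j [v [/SfP[->|[bt ->]] -> _]]].
    case: (unliftP ord0 j) => [i|] ->; last by rewrite eqxx !orbT.
    by rewrite (map_f u) ?mem_enum.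
  suff -> : pvec j 0 = x0 by rewrite /mid bt inE eqxx orbT.
  apply: eq_from_tnth => r; rewrite !pvec_tnth /big /small mulr0 subr0 addr0.
  by case: ifP; case: ifP.
have l0 : lists ms0.
  split => //; apply: pairwise_sorted; rewrite pairwise_cat; apply/and3P; split.
  - apply/allrelP => m m' mL; rewrite !firstE (fu _ mL) mem_cat inE.
    by case/orP => [/fmid[_ ->]|/eqP ->]; rewrite ?fx0 ?fus ltW.
  - apply/(pairwiseP us) => i j iL jL _; rewrite !firstE.
    by rewrite !fu ?mem_nth.
  - rewrite /mid; case: (b) => //; apply/andP; split => //; apply/andP; split => //.
    by rewrite !firstE fx0 fus ltW.
have T0 : 0 < tau us by apply: tau_gt0 => //; apply/P; rewrite !mem_cat inE eqxx !orbT.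
have TL : \sum_(m <- L) tau m = n.+1%:R * tau us.
  rewrite big_map big_enum/= (eq_bigr (fun=> tau us)) => [|i _]; last exact: tau_pvec.
  by rewrite sumr_const card_ord mulr_natl.
have wE : weight ms q = (if b then tau x0 else tau us) /
    (n.+1%:R * tau us + \sum_(m <- mid) tau m + tau us).
  rewrite (@weightE _ _ (fun r => if r == big 0 then tau x0 else tau us) _ l l0).
    rewrite /Defs.weight !big_cat/= TL big_seq1 addrA; congr (_ / _).
    rewrite map_cat nth_cat size_map sL ltnn subnn map_cat /mid.
    by case: (b).
  move=> m; rewrite !mem_cat inE => /or3P[mL|/fmid[_ ->]|/eqP ->].
  - by rewrite (fu _ mL) lt_eqF//; case/mapP: mL => i _ ->; exact: tau_pvec.
  - by rewrite fx0 eqxx.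
  - by rewrite fus gt_eqF.
have := @law_of_split R p beta n p_ge2 beta_gt0 h h_ge0 Qneg max_ex L mid [:: us]
  (small s) (big s) (prec_of (ord_max : 'I_q) s) (prec_of (ord0 : 'I_q) s) U P _ _ _ sbs _ _ _ _.
rewrite TL big_seq1 => /(_ _ _ _ _ _ _ _)/wrap[].
- move=> m mL; rewrite (fu _ mL); split => //.
  by case/mapP: mL => i _ ->; rewrite alE.
- by move=> m; rewrite inE => /eqP ->; rewrite fus alE.
- by move=> m /fmid[_ ->]; rewrite fx0 sb0 b0s.
- by exists (u ord0); apply: map_f; rewrite mem_enum.
- by exists us; rewrite inE.
- exact: al0.
- exact: al0.
have N0 : 0 < n.+1%:R :> R by rewrite ltr0n.
have qE : q%:R = n.+1%:R + 1 :> R by rewrite natr1.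
rewrite wE qE /mid; have [bt|_] := boolP b.
  rewrite /= big_seq1.
  have X0 : 0 < tau x0 by apply: tau_gt0 => //; apply/P; rewrite !mem_cat /mid bt !inE eqxx !orbT.
  move: (n.+1%:R : R) N0 (tau us) T0 (tau x0) X0 => N N0 T T0 X X0.
  set mu := mixture _ _ _ _ _; set mu' := mixture _ _ _ _ _.
  suff -> : mu = mu' by [].
  have ? : N + 1 != 0 by rewrite gt_eqF// addr_gt0.
  have ? : N * T + X + T != 0 by rewrite gt_eqF// !addr_gt0// mulr_gt0.
  by rewrite /mu /mu'; congr mixture; field => //; apply/andP.
rewrite /= big_nil addr0.
move: (n.+1%:R : R) N0 (tau us) T0 => N N0 T T0.
set mu := mixture _ _ _ _ _; set mu' := mixture _ _ _ _ _.
suff -> : mu = mu' by [].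
have ? : N * T + T != 0 by rewrite gt_eqF// !addr_gt0// mulr_gt0.
by rewrite /mu /mu'; congr mixture; field.
Qed.
End cases.

Theorem theorem3p5 (R : realType) (p q : nat) (beta h : R) :
  (2 <= p)%N -> (2 <= q)%N -> Theta (beta, h) -> critical p q beta h ->
  let qR : R := q%:R in
  let f2 := potts_f2 p q beta h in
  let Sf := f_maximizers p q beta h in
  (exists ms : seq (q.-tuple R), lists_maximizers p beta h ms) /\
  forall ms : seq (q.-tuple R), lists_maximizers p beta h ms ->
  let pw := weight p beta h ms in
  [/\ (strongly_critical p q beta h /\ (beta, h) <> (beta_c R p q, 0) ->
        exists s1 s2 : R, [/\ 0 < s1, s1 < s2, Sf = [set s1; s2]
        & mle_cvg_in_law p q beta h
            (mixture
               (pw 1%N / 2) (- (qR ^+ 2 / (qR - 1) ^+ 2) * f2 s1)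
               ((1 - pw 1%N) / 2) (- (qR ^+ 2 / (qR - 1) ^+ 2) * f2 s2)
               (1 / 2))]),
      (weakly_critical p q beta h ->
        exists s : R, [/\ 0 < s, Sf = [set s]
        & mle_cvg_in_law p q beta h
            (mixture
               ((1 - pw q) / 2)
               (- (qR ^+ 2 * f2 s / ((qR - 1) * (1 + (qR - 2) * rho p q beta s))))
               (pw q / 2) (- (qR ^+ 2 / (qR - 1) ^+ 2) * f2 s)
               (1 / 2))])
    & ((beta, h) = (beta_c R p q, 0) ->
        exists s : R, [/\ 0 < s, Sf = [set 0; s]
        & mle_cvg_in_law p q beta h
            (mixture
               ((1 - pw q) * (qR - 1) / (2 * qR))
               (- (qR ^+ 2 * f2 s / ((qR - 1) * (1 + (qR - 2) * rho p q beta s))))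
               ((1 - pw q) / (2 * qR)) (- (qR ^+ 2 / (qR - 1) ^+ 2) * f2 s)
               ((1 + pw q) / 2))])].
Proof.
case: q => [|[|n]]// p_ge2 _ [/= beta0 h0] crit.
have [[m1 [m2 [m1max m2max m12]]] Qneg] := crit.
have max_ex : exists m, H_maximizers p n.+2 beta h m by exists m1.
have HP := H_maxP p_ge2 beta0 h0 Qneg max_ex.
set qR : R := n.+2%:R; set Sf := f_maximizers p n.+2 beta h.
have S01 s : Sf s -> 0 <= s < 1 by exact: f_max_lt1.
have varF s : Sf s -> - (qR ^+ 2 / (qR - 1) ^+ 2) * potts_f2 p n.+2 beta h s =
    prec_of p beta (ord0 : 'I_n.+2) s.
  by move=> /S01 s01; exact: var_firstE.
have varO s : Sf s -> - (qR ^+ 2 * potts_f2 p n.+2 beta h s /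
    ((qR - 1) * (1 + (qR - 2) * rho p n.+2 beta s))) = prec_of p beta (ord_max : 'I_n.+2) s.
  move=> sm; have [b0 _] := f_max_curv p_ge2 beta0 h0 Qneg max_ex sm.
  apply: var_otherE; rewrite ?S01 ?oppr_gt0//.
  exact: (Sf_curv p_ge2 beta0 h0 Qneg max_ex).
have hE : h = 0 \/ 0 < h.
  by move: h0; rewrite le_eqVlt => /orP[/eqP|]; [left|right].
have uniq_zero s : (forall u, Sf u -> u = s) -> h = 0 /\ s <> 0.
  move=> us; have [j1 [s1 [/us -> E1 jh1]]] := (HP m1).1 m1max.
  have [j2 [s2 [/us -> E2 jh2]]] := (HP m2).1 m2max.
  split.
    by case: hE => // hp; case: m12; rewrite E1 E2 jh1 ?jh2.
  move=> s0; apply: m12; rewrite E1 E2 s0; apply: eq_from_tnth => r.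
  by rewrite !pvec_tnth /big /small mulr0 subr0 addr0; case: ifP; case: ifP.
split; first exact: lists_maximizers_ex.
move=> ms l; split.
- move=> [[_ [s [s' [sm sm' ne]]]] bc].
  have [s1 [s2 [s10 s12 SfE sz sp]]] := f_max_pair p_ge2 beta0 h0 Qneg max_ex sm sm' ne.
  have ms1 : Sf s1 by rewrite /Sf SfE; left.
  have ms2 : Sf s2 by rewrite /Sf SfE; right.
  case: hE => [hz|hp].
    exfalso; apply: bc; move: ms1 ms2 s12; rewrite (sz hz) /Sf hz => ms1 ms2 s12.
    by rewrite (beta_c_of_pair p_ge2 (ltW beta0) ms1 s12 ms2).
  exists s1, s2; split => //; first exact: sp.
  rewrite !varF//; exact: law_positive_field.
- move=> [_ [s [sm us]]]; have [hz s0] := uniq_zero s (fun u um => esym (us u um)).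
  have sp : 0 < s by have /andP[? _] := S01 s sm; rewrite lt0r; apply/andP; split => //; apply/eqP.
  exists s; split => //.
    by apply/seteqP; split => [u /us ->|u ->].
  rewrite varF// varO//.
  apply: (@law_zero_field R p beta n p_ge2 beta0 h h0 Qneg max_ex ms s false) => // u; split=> [/us ->|[->|[]]//]; by left.
- move=> [bE hE0]; have z0 : Sf 0.
    by rewrite /Sf hE0 bE; apply: zero_max_at_beta_c; rewrite -?bE.
  have [[s [sm sz]]|N] := pselect (exists s, Sf s /\ s <> 0); last first.
    have [] := uniq_zero 0; last by [].
    by move=> u um; apply: contrapT => u0; apply: N; exists u.
  have [s1 [s2 [s10 s12 SfE sz' sp]]] := f_max_pair p_ge2 beta0 h0 Qneg max_ex z0 sm (nesym sz).
  rewrite (sz' hE0) in s12 SfE s10.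
  have sm2 : Sf s2 by rewrite /Sf SfE; right.
  exists s2; split => //.
  rewrite varF// varO//.
  apply: (@law_zero_field R p beta n p_ge2 beta0 h h0 Qneg max_ex ms s2 true) => // u; rewrite SfE; split=> [[->|->]|[->|[_ ->]]].
  + by right.
  + by left.
  + by right.
  + by left.
Qed.
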